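(* Let $\mathbb{P}$ be the forcing poset consisting of triples $(T,F,A)$ satisfying: (1) $T=(|T|,<_T)$ is a finite tree on $\omega_1$; (2) $F$ is an injective function from the set of maximal nodes of $T$ into $\omega_2$; (3) $A$ is a finite adequate set; (4) if $M\in A$, $a$ and $b$ are distinct maximal nodes of $T$, and $F(a),F(b)\in M$, then every $c$ which is below both $a$ and $b$ in $T$ is in $M$; ordered by $(U,G,B)\le(T,F,A)$ iff $U$ end-extends $T$, $A\subseteq B$, and whenever $a$ is maximal in $T$ there is $b$ maximal in $U$ such that $a\le_U b$ and $F(a)=G(b)$. Then $\mathbb{P}$ is strongly proper on a stationary set.
   Context: Standing assumptions and notation. Assume $2^{\omega_1}=\omega_2$ and fix a bijection $\pi:\omega_2\to H(\omega_2)$. $P_{\omega_1}(\omega_2)$ is the set of countable subsets of $\omega_2$. Assume there is a stationary set $\mathcal{Y}\subseteq P_{\omega_1}(\omega_2)$ which is thin, i.e. for all $\beta<\omega_2$ the set $\{a\cap\beta: a\in\mathcal{Y}\}$ has size at most $\omega_1$; fix such a $\mathcal{Y}$ which is moreover closed under initial segments ($a\in\mathcal{Y}$, $\beta<\omega_2$ imply $a\cap\beta\in\mathcal{Y}$). Let $\mathcal{A}$ be the structure $(H(\omega_2),\in,\pi,\mathcal{Y})$, which has definable Skolem functions (via the well-ordering induced by $\pi$). For $a\subseteq H(\omega_2)$, $Sk(a)$ is the closure of $a$ under a fixed set of definable Skolem functions for $\mathcal{A}$. Let $C$ be the (club) set of $\beta<\omega_2$ with $Sk(\beta)\cap\omega_2=\beta$,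 and let $\Lambda$ be the set of $\beta<\omega_2$ of cofinality $\omega_1$ which are limit points of $C$. Let $\mathcal{X}$ be the set of $M\in\mathcal{Y}$ such that $Sk(M)\cap\omega_2=M$ and for all $\gamma\in M$, $\sup(C\cap\gamma)\in M$. Comparison points and adequacy. Fix a set $\Gamma\subseteq\Lambda$ which is stationary in $\omega_2$. For $M\in\mathcal{X}$, $\Gamma_M$ is the set of $\beta\in\Gamma$ such that $\beta=\min(\Gamma\setminus\sup(M\cap\beta))$, i.e. $\Gamma\cap[\sup(M\cap\beta),\beta)=\emptyset$. For $M,N\in\mathcal{X}$, $\Gamma_M\cap\Gamma_N$ has a largest element, denoted $\beta_{M,N}$. A set $A\subseteq\mathcal{X}$ is adequate if for all $M,N\in A$, either $M\cap\beta_{M,N}=N\cap\beta_{M,N}$, or $M\cap\beta_{M,N}\in Sk(N)$, or $N\cap\beta_{M,N}\in Sk(M)$. Finite trees. A finite tree on $\omega_1$ is a pair $T=(|T|,<_T)$ such that $|T|$ is a finite subset of $\omega_1$; $<_T$ is an irreflexive transitive relation on $|T|$; if $a,b<_T c$ then $a=b$, $a<_T b$ or $b<_T a$; and $a<_T b$ implies $a<b$. $U$ end-extends $T$ if $|T|\subseteq|U|$ and $<_U\cap(|T|\times|T|)=\ <_T$. Strong properness. For a forcing poset $\mathbb{Q}$, a set $N$ and $q\in\mathbb{Q}$, $q$ is strongly $(N,\mathbb{Q})$-generic if every dense subset $D$ of the poset $N\cap\mathbb{Q}$ is predense in $\mathbb{Q}$ below $q$. $\mathbb{Q}$ is strongly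 proper on a stationary set if for every sufficiently large regular cardinal $\theta$ with $\mathbb{Q}\subseteq H(\theta)$, there are stationarily many countable $N\prec H(\theta)$ such that every $p\in N\cap\mathbb{Q}$ has an extension $q\le p$ which is strongly $(N,\mathbb{Q})$-generic. *)

(* Defs.v *)
From HB Require Import structures.
From mathcomp Require Import all_boot all_classical.
From Stdlib Require Import Relation_Operators.

Set Implicit Arguments.
Unset Strict Implicit.
Unset Printing Implicit Defensive.

Local Open Scope classical_set_scope.
Local Open Scope card_scope.

(* The ambient universe of sets is a model of ZFC whose replacement scheme
   ranges over all relations of the metatheory.  Hence every Rocq predicate
   bounded by a set is a set, and cardinality in the sense of the library agrees
   with cardinality in the universe. *)
Record zfc := Zfc {
  carrier :> Type;
  isin : carrier -> carrier -> Prop;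
  ax_extensionality : forall x y, (forall z, isin z x <-> isin z y) -> x = y;
  ax_foundation : forall x, (exists y, isin y x) ->
    exists y, isin y x /\ forall z, isin z y -> ~ isin z x;
  ax_pairing : forall x y, exists p, forall z, isin z p <-> z = x \/ z = y;
  ax_union : forall x, exists u, forall z,
    isin z u <-> exists y, isin z y /\ isin y x;
  ax_power : forall x, exists p, forall z,
    isin z p <-> (forall t, isin t z -> isin t x);
  ax_infinity : exists w,
    (exists e, isin e w /\ forall z, ~ isin z e) /\
    (forall x, isin x w ->
      exists y, isin y w /\ forall z, isin z y <-> isin z x \/ z = x);
  ax_replacement : forall (R : carrier -> carrier -> Prop) x,
    (forall y z z', isin y x -> R y z -> R y z' -> z = z') ->
    exists r, forall z, isin z r <-> exists y, isin y x /\ R y z;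
  ax_choice : forall x, (forall y, isin y x -> exists z, isin z y) ->
    (forall y y' z, isin y x -> isin y' x -> isin z y -> isin z y' -> y = y') ->
    exists c, forall y, isin y x -> exists! z, isin z y /\ isin z c
}.

Notation "x ∈ y" := (isin x y) (at level 70, no associativity).

Lemma zfc_inhabited (V : zfc) : exists x : V, True.
Proof. by case: (ax_infinity V) => w _; exists w. Qed.

(* These instances give access to the description operator [get]. *)
HB.instance Definition _ (V : zfc) := gen_eqMixin (carrier V).
HB.instance Definition _ (V : zfc) := gen_choiceMixin (carrier V).
HB.instance Definition _ (V : zfc) :=
  isPointed.Build (carrier V) (sval (cid (zfc_inhabited V))).

Record language := Language { symbol :> Type; arity : symbol -> nat }.

(* [formula L n]: formulas with free variables among 'I_n; [FAll] binds
   variable [ord0] of its body. *)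
Inductive formula (L : language) : nat -> Type :=
| FBot n : formula L n
| FEq n (i j : 'I_n) : formula L n
| FRel n (s : L) (v : 'I_(arity s) -> 'I_n) : formula L n
| FImp n (f g : formula L n) : formula L n
| FAll n (f : formula L n.+1) : formula L n.

Definition scons (T : Type) n (x : T) (e : 'I_n -> T) : 'I_n.+1 -> T :=
  fun i => oapp e x (unlift ord0 i).

Section Satisfaction.
Context (T : Type) (L : language).
Context (I : forall s : L, ('I_(arity s) -> T) -> Prop).

(* Satisfaction in the structure with domain [D] and relations those of [I]
   restricted to [D]. *)
Fixpoint sat (D : set T) n (f : formula L n) : ('I_n -> T) -> Prop :=
  match f with
  | FBot _ => fun=> False
  | FEq _ i j => fun e => e i = e j
  | FRel _ s v => fun e => I (e \o v)
  | FImp _ f g => fun e => sat D f e -> sat D g e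
  | FAll _ f => fun e => forall x, D x -> sat D f (scons x e)
  end.

Definition elementary_substructure (N D : set T) : Prop :=
  N `<=` D /\
  forall n (f : formula L n) (e : 'I_n -> T), (forall i, N (e i)) ->
    (sat N f e <-> sat D f e).

Definition definable_function (D : set T) n (h : ('I_n -> T) -> T) : Prop :=
  (forall e, (forall i, D (e i)) -> D (h e)) /\
  exists g : formula L n.+1, forall e y, (forall i, D (e i)) -> D y ->
    (sat D g (scons y e) <-> y = h e).

Definition skolem_family :=
  forall n, formula L n.+1 -> ('I_n -> T) -> T.

Definition definable_skolem_functions (D : set T) (sk : skolem_family) : Prop :=
  forall n (f : formula L n.+1),
    definable_function D (sk n f) /\
    forall e, (forall i, D (e i)) -> (exists y, D y /\ sat D f (scons y e)) ->
      sat D f (scons (sk n f e) e).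

Definition skolem_hull (sk : skolem_family) (a : set T) : set T :=
  smallest
    (fun X : set T => forall n (f : formula L n.+1) (e : 'I_n -> T),
       (forall i, X (e i)) -> X (sk n f e)) a.

End Satisfaction.

Section SetTheory.
Context (V : zfc).
Implicit Types (x y z a b k t : V) (A B S : set V).

Definition elts x : set V := [set y | y ∈ x].

(* The set with extension [A] when [A] is not a proper class. *)
Definition toset A : V := get [set x | elts x = A].

Definition cap x y : V := toset (elts x `&` elts y).

Definition opair x y : V :=
  toset [set toset [set x]; toset [set x; y]].

Definition app f x : V := get [set y | opair x y ∈ f].

Definition injection_graph (f : V) A B : Prop :=
  [/\ (forall p, p ∈ f -> exists x y, [/\ p = opair x y, A x & B y]),
      (forall x, A x -> exists! y, opair x y ∈ f) &
      (forall x x' y, opair x y ∈ f -> opair x' y ∈ f -> x = x')].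

Definition tcl x : set V := [set y | clos_trans V (@isin V) y x].

(* H(k), the sets of hereditary cardinality less than the cardinal [k]. *)
Definition Hset k : set V := [set x | ~~ (elts k #<= tcl x)].

Definition ordinal a : Prop :=
  (forall b, b ∈ a -> elts b `<=` elts a) /\
  (forall b c, b ∈ a -> c ∈ b -> elts c `<=` elts b).

Definition ole a b : Prop := a ∈ b \/ a = b.

Definition is_least A a : Prop := A a /\ forall b, A b -> ole a b.

Definition is_greatest A a : Prop := A a /\ forall b, A b -> ole b a.

(* Supremum of a set of ordinals; the empty set has supremum 0. *)
Definition sup A : V := toset (\bigcup_(x in A) elts x).

Definition is_omega1 w1 : Prop :=
  is_least [set a | ordinal a /\ ~ countable (elts a)] w1.

Definition is_omega2 w1 w2 : Prop :=
  is_least [set a | ordinal a /\ ~~ (elts a #<= elts w1)] w2.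

Definition cofinal_map (f : V -> V) k a : Prop :=
  set_fun (elts k) (elts a) f /\
  forall x, x ∈ a -> exists2 i, i ∈ k & ole x (f i).

Definition has_cofinality a k : Prop :=
  is_least [set i | ordinal i /\ exists f, cofinal_map f i a] k.

Definition regular_cardinal t : Prop :=
  [/\ ordinal t, infinite_set (elts t) & has_cofinality t t].

Definition limit_point A a : Prop :=
  (exists b, b ∈ a) /\
  forall b, b ∈ a -> exists c, [/\ A c, c ∈ a & b ∈ c].

Definition club_in k A : Prop :=
  [/\ A `<=` elts k,
      (forall a, a ∈ k -> exists2 b, A b & a ∈ b) &
      (forall a, a ∈ k -> limit_point A a -> A a)].

Definition stationary_in k S : Prop :=
  forall A, club_in k A -> S `&` A !=set0.

Definition Pomega1 (X : set V) : set V :=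
  [set a | elts a `<=` X /\ countable (elts a)].

Definition club_Pomega1 (X : set V) A : Prop :=
  [/\ A `<=` Pomega1 X,
      (forall a, Pomega1 X a -> exists2 b, A b & elts a `<=` elts b) &
      (forall c : nat -> V, (forall n, A (c n)) ->
         (forall n, elts (c n) `<=` elts (c n.+1)) ->
         A (toset (\bigcup_n elts (c n))))].

Definition stationary_Pomega1 (X : set V) S : Prop :=
  forall A, club_Pomega1 X A -> S `&` A !=set0.

Definition thin w1 w2 S : Prop :=
  forall b, b ∈ w2 -> [set cap a b | a in S] #<= elts w1.

Section Forcing.
Context (Q : set V) (leQ : V -> V -> Prop).

Definition dense_in (P D : set V) : Prop :=
  D `<=` P /\ forall p, P p -> exists2 d, D d & leQ d p.

Definition predense_below (D : set V) (q : V) : Prop :=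
  forall r, Q r -> leQ r q ->
    exists d s, [/\ D d, Q s, leQ s d & leQ s r].

Definition strongly_generic (N : set V) (q : V) : Prop :=
  forall D, dense_in (N `&` Q) D -> predense_below D q.

Definition lang_set : language := @Language unit (fun=> 2).

Definition isin_interp (s : lang_set) : ('I_(arity s) -> V) -> Prop :=
  fun e => e ord0 ∈ e ord_max.

Definition strongly_proper_on_stationary_set : Prop :=
  exists t0, ordinal t0 /\
  forall t, regular_cardinal t -> t0 ∈ t -> Q `<=` Hset t ->
  stationary_Pomega1 (Hset t)
    [set N | elementary_substructure isin_interp (elts N) (Hset t) /\
       forall p, (elts N `&` Q) p ->
         exists q, [/\ Q q, leQ q p & strongly_generic (elts N) q]].

End Forcing.

Variant symbolA := InA | PiA | YA.

Definition langA : language :=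
  @Language symbolA (fun s => if s is YA then 1 else 2).

(* [pi] is interpreted by its graph, since its domain is [w2] and not H(w2);
   its values outside [w2] play no role. *)
Definition interpA (w2 : V) (pi : V -> V) (Y : set V) (s : langA) :
    ('I_(arity s) -> V) -> Prop :=
  match s with
  | InA => fun e => e ord0 ∈ e ord_max
  | PiA => fun e => e ord0 ∈ w2 /\ e ord_max = pi (e ord0)
  | YA => fun e => Y (e ord0)
  end.

Section Adequate.
Context (w1 w2 : V) (Y : set V) (sk : skolem_family V langA) (Gamma : set V).

Definition Sk (a : set V) : set V := skolem_hull sk a.

Definition Cset : set V :=
  [set b | b ∈ w2 /\ Sk (elts b) `&` elts w2 = elts b].

Definition Lambda : set V :=
  [set b | [/\ b ∈ w2, has_cofinality b w1 & limit_point Cset b]].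

Definition Xset : set V :=
  [set M | [/\ Y M, Sk (elts M) `&` elts w2 = elts M &
               forall c, c ∈ M -> sup (Cset `&` elts c) ∈ M]].

Definition GammaM (M : V) : set V :=
  [set b | Gamma b /\ is_least (Gamma `\` elts (sup (elts (cap M b)))) b].

Definition comparison_point (M N : V) : V :=
  get (is_greatest (GammaM M `&` GammaM N)).

Definition adequate (A : set V) : Prop :=
  A `<=` Xset /\
  forall M N, A M -> A N -> let b := comparison_point M N in
    [\/ cap M b = cap N b,
        Sk (elts N) (cap M b) |
        Sk (elts M) (cap N b)].

(* A tree is given by its set [T] of nodes and the set [R] of ordered pairs
   in its order. *)
Definition tlt (R x y : V) : Prop := opair x y ∈ R.

Definition finite_tree (T R : V) : Prop :=
  [/\ elts T `<=` elts w1, finite_set (elts T) &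
      (forall p, p ∈ R -> exists x y, [/\ p = opair x y, x ∈ T & y ∈ T])] /\
  [/\ (forall x, ~ tlt R x x),
      (forall x y z, tlt R x y -> tlt R y z -> tlt R x z),
      (forall x y z, tlt R x z -> tlt R y z ->
         [\/ x = y, tlt R x y | tlt R y x]) &
      (forall x y, tlt R x y -> x ∈ y)].

Definition maximal_node (T R : V) : set V :=
  [set x | x ∈ T /\ forall y, ~ tlt R x y].

Definition end_extends (T' R' T R : V) : Prop :=
  elts T `<=` elts T' /\
  forall x y, x ∈ T -> y ∈ T -> (tlt R' x y <-> tlt R x y).

Definition triple (T R F A : V) : V := opair (opair (opair T R) F) A.

Definition is_condition (T R F A : V) : Prop :=
  [/\ finite_tree T R,
      injection_graph F (maximal_node T R) (elts w2),
      finite_set (elts A) /\ adequate (elts A) &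
      forall M a b, M ∈ A ->
        maximal_node T R a -> maximal_node T R b -> a <> b ->
        app F a ∈ M -> app F b ∈ M ->
        forall c, tlt R c a -> tlt R c b -> c ∈ M].

Definition poset : set V :=
  [set p | exists T R F A : V, p = triple T R F A /\ is_condition T R F A].

Definition poset_le (q p : V) : Prop :=
  exists T R F A T' R' F' A' : V,
    [/\ p = triple T R F A, q = triple T' R' F' A',
        end_extends T' R' T R,
        elts A `<=` elts A' &
        forall a, maximal_node T R a -> exists b,
          [/\ maximal_node T' R' b, a = b \/ tlt R' a b & app F a = app F' b]].

End Adequate.
End SetTheory.

(* Main.v *)
(* Let N be a countable elementary submodel of H(t) with M0 = N /\ w2 in X, and
   let q be the condition p of N with M0 added to its models.  To see that q is
   strongly generic, take r <= q and raise its maximal nodes out of N.  For the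
   models M of r with M /\ beta in Sk(M0), where beta is the comparison point of
   M and M0, the finite configuration consisting of r, its nodes, its values,
   these M, beta and M /\ beta is copied into N by a map [bar] that fixes
   what is already in N and preserves all relevant relations.  Let w be the copy
   of r.  Any s <= w in N is compatible with r: put a node of r outside N above
   the nodes of s that it is forced to dominate.  Copying the models M themselves,
   rather than their initial segments M /\ beta, is what makes the separation
   clause (4) hold in the amalgam: a violation by M, between a new value of s in M
   and a value of r in M \ N, would already show in s and the copy of M.  Since
   [bar M] end-extends M /\ beta, it also replaces closure under M |-> M /\ beta
   in the amalgamation of adequate sets. *)
Require Import Defs.
From mathcomp Require Import all_boot all_classical.
From Stdlib Require Import Relation_Operators.
Import Defs.

Set Implicit Arguments.
Unset Strict Implicit.
Unset Printing Implicit Defensive.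

Local Open Scope classical_set_scope.
Local Open Scope card_scope.

(** * Sets and ordinals *)

Section Sets.
Context (V : zfc).
Implicit Types (x y z a b c : V) (A B : set V).

(** The language of H(t) has only [∈], while the configuration to be copied speaks of the poset, of
    comparison points and of [Gamma]. So N is more than elementary: it is a hull closed under chosen
    realisations of all finite diagrams of the relations in [atom]. Every club of countable subsets
    of H(t) contains such a hull, because Y is stationary and, for club many a, the hull of a adds
    no ordinals of w2 to a. Maximal nodes of r leave N because one inside N could acquire nodes of s
    above it. A top a with F(a) in N then shares its value with a top of s extending the copy of a;
    injectivity of the labelling forces that top of s below a. The result is still a tree because M0
    is a model of r: by clause (4) two tops with values in N have no common lower bound outside N,
    so no node outside N has to dominate two tops of s. Thinness of Y enters through one fact: a
    member of Y that is in Sk(N) and is included in some beta of Gamma lies already in Sk(N /\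
    beta). It moves initial segments between hulls when adequate sets are amalgamated. *)

Lemma eltsE x y : elts x y = (y ∈ x). Proof. by []. Qed.

Lemma elts_inj x y : elts x = elts y -> x = y.
Proof.
move=> e; apply: ax_extensionality => z.
by rewrite -[isin z x]/(elts x z) e.
Qed.

Lemma tosetE A : (exists x, elts x = A) -> elts (toset A) = A.
Proof. by case=> x xA; apply: (@xgetPex _ point [set x | elts x = A]); exists x. Qed.

Lemma toset_elts x : toset (elts x) = x.
Proof. by apply: elts_inj; apply: tosetE; exists x. Qed.

(** Replacement needs a domain that is a set. The type [T] becomes one by being injected into [x]
    through [g]; the relation from [g t] to [f t] is then functional. *)
Lemma set_image (T : Type) (f : T -> V) (g : T -> V) (B : set T) x :
  (forall t t', B t -> B t' -> g t = g t' -> t = t') ->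
  (forall t, B t -> g t ∈ x) -> exists y, elts y = f @` B.
Proof.
move=> ginj gx.
have [|r rP] := @ax_replacement V
    (fun u v => exists t, [/\ B t, g t = u & f t = v]) x.
  move=> u v v' _ [t [Bt tu tv]] [t' [Bt' tu' tv']].
  by rewrite -tv -tv' (ginj t t') // tu tu'.
exists r; apply/seteqP; split=> z.
  by move=> /rP[u [_ [t [Bt _ <-]]]]; exists t.
by case=> t Bt <-; apply/rP; exists (g t); split; [exact: gx | exists t].
Qed.

Lemma set_sub A x : A `<=` elts x -> exists y, elts y = A.
Proof.
move=> Ax; have [||y yE] := @set_image V id id A x; first by move=> t t'.
  by move=> t /Ax.
by exists y; rewrite yE image_id.
Qed.

Lemma in_toset_sub A x y : A `<=` elts x -> (y ∈ toset A) = A y.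
Proof.
move=> /set_sub/tosetE e; by rewrite -[y ∈ _]/(elts (toset A) y) e.
Qed.

Lemma elts_cap x y : elts (cap x y) = elts x `&` elts y.
Proof. by apply: tosetE; apply: (@set_sub _ x) => z []. Qed.

Lemma in_cap x y z : (z ∈ cap x y) = (z ∈ x /\ z ∈ y).
Proof. by rewrite -[z ∈ _]/(elts (cap x y) z) elts_cap. Qed.

Lemma elts_pair x y : exists p, elts p = [set x; y].
Proof.
have [p pP] := ax_pairing x y; exists p; apply/seteqP; split=> z.
  by move=> /pP.
by move=> ?; apply/pP.
Qed.

Lemma elts_pairE x y : elts (toset [set x; y]) = [set x; y].
Proof. by apply: tosetE; apply: elts_pair. Qed.

Lemma elts_single x : elts (toset [set x]) = [set x].
Proof. by apply: tosetE; have [p] := elts_pair x x; rewrite setUid; exists p. Qed.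

Lemma elts_opair x y :
  elts (opair x y) = [set toset [set x]; toset [set x; y]].
Proof. exact: elts_pairE. Qed.

Lemma single_inj x y : toset [set x] = toset [set y] -> x = y.
Proof.
move=> /(congr1 (@elts V)); rewrite !elts_single => e.
by have : [set y] x by rewrite -e.
Qed.

Lemma pair_injr x y z : toset [set x; y] = toset [set x; z] -> y = z.
Proof.
move=> /(congr1 (@elts V)); rewrite !elts_pairE => e.
have : [set x; z] y by rewrite -e; right.
have : [set x; y] z by rewrite e; right.
by case=> /= -> // [->|->].
Qed.

Lemma single_pair x y z : toset [set x] = toset [set y; z] -> x = y /\ x = z.
Proof.
move=> /(congr1 (@elts V)); rewrite elts_single elts_pairE => e.
have yx : [set x] y by rewrite e; left.
have zx : [set x] z by rewrite e; right.
by rewrite yx zx.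
Qed.

Lemma opair_inj x y x' y' : opair x y = opair x' y' -> x = x' /\ y = y'.
Proof.
move=> e; have e1 : x = x'.
  have : elts (opair x y) (toset [set x]) by rewrite elts_opair; left.
  by rewrite e elts_opair => -[/single_inj|/single_pair[]].
subst x'; split=> //.
have hy : elts (opair x y) (toset [set x; y]) by rewrite elts_opair; right.
have hy' : elts (opair x y') (toset [set x; y']) by rewrite elts_opair; right.
rewrite e elts_opair in hy; rewrite -e elts_opair in hy'.
case: hy => [/esym/single_pair[_ xy]|/pair_injr //].
by case: hy' => [/esym/single_pair[_ xy']|/pair_injr //]; rewrite -xy -xy'.
Qed.

Lemma union_set x : exists u, elts u = \bigcup_(y in elts x) elts y.
Proof.
have [u uP] := ax_union x; exists u; apply/seteqP; split=> z.
  by move=> /uP[y [zy yx]]; exists y.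
by case=> y yx zy; apply/uP; exists y.
Qed.

Lemma elts_setU x y : exists u, elts u = elts x `|` elts y.
Proof.
have [u uP] := union_set (toset [set x; y]); exists u.
by rewrite uP elts_pairE bigcup_setU !bigcup_set1.
Qed.

Lemma set0_set : exists x : V, elts x = set0.
Proof.
have [w [[e [_ eP]] _]] := ax_infinity V; exists e.
by apply/seteqP; split=> z // /eP.
Qed.

Lemma isin_irr x : ~ x ∈ x.
Proof.
move=> xx; have [|y []] := ax_foundation (x := toset [set x]).
  by exists x; rewrite -[_ ∈ _]/(elts _ _) elts_single.
rewrite -[y ∈ _]/(elts _ _) elts_single => /= -> /(_ x xx).
by rewrite -[_ ∈ _]/(elts _ _) elts_single; apply.
Qed.

Lemma isin_asym x y : x ∈ y -> ~ y ∈ x.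
Proof.
move=> xy yx; have [|z []] := ax_foundation (x := toset [set x; y]).
  by exists x; rewrite -[_ ∈ _]/(elts _ _) elts_pairE; left.
rewrite -[z ∈ _]/(elts _ _) elts_pairE.
case=> -> h; [apply: (h y yx)|apply: (h x xy)];
  rewrite -[_ ∈ _]/(elts _ _) elts_pairE; by [left|right].
Qed.

Definition succ x : V := toset (elts x `|` [set x]).

Lemma elts_succ x : elts (succ x) = elts x `|` [set x].
Proof.
apply: tosetE; rewrite -(elts_single x); exact: elts_setU.
Qed.

Lemma in_succ x y : (y ∈ succ x) = (y ∈ x \/ y = x).
Proof. by rewrite -[LHS]/(elts _ _) elts_succ. Qed.

Lemma succ_inj x y : succ x = succ y -> x = y.
Proof.
move=> e; have : y ∈ succ x by rewrite e in_succ; right.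
have : x ∈ succ y by rewrite -e in_succ; right.
by rewrite !in_succ => -[xy [yx|//]|//]; case: (isin_asym xy).
Qed.

Fixpoint num n : V := if n is n'.+1 then succ (num n') else toset set0.

Lemma num_omega : exists w : V, forall n, num n ∈ w.
Proof.
have [w [[e [ew eP]] wS]] := ax_infinity V; exists w; elim=> [|n IH] /=.
  suff -> : toset set0 = e by [].
  apply: elts_inj; rewrite tosetE; last exact: set0_set.
  by apply/seteqP; split=> z // /eP.
have [y [yw yP]] := wS _ IH; suff -> : succ (num n) = y by [].
by apply: ax_extensionality => z; rewrite in_succ; split=> /yP.
Qed.

Lemma num_lt m n : (m < n)%N -> num m ∈ num n.
Proof.
elim: n => // n IH; rewrite ltnS leq_eqVlt => /orP[/eqP->|/IH] /=; rewrite in_succ; by [right|left].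
Qed.

Lemma num_inj : injective num.
Proof.
move=> m n e; case: (ltngtP m n) => // /num_lt; rewrite e => /isin_irr //.
Qed.

(** The natural numbers of the metatheory embed through [num] into the set given by infinity, so
    [set_image] reaches every countable class. *)
Lemma countable_set A : countable A -> exists y, elts y = A.
Proof.
move=> /countable_injP[g gI]; have [w wP] := num_omega.
have [||y yE] := @set_image V id (num \o g) A w.
- move=> t t' At At' /num_inj/gI; apply; exact/mem_set.
- by move=> t _; exact: wP.
by exists y; rewrite yE image_id.
Qed.

Lemma finite_set_set A : finite_set A -> exists y, elts y = A.
Proof. by move=> /finite_set_countable/countable_set. Qed.

Lemma least_in A a : A a -> exists2 m, (m = a \/ m ∈ a) /\ A m &
  forall z, z ∈ a -> A z -> ~ z ∈ m.
Proof.
move=> Aa; have [[b [ba Ab]]|N] := pselect (exists b, b ∈ a /\ A b); last first.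
  by exists a; [split=> //; left|move=> z za Az; case: N; exists z].
have [|m [mP mm]] := ax_foundation (x := toset (elts a `&` A)).
  by exists b; rewrite (@in_toset_sub _ a) // => ? [].
move: mP; rewrite (@in_toset_sub _ a) => [|? []//] [ma Am].
exists m; [by split=> //; right|move=> z za Az zm].
by apply: (mm z zm); rewrite (@in_toset_sub _ a) // => ? [].
Qed.

Lemma tclP x y : tcl x y <-> y ∈ x \/ exists2 z, z ∈ x & tcl z y.
Proof.
split; last first.
  case=> [yx|[z zx yz]]; first exact: t_step.
  by apply: t_trans yz _; exact: t_step.
rewrite /tcl /=; elim=> {x y} [x y xy|x y z xy [xy'|[t ty xt]] yz [yz'|[u uz yu]]].
- by left.
- by right; exists y.
- by right; exists u => //; apply: t_trans xy yu.
- by right; exists y.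
by right; exists u => //; apply: t_trans xy yu.
Qed.

Lemma tcl_sub x y : x ∈ y -> tcl x `<=` tcl y.
Proof. by move=> xy z zx; apply/tclP; right; exists x. Qed.

Lemma Hset_trans k x y : x ∈ y -> Hset k y -> Hset k x.
Proof.
move=> xy; rewrite /Hset /=; apply: contra => kx.
exact: card_le_trans kx (subset_card_le (tcl_sub xy)).
Qed.

End Sets.

(** * Von Neumann ordinals *)

Section Ordinals.
Context (V : zfc).
Implicit Types (x y z a b c : V) (A B : set V).

Lemma ord_in a b : ordinal a -> b ∈ a -> ordinal b.
Proof.
move=> [a1 a2] ba; split; first by move=> c cb; exact: (a2 b).
by move=> c d cb; apply: a2; apply: (a1 b ba).
Qed.

Lemma ord_trans a b c : ordinal c -> a ∈ b -> b ∈ c -> a ∈ c.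
Proof. by move=> [c1 _] ab bc; exact: (c1 b bc). Qed.

Lemma ord_transitive a b : ordinal a -> b ∈ a -> elts b `<=` elts a.
Proof. by case=> + _; exact. Qed.

Lemma ord_least A a : ordinal a -> A a ->
  exists m, [/\ A m, ordinal m & forall z, z ∈ m -> ~ A z].
Proof.
move=> oa Aa; have [m [ma Am] mm] := least_in Aa.
have om : ordinal m by case: ma => [->//|ma]; exact: ord_in oa ma.
exists m; split=> // z zm Az; apply: (mm z) => //.
case: ma => [<- //|ma]; exact: ord_trans oa zm ma.
Qed.

(** Take [m] least among the ordinals incomparable with something, then [n] least among those
    incomparable with [m]. Minimality makes each a subset of the other, so they are equal. *)
Lemma ord_total a b : ordinal a -> ordinal b -> [\/ a ∈ b, a = b | b ∈ a].
Proof.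
move=> oa ob; apply: contrapT => N.
pose P a b := ~ [\/ a ∈ b, a = b | b ∈ a].
have [m [[b' [ob' mb']] om mm]] :=
  ord_least (A := [set a | exists b, ordinal b /\ P a b]) oa (ex_intro _ b (conj ob N)).
have [n [mn on nn]] := ord_least (A := [set b | P m b]) ob' mb'.
apply: (mn); apply: Or32; apply: elts_inj; apply/seteqP; split=> z.
  move=> zm; have oz := ord_in om zm; apply: contrapT => zn; apply: (mm z zm).
  exists n; split=> // -[//|e|nz]; apply: mn.
    by subst z; apply: Or33.
  by apply: Or33; exact: ord_trans om nz zm.
move=> zn; have oz := ord_in on zn; apply: contrapT => zm; apply: (nn z zn).
case=> [mz|e|//]; apply: mn; last by subst z; apply: Or31.
by apply: Or31; exact: ord_trans on mz zn.
Qed.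

Lemma ole_sub a b : ordinal b -> ole a b -> elts a `<=` elts b.
Proof. by move=> ob [/(ord_transitive ob)|->]. Qed.

Lemma ord_leNgt a b : ordinal a -> ordinal b -> ~ a ∈ b -> ole b a.
Proof. by move=> oa ob; case: (ord_total oa ob); [|right|left]. Qed.

Lemma sub_ole a b : ordinal a -> ordinal b -> elts a `<=` elts b -> ole a b.
Proof.
move=> oa ob ab; apply: ord_leNgt => // ba; exact: (isin_irr (ab _ ba)).
Qed.

Lemma ole_trans a b c : ordinal c -> ole a b -> ole b c -> ole a c.
Proof.
move=> oc ab [bc|<-//]; left; case: ab => [ab|->//]; exact: ord_trans oc ab bc.
Qed.

Lemma ole_lt_trans a b c : ordinal c -> ole a b -> b ∈ c -> a ∈ c.
Proof. by move=> oc [ab|->//] bc; exact: ord_trans oc ab bc. Qed.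

Lemma lt_ole_trans a b c : ordinal c -> a ∈ b -> ole b c -> a ∈ c.
Proof. by move=> oc ab [bc|<-//]; exact: ord_trans oc ab bc. Qed.

Lemma ole_notin a b : ole a b -> ~ b ∈ a.
Proof. by case=> [/isin_asym|->] // /isin_irr. Qed.

Lemma ord_succ a : ordinal a -> ordinal (succ a).
Proof.
move=> oa; split=> [b|b c]; rewrite in_succ => -[ba|->].
- by move=> c cb; rewrite eltsE in_succ; left; exact: ord_trans oa cb ba.
- by move=> c ca; rewrite eltsE in_succ; left.
- by move=> cb; exact: (ord_transitive (ord_in oa ba)).
- exact: (ord_transitive oa).
Qed.

Lemma ord_bigcup a A : (forall b, A b -> ordinal b) ->
  elts a = \bigcup_(b in A) elts b -> ordinal a.
Proof.
move=> oA e; have aP z : z ∈ a -> exists2 b, A b & z ∈ b.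
  by rewrite -[z ∈ a]/(elts a z) e => -[b Ab zb]; exists b.
split=> [z /aP[b Ab zb] t tz|z t /aP[b Ab zb]].
  by rewrite e; exists b => //; exact: (ord_trans (oA _ Ab) tz zb).
exact: ord_transitive (ord_in (oA _ Ab) zb).
Qed.

Lemma num_ord n : ordinal (num V n).
Proof.
elim: n => [|n IH] /=; last exact: ord_succ.
by split=> b; rewrite -[b ∈ _]/(elts _ b) tosetE //; exact: set0_set.
Qed.

Lemma tcl_ord a : ordinal a -> tcl a = elts a.
Proof.
move=> oa; apply/seteqP; split=> y; last by move=> ya; apply: t_step.
rewrite /tcl /= => h; elim: h oa => {a y} [y a //|x y z _ IH1 _ IH2 oz].
have yz := IH2 oz; exact: ord_trans oz (IH1 (ord_in oz yz)) yz.
Qed.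

End Ordinals.

(** * Cardinality *)

Lemma card_leI (T U : Type) (A : set T) (B : set U) (f : T -> U) :
  (forall x, A x -> B (f x)) ->
  (forall x y, A x -> A y -> f x = f y -> x = y) -> A #<= B.
Proof.
move=> fB fI; have [g] : $|{injfun A >-> B}|.
  by apply/injfunPex; exists f => // x y /set_mem Ax /set_mem Ay; exact: fI.
exact: inj_card_le g.
Qed.

Lemma card_leE (T : Type) (U : pointedType) (A : set T) (B : set U) :
  A #<= B -> exists f : T -> U, (forall x, A x -> B (f x)) /\
    (forall x y, A x -> A y -> f x = f y -> x = y).
Proof.
move=> /pcard_leP[f]; exists f; split=> [x Ax|x y Ax Ay]; first exact: funS.
by apply: (@inj _ _ A f); exact/mem_set.
Qed.

Lemma countableE (T : Type) (A : set T) : countable A ->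
  exists f : T -> nat, forall x y, A x -> A y -> f x = f y -> x = y.
Proof.
move=> /countable_injP[f fI]; exists f => x y Ax Ay.
by apply: fI; exact/mem_set.
Qed.

Lemma countableI (T : Type) (U : countType) (A : set T) (f : T -> U) :
  (forall x y, A x -> A y -> f x = f y -> x = y) -> countable A.
Proof.
move=> fI; apply/countable_injP; exists (pickle \o f) => x y /set_mem Ax /set_mem Ay.
by move=> /(pcan_inj pickleK); exact: fI.
Qed.

Lemma sub_countableS (T : Type) (A B : set T) : A `<=` B -> countable B -> countable A.
Proof. by move=> /subset_card_le; exact: sub_countable. Qed.

Lemma countable_img (T U : Type) (f : T -> U) (A : set T) :
  countable A -> countable (f @` A).
Proof. exact/sub_countable/card_image_le. Qed.

Lemma countable_range (T : countType) (U : Type) (f : T -> U) : countable (range f).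
Proof. exact/countable_img/countableP. Qed.

(** * Arithmetic of the first uncountable cardinal *)

Section Omega1.
Context (V : zfc) (w1 : V) (w1P : is_omega1 w1).
Implicit Types (x y z a b c : V) (A B : set V).

Lemma w1_ord : ordinal w1. Proof. by case: w1P => -[]. Qed.

Lemma w1_uncountable : ~ countable (elts w1). Proof. by case: w1P => -[]. Qed.

Lemma in_w1_countable a : a ∈ w1 -> countable (elts a).
Proof.
move=> aw; apply: contrapT => na; case: w1P => _ /(_ a) [|wa|wa].
- by split=> //; exact: ord_in w1_ord aw.
- exact: (isin_asym wa aw).
- by rewrite wa in aw; exact: (isin_irr aw).
Qed.

Lemma countable_in_w1 a : ordinal a -> countable (elts a) -> a ∈ w1.
Proof.
move=> oa ca; apply: contrapT => /(ord_leNgt oa w1_ord) /(ole_sub oa) wa.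
apply: w1_uncountable; exact: sub_countableS wa ca.
Qed.

Lemma in_w1P a : a ∈ w1 <-> ordinal a /\ countable (elts a).
Proof.
split=> [aw|[]]; last exact: countable_in_w1.
by split; [exact: ord_in w1_ord aw | exact: in_w1_countable].
Qed.

Lemma countableU (T : Type) (A B : set T) : countable A -> countable B -> countable (A `|` B).
Proof.
move=> cA cB; rewrite -bigcup2E; apply: bigcup_countable => //.
by move=> [|[|n]] _ //=; exact: countable0.
Qed.

Lemma succ_in_w1 a : a ∈ w1 -> succ a ∈ w1.
Proof.
move=> /in_w1P[oa ca]; apply/in_w1P; split; first exact: ord_succ.
by rewrite elts_succ; apply: countableU => //; exact: countable1.
Qed.

Lemma countable_le_w1 (T : Type) (A : set T) : countable A -> A #<= elts w1.
Proof.
move=> cA; apply: card_le_trans cA _.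
apply: (@card_leI _ _ _ _ (num V)) => [n _|m n _ _ /num_inj //].
apply: countable_in_w1; first exact: num_ord.
elim: n => [|n IH] /=; first by rewrite tosetE; [exact: countable0|exact: set0_set].
by rewrite elts_succ; apply: countableU => //; exact: countable1.
Qed.

Lemma iter_succ_inj i j l l' :
  (forall x, l <> succ x) -> (forall x, l' <> succ x) ->
  iter i (@succ V) l = iter j (@succ V) l' -> i = j /\ l = l'.
Proof.
move=> hl hl'; elim: i j => [|i IH] [|j] //=; first by move=> /hl.
  by move=> /esym/hl'.
by move=> /succ_inj/IH[-> ->].
Qed.

Lemma ord_iter_succ a : ordinal a -> exists p : nat * V,
  [/\ forall x, p.2 <> succ x, ole p.2 a & a = iter p.1 (@succ V) p.2].
Proof.
move=> oa; apply: contrapT => na.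
have [m [nm om mm]] := ord_least (A := [set a | ~ exists p : nat * V,
  [/\ forall x, p.2 <> succ x, ole p.2 a & a = iter p.1 (@succ V) p.2]]) oa na.
apply: nm; have [[x mx]|N] := pselect (exists x, m = succ x); last first.
  by exists (0, m); split=> //= [x mx|]; [apply: N; exists x|right].
have xm : x ∈ m by rewrite mx in_succ; right.
have /contrapT[[k l] [/= hl lx xe]] := mm _ xm.
by exists (k.+1, l); split=> //=; [exact: ole_trans om lx (or_introl xm)|rewrite -xe].
Qed.

(* Every ordinal is a finite successor of a nonsuccessor, so that w1 is a
   multiple of nat. *)
Lemma w1_nat : elts w1 `*` [set: nat] #<= elts w1.
Proof.
have /choice[d dP] : forall a, exists p : nat * V, a ∈ w1 ->
    [/\ forall x, p.2 <> succ x, ole p.2 a & a = iter p.1 (@succ V) p.2].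
  move=> a; have [aw|] := pselect (a ∈ w1); last by exists (0, a).
  by have [p pP] := ord_iter_succ (ord_in w1_ord aw); exists p.
apply: (@card_leI _ _ _ _
  (fun q => iter (pickle ((d q.1).1, q.2)) (@succ V) (d q.1).2)).
  move=> [a n] [/= aw _]; have [_ la _] := dP a aw.
  elim: (pickle _) => [|k IH] /=; last exact: succ_in_w1.
  exact: ole_lt_trans w1_ord la aw.
move=> [a n] [b m] [/= aw _] [/= bw _].
have [la _ ea] := dP a aw; have [lb _ eb] := dP b bw.
move=> /(iter_succ_inj la lb)[/(pcan_inj pickleK)[e1 ->] e2].
by rewrite ea eb e1 e2.
Qed.

(** A pair is coded by its larger coordinate and the number of the smaller one in an enumeration of
    the larger; the parity tells which coordinate is the larger. The second branch enumerates
    [succ p.1], since there the coordinates may be equal. *)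
Lemma w1_square : elts w1 `*` elts w1 #<= elts w1.
Proof.
apply: card_le_trans w1_nat.
have /choice[f fP] : forall a, exists f : V -> nat, a ∈ w1 ->
    forall x y, x ∈ a -> y ∈ a -> f x = f y -> x = y.
  move=> a; have [aw|] := pselect (a ∈ w1); last by exists (fun=> 0%N).
  by have [f fP] := countableE (in_w1_countable aw); exists f.
pose h (p : V * V) := if `[<p.1 ∈ p.2>] then (p.2, (f p.2 p.1).*2)
  else (p.1, (f (succ p.1) p.2).*2.+1).
apply: (@card_leI _ _ _ _ h) => [[a b] [/= aw bw]|].
  by rewrite /h /=; case: asboolP.
move=> [a b] [a' b'] [/= aw bw] [/= aw' bw']; rewrite /h /=.
have ow := w1_ord; have oa := ord_in ow aw; have oa' := ord_in ow aw'.
have ob := ord_in ow bw; have ob' := ord_in ow bw'.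
have odd_ne i j : i.*2 = j.*2.+1 -> False.
  by move=> /(congr1 odd); rewrite /= !odd_double.
have le_in c d : ordinal c -> ordinal d -> ~ c ∈ d -> d ∈ succ c.
  by move=> oc od cd; rewrite in_succ; exact: ord_leNgt.
case: asboolP => ab; case: asboolP => ab' [].
- move=> e /double_inj; rewrite -e => /fP -> //; by rewrite ?e // e.
- by move=> _ /odd_ne.
- by move=> _ /esym/odd_ne.
move=> e [/double_inj]; rewrite -e => /fP -> //; first exact: succ_in_w1.
- exact: le_in.
- by rewrite e; exact: le_in.
Qed.

Lemma w1_bigcup (I T : Type) (D : set I) (F : I -> set T) :
  D #<= elts w1 -> (forall i, D i -> F i #<= elts w1) ->
  \bigcup_(i in D) F i #<= elts w1.
Proof.
move=> /card_leE[g [gw gI]] FP; apply: card_le_trans w1_square.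
have /choice[f fP] : forall i, exists f : T -> V, D i ->
    (forall t, F i t -> f t ∈ w1) /\
    (forall t u, F i t -> F i u -> f t = f u -> t = u).
  move=> i; have [Di|] := pselect (D i); last by exists (fun=> point).
  by have [f fP] := card_leE (FP _ Di); exists f.
have /choice[k kP] : forall t, exists p : V * V, (\bigcup_(i in D) F i) t ->
    exists i, [/\ D i, F i t & p = (g i, f i t)].
  move=> t; have [[i Di Ft]|N] := pselect ((\bigcup_(i in D) F i) t).
    by exists (g i, f i t) => _; exists i.
  by exists (point, point) => /N.
apply: (@card_leI _ _ _ _ k) => [t /kP[i [Di Ft ->]]|t u].
  by split=> /=; [exact: gw|exact: (fP i Di).1].
move=> /kP[i [Di Ft ->]] /kP[j [Dj Fu ->]] [/(gI _ _ Di Dj) e].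
by subst j; exact: (fP i Di).2.
Qed.

Lemma w1_setU (T : Type) (A B : set T) :
  A #<= elts w1 -> B #<= elts w1 -> A `|` B #<= elts w1.
Proof.
move=> cA cB; rewrite -bigcup2E; apply: w1_bigcup.
  exact: countable_le_w1.
by move=> [|[|n]] _ //=; exact: card_ge0.
Qed.

End Omega1.

(** * Ordinals and hereditary cardinality below omega2 *)

Section Omega2.
Context (V : zfc) (w1 w2 : V) (w1P : is_omega1 w1) (w2P : is_omega2 w1 w2).
Implicit Types (x y z a b c : V) (A B : set V).

Lemma w2_ord : ordinal w2. Proof. by case: w2P => -[]. Qed.

Lemma w2_not_le : ~ (elts w2 #<= elts w1).
Proof. by case: w2P => -[_] /negP. Qed.

Lemma in_w2P a : a ∈ w2 <-> ordinal a /\ elts a #<= elts w1.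
Proof.
split=> [aw|[oa ca]].
  have oa := ord_in w2_ord aw; split=> //; apply: contrapT => na.
  case: w2P => _ /(_ a); case; first by split=> //; exact/negP.
    by move=> /isin_asym/(_ aw).
  by move=> e; rewrite e in aw; exact: (isin_irr aw).
apply: contrapT => /(ord_leNgt oa w2_ord) /(ole_sub oa) wa.
by apply: w2_not_le; exact: card_le_trans (subset_card_le wa) ca.
Qed.

Lemma w1_in_w2 : w1 ∈ w2.
Proof. by apply/in_w2P; split; [exact: w1_ord|exact: card_lexx]. Qed.

Lemma succ_in_w2 a : a ∈ w2 -> succ a ∈ w2.
Proof.
move=> /in_w2P[oa ca]; apply/in_w2P; split; first exact: ord_succ.
rewrite elts_succ; apply: w1_setU => //.
by apply: countable_le_w1 => //; exact: countable1.
Qed.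

(* The sets of hereditary cardinality at most omega1; they all belong to
   H(omega2), and showing this needs no cardinal arithmetic beyond
   omega1 x omega1 = omega1. *)
Definition HC : set V := [set x | tcl x #<= elts w1].

Lemma HC_Hset x : HC x -> Hset w2 x.
Proof.
move=> cx; apply/negP => wx; apply: w2_not_le; exact: card_le_trans wx cx.
Qed.

Lemma HC_intro x : elts x #<= elts w1 -> elts x `<=` HC -> HC x.
Proof.
move=> cx hx; rewrite /HC /=.
have -> : tcl x = elts x `|` \bigcup_(y in elts x) tcl y.
  apply/seteqP; split=> z.
    by move=> /tclP[zx|[y yx zy]]; [left|right; exists y].
  by move=> [zx|[y yx zy]]; apply/tclP; [left|right; exists y].
by apply: w1_setU => //; apply: w1_bigcup.
Qed.

Lemma HC_w2 a : a ∈ w2 -> HC a.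
Proof. by move=> /in_w2P[oa ca]; rewrite /HC /= tcl_ord. Qed.

Lemma HC_countable x : countable (elts x) -> elts x `<=` HC -> HC x.
Proof. by move=> cx; apply: HC_intro; exact: countable_le_w1. Qed.

Lemma HC_pair x y : HC x -> HC y -> HC (toset [set x; y]).
Proof.
move=> hx hy; apply: HC_countable; rewrite elts_pairE.
  exact/finite_set_countable/finite_set2.
by move=> z [->|->].
Qed.

Lemma HC_single x : HC x -> HC (toset [set x]).
Proof.
move=> hx; have -> : [set x] = [set x; x] by rewrite setUid.
exact: HC_pair.
Qed.

Lemma HC_opair x y : HC x -> HC y -> HC (opair x y).
Proof. by move=> hx hy; apply: HC_pair; [exact: HC_single|exact: HC_pair]. Qed.

(** The union of countably many ordinals of size at most [w1] is again such an ordinal. Its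
    successor is taken because the union may belong to [a]. *)
Lemma w2_bounded a : elts a `<=` elts w2 -> countable (elts a) ->
  exists2 b, b ∈ w2 & elts a `<=` elts b.
Proof.
move=> aw ca; have [u uP] := union_set a; exists (succ u).
  have ou : ordinal u by apply: ord_bigcup uP => b /aw; exact: ord_in w2_ord.
  apply: succ_in_w2; apply/in_w2P; split=> //; rewrite uP; apply: w1_bigcup => //.
    exact: countable_le_w1.
  by move=> b /aw/in_w2P[].
have ou : ordinal u by apply: ord_bigcup uP => b /aw; exact: ord_in w2_ord.
move=> x xa; rewrite eltsE in_succ; apply: sub_ole => //.
  by have := aw _ xa; exact: ord_in w2_ord.
by rewrite uP; exact: bigcup_sup.
Qed.

End Omega2.

(** * Definability and Skolem hulls *)

Section Definable.
Context (T : Type) (L : language) (I : forall s : L, ('I_(arity s) -> T) -> Prop).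
Context (D : set T).

(** A property of Rocq predicates, so that no formula has to be written out: the closure lemmas
    build the formula along the shape of the predicate. *)
Definition definable n (P : ('I_n -> T) -> Prop) : Prop :=
  exists f : formula L n, forall e, (forall i, D (e i)) -> (sat I D f e <-> P e).

Lemma definable_ext n (P Q : ('I_n -> T) -> Prop) :
  (forall e, (forall i, D (e i)) -> (P e <-> Q e)) -> definable P -> definable Q.
Proof. by move=> PQ [f fP]; exists f => e De; rewrite fP // PQ. Qed.

Lemma definable_eq n (i j : 'I_n) : definable (fun e => e i = e j).
Proof. by exists (FEq L i j). Qed.

Lemma definable_imp n (P Q : ('I_n -> T) -> Prop) :
  definable P -> definable Q -> definable (fun e => P e -> Q e).
Proof.
by move=> [f fP] [g gP]; exists (FImp f g) => e De /=; rewrite fP // gP.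
Qed.

Lemma definable_not n (P : ('I_n -> T) -> Prop) :
  definable P -> definable (fun e => ~ P e).
Proof. by move=> dP; apply: definable_imp => //; exists (FBot L n). Qed.

Lemma definable_or n (P Q : ('I_n -> T) -> Prop) :
  definable P -> definable Q -> definable (fun e => P e \/ Q e).
Proof.
move=> dP dQ; apply: definable_ext (definable_imp (definable_not dP) dQ) => e _.
split=> [h|[//|//]]; have [|/h] := pselect (P e); by [left|right].
Qed.

Lemma definable_and n (P Q : ('I_n -> T) -> Prop) :
  definable P -> definable Q -> definable (fun e => P e /\ Q e).
Proof.
move=> dP dQ; apply: definable_ext (definable_not (definable_imp dP (definable_not dQ))).
move=> e _; split=> [h|[p q] /(_ p q)//]; split; apply: contrapT => h'; apply: h => //.
Qed.

Lemma scons0 n x (e : 'I_n -> T) : scons x e ord0 = x.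
Proof. by rewrite /scons unlift_none. Qed.

Lemma scons_lift n x (e : 'I_n -> T) i : scons x e (lift ord0 i) = e i.
Proof. by rewrite /scons liftK. Qed.

Lemma scons_in n x (e : 'I_n -> T) (X : set T) :
  X x -> (forall i, X (e i)) -> forall i, X (scons x e i).
Proof. by move=> Xx Xe i; rewrite /scons; case: unliftP => /=. Qed.

Lemma definable_all n (P : T -> ('I_n -> T) -> Prop) :
  definable (fun e : 'I_n.+1 -> T => P (e ord0) (fun i => e (lift ord0 i))) ->
  definable (fun e => forall x, D x -> P x e).
Proof.
move=> [f fP]; exists (FAll f) => e De /=.
have h x : D x -> sat I D f (scons x e) <-> P x e.
  move=> Dx; rewrite fP; last exact: scons_in.
  rewrite scons0; have -> // : (fun i => scons x e (lift ord0 i)) = e.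
  by apply: funext => i; rewrite scons_lift.
by split=> a x Dx; apply/(h x Dx); apply: a.
Qed.

Lemma definable_ex n (P : T -> ('I_n -> T) -> Prop) :
  definable (fun e : 'I_n.+1 -> T => P (e ord0) (fun i => e (lift ord0 i))) ->
  definable (fun e => exists x, D x /\ P x e).
Proof.
move=> dP; have := definable_not (definable_all (P := fun x e => ~ P x e) (definable_not dP)).
apply: definable_ext => e _; split=> [h|[x [Dx Px]] /(_ x Dx)//].
by apply: contrapT => N; apply: h => x Dx Px; apply: N; exists x.
Qed.

End Definable.

(** * Countability of the set of formulas *)

Section CountableFormulas.
Context (L : language) (code_sym : L -> nat) (code_symI : injective code_sym).

Fixpoint code_formula n (f : formula L n) : GenTree.tree nat :=
  match f with
  | FBot _ => GenTree.Node 0 [::]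
  | FEq _ i j => GenTree.Node 1 [:: GenTree.Leaf (i : nat); GenTree.Leaf (j : nat)]
  | FRel _ s v => GenTree.Node 2
      (GenTree.Leaf (code_sym s) :: [seq GenTree.Leaf (v i : nat) | i <- enum 'I_(arity s)])
  | FImp _ f g => GenTree.Node 3 [:: code_formula f; code_formula g]
  | FAll _ f => GenTree.Node 4 [:: code_formula f]
  end.

Lemma code_formula_inj n : injective (@code_formula n).
Proof.
move=> f; elim: f => {n} [n|n i j|n s v|n f IHf g IHg|n f IHf] f'.
- by case: f'.
- by case: n / f' i j => // n i j i' j' [/val_inj -> /val_inj ->].
- case: n / f' v => // n s' v' v [/code_symI e]; subst s' => h.
  congr FRel; apply: funext => i; apply: val_inj.
  have leaf_inj : injective (@GenTree.Leaf nat) by move=> a b [].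
  have := mem_enum 'I_(arity s) i; move: h; elim: (enum _) => //= k r IH [hk hr].
  by rewrite !inE => /orP[/eqP->|ir]; [rewrite hk|apply: IH].
- by case: n / f' f IHf g IHg => // n f' g' f IHf g IHg [/IHf -> /IHg ->].
- by case: n / f' f IHf => // n f' f IHf [/IHf ->].
Qed.

Lemma countable_formula n : countable [set: formula L n].
Proof. by apply: (@countableI _ _ _ (@code_formula n)) => f g _ _ /code_formula_inj. Qed.

End CountableFormulas.

(** * Definability in the structure on H(omega2) *)

Section Hull.
Context (V : zfc) (w1 w2 : V) (w1P : is_omega1 w1) (w2P : is_omega2 w1 w2).
Context (pi : V -> V) (Y : set V) (sk : skolem_family V langA).
Context (pi_bij : set_bij (elts w2) (Hset w2) pi).
Context (skP : definable_skolem_functions (interpA w2 pi Y) (Hset w2) sk).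
Implicit Types (x y z a b c : V) (A B : set V).

Local Notation D := (Hset w2).
Local Notation defA := (definable (interpA w2 pi Y) D).

Let D_in x y : D y -> x ∈ y -> D x.
Proof. by move=> Dy xy; exact: Hset_trans xy Dy. Qed.

Lemma w2_sub_H : elts w2 `<=` D.
Proof. by move=> a /(HC_w2 w2P)/(HC_Hset w2P). Qed.

Lemma Hset_subset x y : D y -> elts x `<=` elts y -> D x.
Proof.
rewrite /Hset /= => + xy; apply: contra => /card_le_trans; apply.
apply: subset_card_le => z /tclP[/xy zy|[t /xy ty zt]]; first exact: t_step.
by apply/tclP; right; exists t.
Qed.

Lemma def_mem n (i j : 'I_n) : defA (fun e => e i ∈ e j).
Proof.
by exists (@FRel langA n InA (fun k : 'I_2 => if k == ord0 then i else j)).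
Qed.

Lemma def_pi n (i j : 'I_n) : defA (fun e => e i ∈ w2 /\ e j = pi (e i)).
Proof.
by exists (@FRel langA n PiA (fun k : 'I_2 => if k == ord0 then i else j)).
Qed.

Lemma def_Y n (i : 'I_n) : defA (fun e => Y (e i)).
Proof. by exists (@FRel langA n YA (fun k : 'I_1 => i)). Qed.

Lemma def_ball n (j : 'I_n) (P : V -> ('I_n -> V) -> Prop) :
  defA (fun e : 'I_n.+1 -> V => P (e ord0) (fun i => e (lift ord0 i))) ->
  defA (fun e => forall x, x ∈ e j -> P x e).
Proof.
move=> dP; have := definable_all (P := fun x e => x ∈ e j -> P x e)
  (definable_imp (def_mem ord0 (lift ord0 j)) dP).
apply: definable_ext => e De; split=> h x; last by move=> _; exact: h.
by move=> xj; apply: h => //; exact: D_in xj.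
Qed.

Lemma def_bex n (j : 'I_n) (P : V -> ('I_n -> V) -> Prop) :
  defA (fun e : 'I_n.+1 -> V => P (e ord0) (fun i => e (lift ord0 i))) ->
  defA (fun e => exists x, x ∈ e j /\ P x e).
Proof.
move=> dP; have := definable_ex (P := fun x e => x ∈ e j /\ P x e)
  (definable_and (def_mem ord0 (lift ord0 j)) dP).
apply: definable_ext => e De; split=> [[x [_ h]]|[x [xj Px]]]; exists x => //.
by split=> //; exact: D_in xj.
Qed.

Lemma def_empty n (i : 'I_n) : defA (fun e => forall x, x ∈ e i -> False).
Proof. by apply: (@def_ball _ _ (fun _ _ => False)); exists (FBot _ _). Qed.

Lemma def_sub n (i j : 'I_n) : defA (fun e => elts (e i) `<=` elts (e j)).
Proof. apply: (@def_ball _ _ (fun x e => x ∈ e j)); exact: def_mem. Qed.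

Lemma def_succ n (i j : 'I_n) : defA (fun e => e j = succ (e i)).
Proof.
apply: definable_ext (definable_and (def_mem i j) (definable_and (def_sub i j)
  (@def_ball n j (fun x e => x ∈ e i \/ x = e i) (definable_or (def_mem _ _)
     (definable_eq _ _ _ _))))) => e De.
split=> [[ij [sij h]]|->]; last first.
  split; first by rewrite in_succ; right.
  by split=> [x|x]; rewrite ?eltsE in_succ //; left.
apply: elts_inj; apply/seteqP; rewrite elts_succ; split=> x; first exact: h.
by case=> [/sij|->].
Qed.

Lemma def_pair n (i j k : 'I_n) : defA (fun e => e k = toset [set e i; e j]).
Proof.
apply: definable_ext (definable_and (def_mem i k) (definable_and (def_mem j k)
  (@def_ball n k (fun x e => x = e i \/ x = e j) (definable_or
    (definable_eq _ _ _ _) (definable_eq _ _ _ _))))) => e De.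
split=> [[ik [jk h]]|->]; last first.
  by rewrite -!eltsE elts_pairE; split; [left|split; [right|move=> x; rewrite -eltsE elts_pairE]].
apply: elts_inj; rewrite elts_pairE; apply/seteqP; split=> x; first exact: h.
by case=> ->.
Qed.

Lemma def_opair n (i j k : 'I_n) : defA (fun e => e k = opair (e i) (e j)).
Proof.
apply: definable_ext (@def_bex n k (fun u e => exists v, v ∈ e k /\
   (u = toset [set e i; e i] /\ v = toset [set e i; e j] /\
      (e k = toset [set u; v]))) _) => [e De|].
  split=> [[u [_ [v [_ [-> [-> ->]]]]]]|eij]; first by rewrite setUid.
  exists (toset [set e i]); rewrite eij -eltsE elts_opair; split; first by left.
  exists (toset [set e i; e j]); rewrite -eltsE elts_opair setUid; split; first by right.
  by [].
apply: (@def_bex n.+1 (lift ord0 k) (fun v e => e ord0 = toset [set e (lift ord0 i); e (lift ord0 i)] /\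
   v = toset [set e (lift ord0 i); e (lift ord0 j)] /\
      (e (lift ord0 k) = toset [set e ord0; v]))).
by apply: definable_and; [|apply: definable_and]; exact: def_pair.
Qed.

Lemma def_opair_in n (i j k : 'I_n) : defA (fun e => opair (e i) (e j) ∈ e k).
Proof.
apply: definable_ext (@def_bex n k (fun p e => p = opair (e i) (e j)) _) => [e De|].
  by split=> [[p [pk <-]]|]; [|exists (opair (e i) (e j))].
exact: def_opair.
Qed.

Lemma def_cap n (i j k : 'I_n) : defA (fun e => e k = cap (e i) (e j)).
Proof.
apply: definable_ext (definable_and (def_sub k i) (definable_and (def_sub k j)
  (@def_ball n i (fun x e => x ∈ e j -> x ∈ e k)
     (definable_imp (def_mem _ _) (def_mem _ _))))) => e De.
split=> [[ki [kj h]]|->]; last first.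
  by split; [|split]; rewrite ?elts_cap; [move=> x []..|move=> x xi xj; rewrite in_cap].
apply: elts_inj; rewrite elts_cap; apply/seteqP; split=> x.
  by move=> xk; split; [exact: ki|exact: kj].
by case=> xi xj; exact: h.
Qed.

Definition inductive w := (exists z, z ∈ w /\ forall x, x ∈ z -> False) /\
  forall x, x ∈ w -> exists y, y ∈ w /\ y = succ x.

Lemma def_inductive n (i : 'I_n) : defA (fun e => inductive (e i)).
Proof.
apply: definable_and.
  apply: (@def_bex _ _ (fun z _ => forall x, x ∈ z -> False)); exact: def_empty.
apply: (@def_ball _ _ (fun x e => exists y, y ∈ e i /\ y = succ x)).
apply: (@def_bex n.+1 (lift ord0 i) (fun y e => y = succ (e ord0))).
exact: def_succ.
Qed.

(** The set of natural numbers, described with quantifiers over [D] only so that a hull can pick it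
    out. *)
Definition least_inductive w := inductive w /\
  forall x, D x -> inductive x -> elts w `<=` elts x.

Lemma def_omega n (i : 'I_n) : defA (fun e => least_inductive (e i)).
Proof.
apply: definable_and; first exact: def_inductive.
apply: (@definable_all _ _ _ _ _ (fun x e => inductive x -> elts (e i) `<=` elts x)).
by apply: definable_imp; [exact: def_inductive|exact: def_sub].
Qed.

(** * Closure properties of Skolem hulls *)

Section Closure.
Context (G : set V) (GD : G `<=` D).

Local Notation S := (Sk sk G).

Lemma Sk_base : G `<=` S.
Proof. by move=> x Gx X [_]; apply. Qed.

Lemma Sk_app n (f : formula langA n.+1) (e : 'I_n -> V) :
  (forall i, S (e i)) -> S (sk f e).
Proof. by move=> Se X [cX GX]; apply: (cX) => i; exact: (Se i X (conj cX GX)). Qed.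

Lemma Sk_least X : G `<=` X ->
  (forall n (f : formula langA n.+1) (e : 'I_n -> V),
    (forall i, X (e i)) -> X (sk f e)) -> S `<=` X.
Proof. by move=> GX cX x; apply; split. Qed.

Lemma Sk_H : S `<=` D.
Proof. by apply: Sk_least => // n f e De; have [[h _] _] := skP f; apply: h. Qed.

(** This stands in for elementarity of the hull: truth is always evaluated in [D], and the Skolem
    function only supplies a witness inside the hull. *)
Lemma Sk_ex n (P : ('I_n.+1 -> V) -> Prop) (e : 'I_n -> V) : defA P ->
  (forall i, S (e i)) -> (exists y, D y /\ P (scons y e)) ->
  exists y, S y /\ P (scons y e).
Proof.
move=> [f fP] Se [y [Dy Py]]; have [_ h] := skP f.
have De i : D (e i) by apply: Sk_H.
exists (sk f e); split; first exact: Sk_app.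
apply/fP; first by apply: scons_in => //; apply: Sk_H; exact: Sk_app.
by apply: h => //; exists y; split=> //; apply/fP => //; exact: scons_in.
Qed.

Definition v1 n : 'I_n.+2 := lift ord0 ord0.
Definition v2 n : 'I_n.+3 := lift ord0 (v1 n).
Definition v3 n : 'I_n.+4 := lift ord0 (v2 n).

Lemma Sk_ex0 (P : V -> Prop) : defA (fun e : 'I_1 -> V => P (e ord0)) ->
  (exists y, D y /\ P y) -> exists y, S y /\ P y.
Proof.
move=> dP [y [Dy Py]].
have [||z [Sz]] := Sk_ex (e := fun i : 'I_0 => point) dP.
- by case.
- by exists y; rewrite scons0.
by rewrite scons0; exists z.
Qed.

Lemma Sk_ex1 (P : V -> V -> Prop) x :
  defA (fun e : 'I_2 -> V => P (e ord0) (e (v1 0))) ->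
  S x -> (exists y, D y /\ P y x) -> exists y, S y /\ P y x.
Proof.
move=> dP Sx [y [Dy Py]].
have [||z [Sz]] := Sk_ex (e := fun i : 'I_1 => x) dP.
- by [].
- by exists y; rewrite scons0 scons_lift.
by rewrite scons0 scons_lift; exists z.
Qed.

Lemma Sk_ex2 (P : V -> V -> V -> Prop) x x' :
  defA (fun e : 'I_3 -> V => P (e ord0) (e (v1 1)) (e (v2 0))) ->
  S x -> S x' -> (exists y, D y /\ P y x x') -> exists y, S y /\ P y x x'.
Proof.
move=> dP Sx Sx' [y [Dy Py]].
have [||z [Sz]] := Sk_ex (e := scons x (fun i : 'I_1 => x')) dP.
- exact: scons_in.
- by exists y; rewrite scons0 !scons_lift scons0.
by rewrite scons0 !scons_lift scons0; exists z.
Qed.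

Lemma Sk_ex3 (P : V -> V -> V -> V -> Prop) x x' x'' :
  defA (fun e : 'I_4 -> V => P (e ord0) (e (v1 2)) (e (v2 1)) (e (v3 0))) ->
  S x -> S x' -> S x'' -> (exists y, D y /\ P y x x' x'') ->
  exists y, S y /\ P y x x' x''.
Proof.
move=> dP Sx Sx' Sx'' [y [Dy Py]].
have [||z [Sz]] := Sk_ex (e := scons x (scons x' (fun i : 'I_1 => x''))) dP.
- by do !apply: scons_in.
- by exists y; rewrite scons0 !scons_lift !scons0.
by rewrite scons0 !scons_lift !scons0; exists z.
Qed.

Lemma Sk_succ x : S x -> D (succ x) -> S (succ x).
Proof.
move=> Sx Dx; have [||y [Sy <-//]] := @Sk_ex1 (fun y x => y = succ x) x _ Sx.
  exact: def_succ.
by exists (succ x).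
Qed.

Lemma Sk_cap x y : S x -> S y -> S (cap x y).
Proof.
move=> Sx Sy; have [||z [Sz <-//]] := @Sk_ex2 (fun z x y => z = cap x y) x y _ Sx Sy.
  exact: def_cap.
exists (cap x y); split=> //; apply: Hset_subset (Sk_H Sx) _.
by rewrite elts_cap => ? [].
Qed.

Lemma Sk_pi a : a ∈ w2 -> S a -> S (pi a).
Proof.
move=> aw Sa.
have [||z [Sz [_ <-//]]] := @Sk_ex1 (fun z a => a ∈ w2 /\ z = pi a) a _ Sa.
  exact: def_pi.
by exists (pi a); split=> //; case: pi_bij => h _ _; exact: h.
Qed.

(** With [Sk_pi], this makes a hull the image under [pi] of its own ordinals below [w2]. *)
Lemma Sk_pi_inv x : S x -> exists a, [/\ S a, a ∈ w2 & pi a = x].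
Proof.
move=> Sx.
have [||a [Sa [aw ->]]] := @Sk_ex1 (fun a z => a ∈ w2 /\ z = pi a) x _ Sx; last by exists a.
  exact: def_pi.
have [_ _ /(_ x (Sk_H Sx))[a aw ax]] := pi_bij.
by exists a; split=> //; exact: w2_sub_H.
Qed.

Lemma HC_num n : HC w1 (num V n).
Proof.
apply: (HC_w2 w2P); apply: (ord_trans (w2_ord w2P) _ (w1_in_w2 w1P w2P)).
apply: (countable_in_w1 w1P); first exact: num_ord.
elim: n => [|n IH] /=; first by rewrite tosetE; [exact: countable0|exact: set0_set].
by rewrite elts_succ; apply: countableU => //; exact: countable1.
Qed.

Let om := toset (range (num V)).

Let omE : elts om = range (num V).
Proof. apply: tosetE; apply: countable_set; exact: countable_range. Qed.

Let om_HC : HC w1 om.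
Proof.
apply: (HC_countable w1P); rewrite omE; first exact: countable_range.
by move=> _ [n _ <-]; exact: HC_num.
Qed.

Lemma num_inductive w n : inductive w -> num V n ∈ w.
Proof.
move=> [[z [zw z0]] wS]; elim: n => [|n IH] /=; last first.
  by have [y [yw <-]] := wS _ IH.
suff <- : z = toset set0 by [].
apply: elts_inj; rewrite tosetE; last exact: set0_set.
by apply/seteqP; split=> x // /z0.
Qed.

Let om_ind : inductive om.
Proof.
split; last first.
  move=> x; rewrite -eltsE omE => -[n _ <-]; exists (succ (num V n)); split=> //.
  by rewrite -eltsE omE; exists n.+1.
exists (num V 0); split; first by rewrite -eltsE omE; exists 0.
by move=> x; rewrite -eltsE /= tosetE //; exact: set0_set.
Qed.

(** The least inductive set is definable, hence in the hull. Its trace on the hull is again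
    inductive and in [D], so minimality puts all of its elements in the hull. *)
Lemma Sk_omega : exists w, [/\ S w, elts w `<=` S & inductive w].
Proof.
have [||w [Sw [wi wm]]] := @Sk_ex0 least_inductive.
- exact: def_omega.
- exists om; split; first exact: (HC_Hset w2P).
  split=> // x Dx xi y; rewrite omE => -[n _ <-]; exact: num_inductive.
exists w; split=> //.
have Dw := Sk_H Sw; have sw : elts w `&` S `<=` elts w by move=> x [].
have Dw' : D (toset (elts w `&` S)).
  by apply: Hset_subset Dw _ => y; rewrite eltsE (in_toset_sub _ sw) => -[].
suff h : inductive (toset (elts w `&` S)).
  by move=> x /(wm _ Dw' h); rewrite eltsE (in_toset_sub _ sw) => -[].
case: wi => [[z [zw z0]] wS]; split=> [|x]; last first.
  rewrite (in_toset_sub _ sw) => -[/wS[y [yw ye]] Sx]; subst y.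
  exists (succ x); split=> //; rewrite (in_toset_sub _ sw); split=> //.
  by apply: Sk_succ => //; exact: D_in Dw _.
have [||z' [Sz' z'0]] := @Sk_ex0 (fun z => forall x, x ∈ z -> False).
- exact: def_empty.
- by exists z; split=> //; exact: D_in zw.
exists z'; split=> //; rewrite (in_toset_sub _ sw); split=> //.
suff <- : z = z' by [].
by apply: elts_inj; apply/seteqP; split=> x; [move=> /z0|move=> /z'0].
Qed.

Definition enumerates f K w := (forall x, x ∈ K -> exists n, n ∈ w /\ opair n x ∈ f) /\
  forall n, n ∈ w -> forall x, x ∈ K -> forall y, y ∈ K ->
    opair n x ∈ f -> opair n y ∈ f -> x = y.

Lemma def_enumerates n (i j k : 'I_n) : defA (fun e => enumerates (e i) (e j) (e k)).
Proof.
apply: definable_and.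
  apply: (@def_ball _ _ (fun x e => exists n, n ∈ e k /\ opair n x ∈ e i)).
  apply: (@def_bex n.+1 (lift ord0 k) (fun m e => opair m (e ord0) ∈ e (lift ord0 i))).
  exact: def_opair_in.
apply: (@def_ball _ _ (fun m e => forall x, x ∈ e j -> forall y, y ∈ e j ->
  opair m x ∈ e i -> opair m y ∈ e i -> x = y)).
apply: (@def_ball n.+1 (lift ord0 j) (fun x e => forall y, y ∈ e (lift ord0 j) ->
  opair (e ord0) x ∈ e (lift ord0 i) -> opair (e ord0) y ∈ e (lift ord0 i) -> x = y)).
apply: (@def_ball n.+2 (lift ord0 (lift ord0 j)) (fun y e =>
  opair (e (lift ord0 ord0)) (e ord0) ∈ e (lift ord0 (lift ord0 i)) ->
  opair (e (lift ord0 ord0)) y ∈ e (lift ord0 (lift ord0 i)) -> e ord0 = y)).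
do 2 (apply: definable_imp; first exact: def_opair_in).
exact: definable_eq.
Qed.

(** The hull contains an enumeration of [K] by natural numbers, and all of these numbers; each
    element of [K] is therefore definable from parameters in the hull. The bound by [HC w1] places
    the enumeration in [D]. *)
Lemma Sk_countable K : S K -> countable (elts K) -> elts K `<=` HC w1 ->
  elts K `<=` S.
Proof.
move=> SK cK hK; have [w [Sw wS wi]] := Sk_omega.
have [g gI] := countableE cK.
pose f := toset [set opair (num V (g x)) x | x in elts K].
have fE : elts f = [set opair (num V (g x)) x | x in elts K].
  apply: tosetE; apply: countable_set; exact: countable_img.
have [||f' [Sf' [f1 f2]]] := @Sk_ex2 enumerates K w _ SK Sw.
- exact: def_enumerates.
- exists f; split.
    apply: (HC_Hset w2P); apply: (HC_countable w1P); rewrite fE; first exact: countable_img.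
    by move=> _ [x xK <-]; apply: (HC_opair w1P); [exact: HC_num|exact: hK].
  split=> [x xK|n nw x xK y yK].
    exists (num V (g x)); split; first exact: num_inductive.
    by rewrite -eltsE fE; exists x.
  rewrite -!eltsE fE => -[x' x'K /opair_inj[ex xx']] [y' y'K /opair_inj[ey yy']].
  subst x' y'.
  by apply: gI => //; apply: (@num_inj V); rewrite ex ey.
move=> x xK; have [n [nw nx]] := f1 x xK.
have [||y [Sy [yK ny]]] := @Sk_ex3 (fun x K n f => x ∈ K /\ opair n x ∈ f) K n f' _ SK (wS _ nw) Sf'.
- by apply: definable_and; [exact: def_mem|exact: def_opair_in].
- by exists x; split=> //; exact: D_in (Sk_H SK) _.
by rewrite (f2 n nw x xK y yK nx ny).
Qed.

End Closure.

Lemma Sk_mono (A B : set V) : A `<=` Sk sk B -> Sk sk A `<=` Sk sk B.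
Proof. by move=> AB; apply: Sk_least => // n f e; exact: Sk_app. Qed.

End Hull.

(** * Adequate sets *)

Lemma countable_enum (T : choiceType) (A : set T) : countable A -> A !=set0 ->
  exists g : nat -> T, range g = A.
Proof.
move=> /countableE[f fI] [a0 Aa0].
pose g n := xget a0 [set x | A x /\ f x = n]; exists g.
apply/seteqP; split=> [x [n _ <-]|x Ax].
  by rewrite /g; case: xgetP => // y _ [].
exists (f x) => //.
have [Ag] : [set z | A z /\ f z = f x] (g (f x)) by apply: xgetPex; exists x.
exact: fI.
Qed.

Section Adequacy.
Context (V : zfc) (w1 w2 : V) (w1P : is_omega1 w1) (w2P : is_omega2 w1 w2).
Context (pi : V -> V) (Y : set V) (sk : skolem_family V langA) (Gamma : set V).
Context (pi_bij : set_bij (elts w2) (Hset w2) pi).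
Context (Y_sub : Y `<=` Pomega1 (elts w2)) (Y_thin : thin w1 w2 Y).
Context (Y_init : forall a b : V, Y a -> b ∈ w2 -> Y (cap a b)).
Context (skP : definable_skolem_functions (interpA w2 pi Y) (Hset w2) sk).
Context (Gamma_sub : Gamma `<=` Lambda w1 w2 sk).
Context (Gamma_stat : stationary_in w2 Gamma).
Implicit Types (x y z a b c M N K L : V) (A B : set V).

Local Notation D := (Hset w2).
Local Notation S := (Sk sk).
Local Notation X := (Xset w2 Y sk).
Local Notation beta := (comparison_point Gamma).

Let ow2 := w2_ord w2P.
Let ow1 := w1_ord w1P.

Definition omega : V := toset (range (num V)).

Lemma elts_omega : elts omega = range (num V).
Proof. apply: tosetE; apply: countable_set; exact: countable_range. Qed.

Lemma num_down n x : x ∈ num V n -> exists m, x = num V m.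
Proof.
elim: n => [|n IH] /=; last by rewrite in_succ => -[/IH//|->]; exists n.
by rewrite -eltsE tosetE //; exact: set0_set.
Qed.

Lemma omega_ord : ordinal omega.
Proof.
split=> [b|b c]; rewrite -eltsE elts_omega => -[n _ <-].
  by move=> x /num_down[m ->]; exists m.
exact: ord_transitive (num_ord V n).
Qed.

Lemma Gamma_w2 b : Gamma b -> b ∈ w2. Proof. by move=> /Gamma_sub[]. Qed.

Lemma Gamma_ord b : Gamma b -> ordinal b.
Proof. by move=> /Gamma_w2; exact: ord_in. Qed.

(** The identity is cofinal from [b] to [b], so the cofinality [w1] of [b] is at most [b]. *)
Lemma Gamma_w1 b : Gamma b -> elts w1 `<=` elts b.
Proof.
move=> Gb; have ob := Gamma_ord Gb; have [_ [_ h] _] := Gamma_sub Gb.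
apply: ole_sub => //; apply: h; split=> //; exists id; split=> [x //|x xb].
by exists x => //; right.
Qed.

(** An unbounded countable subset would give a cofinal map from [omega], whereas the cofinality of
    [b] is [w1]. *)
Lemma Gamma_bound b a : Gamma b -> elts a `<=` elts b -> countable (elts a) ->
  exists2 x, x ∈ b & elts a `<=` elts x.
Proof.
move=> Gb ab ca; have ob := Gamma_ord Gb.
have [_ [_ lb] [[b0 b0b] _]] := Gamma_sub Gb.
apply: contrapT => N.
have unb x : x ∈ b -> exists2 y, y ∈ a & ole x y.
  move=> xb; apply: contrapT => N'; apply: N; exists x => // y ya.
  apply: contrapT => yx; apply: N'; exists y => //.
  by apply: ord_leNgt yx; [exact: ord_in (ab _ ya)|exact: ord_in xb].
have [g gE] := countable_enum ca (let: ex_intro2 y ya _ := unb _ b0b in ex_intro _ y ya).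
(* Cofinal maps are functions on all of [V]; [k] reads a numeral back as a natural number. *)
have /choice[k kP] : forall x, exists n, forall m, x = num V m -> n = m.
  move=> x; have [[m ->]|N'] := pselect (exists m, x = num V m).
    by exists m => m' /num_inj.
  by exists 0%N => m e; case: N'; exists m.
have gA n : g n ∈ a by rewrite -eltsE -gE; exists n.
case: (isin_irr (x := omega)).
have : omega ∈ w1.
  apply: (countable_in_w1 w1P); first exact: omega_ord.
  rewrite elts_omega; exact: countable_range.
move=> ow; apply: (lt_ole_trans omega_ord ow); apply: lb; split; first exact: omega_ord.
exists (g \o k); split=> [x _ /=|x xb]; first exact: ab (gA _).
have [y ya xy] := unb x xb; move: ya; rewrite -eltsE -gE => -[n _ gn].
exists (num V n); first by rewrite -eltsE elts_omega; exists n.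
by rewrite /= (kP _ n erefl) gn.
Qed.

Lemma Gamma_C b x : Gamma b -> x ∈ b -> exists c, [/\ Cset w2 sk c, c ∈ b & x ∈ c].
Proof. by move=> /Gamma_sub[_ _ [_]]; apply. Qed.

Lemma Gamma_unbounded a : a ∈ w2 -> exists2 b, Gamma b & a ∈ b.
Proof.
move=> aw; have [|b [Gb [bw ab]]] := Gamma_stat (A := [set b | b ∈ w2 /\ a ∈ b]).
  split=> [b []//|b bw|b bw [[c cb] h]].
    have [ab|<-|ba] := ord_total (ord_in ow2 aw) (ord_in ow2 bw).
    - exists (succ b); last by rewrite in_succ; right.
      by split; [exact: (succ_in_w2 w1P w2P)|rewrite in_succ; left].
    - exists (succ a); last by rewrite in_succ; right.
      by split; [exact: (succ_in_w2 w1P w2P)|rewrite in_succ; right].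
    - exists (succ a); last by rewrite in_succ; left.
      by split; [exact: (succ_in_w2 w1P w2P)|rewrite in_succ; right].
  have [d [[_ ad] db _]] := h _ cb.
  by split=> //; exact: ord_trans (ord_in ow2 bw) ad db.
by exists b.
Qed.

Lemma Y_w2 a : Y a -> elts a `<=` elts w2. Proof. by move=> /Y_sub[]. Qed.

Lemma Y_countable a : Y a -> countable (elts a). Proof. by move=> /Y_sub[]. Qed.

Lemma w2_countable_HC a : elts a `<=` elts w2 -> countable (elts a) -> HC w1 a.
Proof.
move=> aw ca; apply: (HC_countable w1P) => // x /aw; exact: (HC_w2 w2P).
Qed.

Lemma sub_H a : elts a `<=` elts w2 -> elts a `<=` D.
Proof. by move=> aw x /aw; exact: (w2_sub_H w2P). Qed.

Lemma X_Y M : X M -> Y M. Proof. by case. Qed.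
Lemma X_w2 M : X M -> elts M `<=` elts w2. Proof. by move=> /X_Y/Y_w2. Qed.
Lemma X_countable M : X M -> countable (elts M).
Proof. by move=> /X_Y/Y_countable. Qed.
Lemma X_H M : X M -> elts M `<=` D. Proof. by move=> /X_w2/sub_H. Qed.
Lemma X_HC M : X M -> HC w1 M.
Proof. by move=> XM; apply: w2_countable_HC; [exact: X_w2|exact: X_countable]. Qed.

Lemma X_Sk M x : X M -> S (elts M) x -> x ∈ w2 -> x ∈ M.
Proof. by move=> [_ e _] Sx xw; rewrite -eltsE -e. Qed.

Lemma Sk_sub N K : X N -> S (elts N) K -> elts K `<=` elts w2 ->
  countable (elts K) -> elts K `<=` elts N.
Proof.
move=> XN SK Kw cK x xK; apply: (X_Sk XN); last exact: Kw.
apply: (Sk_countable w1P w2P skP (X_H XN) SK cK) xK.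
by move=> y /Kw; exact: (HC_w2 w2P).
Qed.

Lemma X_succ M x : X M -> x ∈ M -> succ x ∈ M.
Proof.
move=> XM xM; have sw : succ x ∈ w2 by apply: (succ_in_w2 w1P w2P) => //; exact: X_w2 xM.
apply: X_Sk => //; apply: (Sk_succ skP (X_H XM)).
  exact: Sk_base.
exact: (w2_sub_H w2P).
Qed.

(** The ordinal [g] need not lie in the hull. But [K] is cut at the same place by its own least
    element not below [g], which is in [N]. *)
Lemma Sk_init N K g : X N -> S (elts N) K -> elts K `<=` elts w2 ->
  countable (elts K) -> ordinal g -> S (elts N) (cap K g).
Proof.
move=> XN SK Kw cK og; have KN := Sk_sub XN SK Kw cK.
have [Kg|[x [xK xg]]] : elts K `<=` elts g \/ exists x, x ∈ K /\ ~ x ∈ g.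
  have [|N'] := pselect (exists x, x ∈ K /\ ~ x ∈ g); [by right|left=> x xK].
  by apply: contrapT => xg; apply: N'; exists x.
  suff -> : cap K g = K by [].
  apply: elts_inj; rewrite elts_cap; exact/setIidPl.
have [m [[mK mg] om mm]] := ord_least (A := [set x | x ∈ K /\ ~ x ∈ g])
  (ord_in ow2 (Kw _ xK)) (conj xK xg).
suff -> : cap K g = cap K m.
  apply: (Sk_cap skP (X_H XN)) => //; apply: Sk_base; exact: KN.
apply: elts_inj; rewrite !elts_cap; apply/seteqP; split=> z [zK zg]; split=> //.
  have := ord_leNgt om og mg; exact: lt_ole_trans.
by apply: contrapT => zg'; exact: (mm z zg).
Qed.

(** [g] gives each index in [u] at most one set of [D], and every trace on [c] of a member of [Y]
    has an index. Quantifying over [D] keeps the notion definable in the structure. *)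
Definition thin_cover g u c :=
  (forall x, D x -> Y x -> exists i, i ∈ u /\ exists z, D z /\ (z = cap x c /\ opair i z ∈ g)) /\
  (forall i, i ∈ u -> forall z, D z -> forall z', D z' ->
    opair i z ∈ g -> opair i z' ∈ g -> z = z').

Lemma def_thin_cover n (i j k : 'I_n) :
  definable (interpA w2 pi Y) D (fun e => thin_cover (e i) (e j) (e k)).
Proof.
apply: definable_and.
  apply: (@definable_all _ _ _ _ _ (fun x e => Y x ->
     exists t, t ∈ e j /\ exists z, D z /\ (z = cap x (e k) /\ opair t z ∈ e i))).
  apply: definable_imp; first exact: def_Y.
  apply: (@def_bex _ w2 _ _ n.+1 (lift ord0 j) (fun t e => exists z, D z /\
    (z = cap (e ord0) (e (lift ord0 k)) /\ opair t z ∈ e (lift ord0 i)))).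
  apply: (@definable_ex _ _ _ _ n.+2 (fun z e =>
    (z = cap (e (lift ord0 ord0)) (e (lift ord0 (lift ord0 k))) /\
     opair (e ord0) z ∈ e (lift ord0 (lift ord0 i))))).
  by apply: definable_and; [exact: def_cap|exact: def_opair_in].
apply: (@def_ball _ w2 _ _ n j (fun t e => forall z, D z -> forall z', D z' ->
    opair t z ∈ e i -> opair t z' ∈ e i -> z = z')).
apply: (@definable_all _ _ _ _ n.+1 (fun z e => forall z', D z' ->
  opair (e ord0) z ∈ e (lift ord0 i) -> opair (e ord0) z' ∈ e (lift ord0 i) -> z = z')).
apply: (@definable_all _ _ _ _ n.+2 (fun z' e =>
  opair (e (lift ord0 ord0)) (e ord0) ∈ e (lift ord0 (lift ord0 i)) ->
  opair (e (lift ord0 ord0)) z' ∈ e (lift ord0 (lift ord0 i)) -> e ord0 = z')).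
do 2 (apply: definable_imp; first exact: def_opair_in).
exact: definable_eq.
Qed.

(** Thinness injects the traces on [c] into [w1]. The inverse of this injection is a cover, and its
    hereditary size of at most [w1] places it in [D]. *)
Lemma thin_cover_ex c : c ∈ w2 -> exists2 g, D g & thin_cover g w1 c.
Proof.
move=> cw; set Z := [set cap a c | a in Y].
have [h [hw hI]] := card_leE (Y_thin cw).
have ZHC : Z `<=` HC w1.
  move=> _ [a Ya <-]; apply: w2_countable_HC; rewrite elts_cap.
    by move=> x [/(Y_w2 Ya)].
  by apply: sub_countableS (Y_countable Ya) => x [].
have gE : elts (toset [set opair (h z) z | z in Z]) = [set opair (h z) z | z in Z].
  apply: tosetE; apply: (@set_image V V _ h Z w1) => [t t' Zt Zt'|t Zt]; first exact: hI.
  exact: hw.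
exists (toset [set opair (h z) z | z in Z]).
  apply: (HC_Hset w2P); apply: (HC_intro w1P); rewrite gE.
    by apply: card_le_trans (card_image_le _ _) _; exact: Y_thin.
  move=> _ [z Zz <-]; apply: (HC_opair w1P); last exact: ZHC.
  apply: (HC_w2 w2P); apply: ord_trans (hw _ Zz) (w1_in_w2 w1P w2P); exact: ow2.
split=> [x Dx Yx|i iw z Dz z' Dz'].
  have Zx : Z (cap x c) by exists x.
  exists (h (cap x c)); split; first exact: hw.
  exists (cap x c); split; first exact/(HC_Hset w2P)/ZHC.
  by split=> //; rewrite -eltsE gE; exists (cap x c).
rewrite -!eltsE gE => -[u Zu /opair_inj[iu uz]] [u' Zu' /opair_inj[iu' uz']].
by subst u u' i; apply: hI.
Qed.

(* The index set u of a cover of {x /\ c | x in Y} is an ordinal chosen in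
   Sk(d) /\ w2 = d for some d < b in C; hence u is included in d, and the cover
   puts a itself in Sk(d). *)
Lemma Sk_Lambda N a b : X N -> Gamma b -> Y a -> S (elts N) a -> elts a `<=` elts b ->
  S (elts (cap N b)) a.
Proof.
move=> XN Gb Ya Sa ab; have ca := Y_countable Ya; have aw := Y_w2 Ya.
have [al [Sal alw pial]] := Sk_pi_inv w2P pi_bij skP (X_H XN) Sa.
have alN := X_Sk XN Sal alw.
have ob := Gamma_ord Gb; have bw := Gamma_w2 Gb.
have [c cb ac] := Gamma_bound Gb ab ca.
have [d [[dw dC] db cd]] := Gamma_C Gb cb.
have cw : c ∈ w2 by exact: ord_trans cb bw.
have dH : elts d `<=` D by apply: sub_H; exact: ord_transitive dw.
have Sd x : S (elts d) x -> x ∈ w2 -> x ∈ d by move=> Sx xw; rewrite -eltsE -dC.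
have [g0 Dg0 g0P] := thin_cover_ex cw.
have Sc : S (elts d) c by apply: Sk_base.
have [||u [Su [uw [g1 [Dg1 g1P]]]]] := @Sk_ex1 V w2 pi Y sk skP _ dH
  (fun u c => u ∈ w2 /\ exists g, D g /\ thin_cover g u c) c _ Sc.
- apply: definable_and.
    apply: definable_ext (@definable_ex _ _ _ _ 2 (fun y e => e ord0 ∈ w2 /\ y = pi (e ord0)) _) => [e De|].
      split=> [[y [_ []]]//|ew]; exists (pi (e ord0)); split=> //.
      by case: pi_bij => h _ _; exact: h.
    exact: def_pi.
  apply: (@definable_ex _ _ _ _ 2 (fun g e => thin_cover g (e ord0) (e (v1 0)))).
  exact: def_thin_cover.
- exists w1; split; first exact: (w2_sub_H w2P (w1_in_w2 w1P w2P)).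
  by split; [exact: (w1_in_w2 w1P w2P)|exists g0].
have [||g [Sg [g2 g3]]] := @Sk_ex2 V w2 pi Y sk skP _ dH thin_cover u c _ Su Sc.
- exact: def_thin_cover.
- by exists g1.
have ud := Sd u Su uw; have od := ord_in ow2 dw.
have Da : D a by apply: (HC_Hset w2P); exact: w2_countable_HC.
have [i [iu [z [Dz [zE iz]]]]] := g2 a Da Ya.
have {zE} za : z = a.
  rewrite zE; apply: elts_inj; rewrite elts_cap; exact/setIidPl.
subst z.
have Si : S (elts d) i by apply: Sk_base; exact: ord_trans od iu ud.
have [||z [Sz iz']] := @Sk_ex2 V w2 pi Y sk skP _ dH (fun z i g => opair i z ∈ g) i g _ Si Sg.
- exact: def_opair_in.
- by exists a.
have za : z = a by apply: (g3 i iu) => //; exact: (Sk_H skP dH Sz).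
subst z.
have [al' [Sal' al'w pial']] := Sk_pi_inv w2P pi_bij skP dH Sz.
have e : al' = al.
  have [_ inj _] := pi_bij; apply: inj; rewrite ?pial' ?pial //; exact/mem_set.
subst al'.
(* The ordinal coding [a] under [pi] lies in [N] and, as an ordinal of [Sk d], below [d], hence
   below [b]. So it belongs to [cap N b], and [pi] recovers [a] from it. *)
rewrite -pial; apply: (Sk_pi pi_bij skP) => //.
  by apply: sub_H; rewrite elts_cap => x [/(X_w2 XN)].
apply: Sk_base; rewrite elts_cap; split=> //.
by apply: ord_trans ob (Sd al Sal' alw) db.
Qed.

(** * Initial segments of models and comparison points *)

Lemma elts_sup (a : V) : elts (sup (elts a)) = \bigcup_(x in elts a) elts x.
Proof. by apply: tosetE; exact: union_set. Qed.

(** Being countable, [cap M b] is bounded by some [c] of [Cset] below [b]; its hull has no ordinals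
    of [w2] outside [c], and none outside [M]. *)
Lemma X_cap M b : X M -> Gamma b -> X (cap M b).
Proof.
move=> XM Gb; have ob := Gamma_ord Gb; have bw := Gamma_w2 Gb.
split=> [|| c]; first exact: Y_init (X_Y XM) bw.
  have [x xb Mx] : exists2 x, x ∈ b & elts (cap M b) `<=` elts x.
    apply: (Gamma_bound Gb); first by rewrite elts_cap => x [].
    by apply: sub_countableS (X_countable XM); rewrite elts_cap => x [].
  have [c [[cw cC] cb xc]] := Gamma_C Gb xb.
  apply/seteqP; split=> y; last first.
    by move=> yM; split; [exact: Sk_base|move: yM; rewrite elts_cap => -[/(X_w2 XM)]].
  move=> [Sy yw]; rewrite elts_cap; split.
    apply: X_Sk XM _ yw; apply: Sk_mono Sy => z; rewrite elts_cap => -[zM _].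
    exact: Sk_base.
  have : elts c y.
    rewrite -cC; split=> //; apply: Sk_mono Sy => z zM; apply: Sk_base.
    by apply: ord_trans (ord_in ob cb) (Mx _ zM) xc.
  by move=> yc; exact: ord_trans ob yc cb.
rewrite !in_cap => -[cM cb]; split; first by case: XM => _ _; exact.
have oc := ord_in ob cb.
have sE : elts (sup (Cset w2 sk `&` elts c)) = \bigcup_(x in Cset w2 sk `&` elts c) elts x.
  apply: tosetE; apply: (@set_sub _ _ c) => z [x [_ xc] zx]; exact: ord_trans oc zx xc.
apply: ole_lt_trans ob _ cb; apply: sub_ole => //.
  by apply: ord_bigcup sE => x [_]; exact: ord_in.
rewrite sE => z [x [_ xc] zx]; exact: ord_trans oc zx xc.
Qed.

(** Minimality above a supremum becomes an interpolation property: [M] has an element strictly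
    between [b] and each smaller member of [Gamma]. In this form it visibly persists when [M]
    grows. *)
Lemma GammaMP M b : X M -> GammaM Gamma M b <-> Gamma b /\
  forall c, Gamma c -> c ∈ b -> exists x, [/\ x ∈ M, x ∈ b & c ∈ x].
Proof.
move=> XM; have inE c : c ∈ sup (elts (cap M b)) <-> exists x, [/\ x ∈ M, x ∈ b & c ∈ x].
  rewrite -eltsE elts_sup elts_cap; split=> [[x [xM xb] cx]|[x [xM xb cx]]]; by exists x.
split=> [[Gb [_ lb]]|[Gb h]]; split=> //.
  move=> c Gc cb; apply/inE; apply: contrapT => nc.
  by case: (ole_notin (lb c (conj Gc nc)) cb).
split.
  by split=> // /inE[x [_ xb bx]]; exact: isin_asym xb bx.
move=> c [Gc nc]; apply: ord_leNgt; [exact: Gamma_ord|exact: Gamma_ord|].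
by move=> cb; apply: nc; apply/inE; exact: h.
Qed.

(* The least b in Gamma with no element of Gamma_M /\ Gamma_N above it belongs to
   Gamma_M /\ Gamma_N. *)
Lemma beta_greatest M N : X M -> X N ->
  is_greatest (GammaM Gamma M `&` GammaM Gamma N) (beta M N).
Proof.
move=> XM XN; apply: (@xgetPex _ point (is_greatest (GammaM Gamma M `&` GammaM Gamma N))).
have [m mw Mm] := w2_bounded w1P w2P (X_w2 XM) (X_countable XM).
have [b0 Gb0 mb0] := Gamma_unbounded mw.
pose P b := Gamma b /\ forall c, GammaM Gamma M c -> GammaM Gamma N c -> ~ b ∈ c.
have [|b [[Gb bP] ob bm]] := @ord_least V P b0 (Gamma_ord Gb0).
  split=> // c /(GammaMP _ XM)[Gc h] _ bc.
  have [x [xM xc bx]] := h _ Gb0 bc.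
  apply: (isin_asym (ord_trans (ord_in ow2 mw) bx (Mm _ xM)) mb0).
(* If this fails, some [c] of [Gamma] below [b] is exceeded by no element of [K] below [b].
   Minimality of [b] gives a common point [d] above [c], and each position of [d] relative to [b] is
   contradictory. *)
have key K : X K -> GammaM Gamma M `&` GammaM Gamma N `<=` GammaM Gamma K ->
    GammaM Gamma K b.
  move=> XK sK; apply: contrapT => nb.
  have [c [Gc cb cP]] : exists c, [/\ Gamma c, c ∈ b &
      forall x, x ∈ K -> x ∈ b -> ~ c ∈ x].
    apply: contrapT => N'; apply: nb; apply/(GammaMP _ XK); split=> // c Gc cb.
    apply: contrapT => N2; apply: N'; exists c; split=> // x xK xb cx.
    by apply: N2; exists x.
  apply: (bm c cb); split=> // d Md Nd cd.
  have Kd : GammaM Gamma K d by apply: sK.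
  have od := Gamma_ord (Kd.1).
  have [db|e|bd] := ord_total od ob.
  - have [x [xK xd cx]] := (iffLR (GammaMP _ XK) Kd).2 _ Gc cd.
    exact: cP xK (ord_trans ob xd db) cx.
  - by subst d.
  - exact: bP Md Nd bd.
exists b; split; first by split; apply: key => // c [].
by move=> c [Mc Nc]; apply: ord_leNgt; [exact: ob|exact: Gamma_ord Mc.1|exact: bP].
Qed.

Lemma betaC M N : beta M N = beta N M.
Proof. by rewrite /comparison_point setIC. Qed.

Lemma beta_Gamma M N : X M -> X N -> Gamma (beta M N).
Proof. by move=> XM XN; have [[[]]] := beta_greatest XM XN. Qed.

Lemma beta_le M N c : X M -> X N -> GammaM Gamma M c -> GammaM Gamma N c ->
  ole c (beta M N).
Proof. by move=> XM XN Mc Nc; have [_] := beta_greatest XM XN; apply. Qed.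

(** Let [b] be the least element of [Gamma] above [succ x]. Smaller elements of [Gamma] are at most
    [succ x], so [succ (succ x)], which both models contain, interpolates and puts [b] in both sets
    of points. *)
Lemma common_in_beta M N x : X M -> X N -> x ∈ M -> x ∈ N -> x ∈ beta M N.
Proof.
move=> XM XN xM xN; have xw := X_w2 XM xM.
have sw : succ x ∈ w2 by exact: (succ_in_w2 w1P w2P).
have [b0 Gb0 sb0] := Gamma_unbounded sw.
have [b [[Gb sb] ob bm]] := ord_least (A := [set b | Gamma b /\ succ x ∈ b])
  (Gamma_ord Gb0) (conj Gb0 sb0).
have ssb : succ (succ x) ∈ b.
  have [d [_ db sd]] := Gamma_C Gb sb.
  have od := ord_in ob db; apply: ole_lt_trans ob _ db.
  apply: sub_ole => //; first exact/ord_succ/(ord_in ow2 sw).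
  by move=> y; rewrite eltsE in_succ => -[ys|->//]; exact: ord_trans od ys sd.
have key K : X K -> x ∈ K -> GammaM Gamma K b.
  move=> XK xK; apply/(GammaMP _ XK); split=> // c Gc cb.
  exists (succ (succ x)); split=> //; first by do 2 apply: X_succ => //.
  rewrite in_succ; apply: ord_leNgt; [exact: ord_in ow2 sw|exact: Gamma_ord|].
  by move=> sc; exact: (bm c cb).
apply: (lt_ole_trans (b := b)).
- exact/Gamma_ord/beta_Gamma.
- apply: ord_trans ob _ sb; by rewrite in_succ; right.
- by apply: beta_le => //; apply: key.
Qed.

Lemma GammaM_cap M b c : X M -> Gamma b ->
  GammaM Gamma (cap M b) c <-> GammaM Gamma M c /\ ole c b.
Proof.
move=> XM Gb; have ob := Gamma_ord Gb; rewrite !GammaMP //; last exact: X_cap.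
split=> [[Gc h]|[[Gc h] cb]].
  split; last first.
    apply: ord_leNgt; [exact: ob|exact: Gamma_ord|move=> bc].
    have [x []] := h _ Gb bc; rewrite in_cap => -[_ xb] _ bx; exact: isin_asym xb bx.
  by split=> // d Gd /(h d Gd)[x []]; rewrite in_cap => -[xM _] xc dx; exists x.
split=> // d Gd /(h d Gd)[x [xM xc dx]]; exists x; split=> //; rewrite in_cap.
by split=> //; exact: lt_ole_trans ob xc cb.
Qed.

(** * Adequacy and its amalgamation *)

Definition comparable_at M N b := [\/ cap M b = cap N b, S (elts N) (cap M b) | S (elts M) (cap N b)].

Lemma comparable_at_sym M N b : comparable_at M N b -> comparable_at N M b.
Proof. by case=> [e|h|h]; [constructor 1|constructor 3|constructor 2]. Qed.

Lemma cap_cap M b c : elts c `<=` elts b -> cap (cap M b) c = cap M c.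
Proof.
by move=> cb; apply: elts_inj; rewrite !elts_cap -setIA; congr (_ `&` _); exact/setIidPr.
Qed.

Lemma cap_w2 M b : X M -> elts (cap M b) `<=` elts w2.
Proof. by move=> XM; rewrite elts_cap => x [/(X_w2 XM)]. Qed.

Lemma cap_countable M b : X M -> countable (elts (cap M b)).
Proof.
by move=> XM; apply: sub_countableS (X_countable XM); rewrite elts_cap => x [].
Qed.

Lemma Sk_cap_le M N b c : X M -> X N -> ordinal b -> ole c b ->
  S (elts N) (cap M b) -> S (elts N) (cap M c).
Proof.
move=> XM XN ob cb SN; have oc : ordinal c by case: cb => [/(ord_in ob)|->].
rewrite -(cap_cap M (ole_sub ob cb)); apply: Sk_init => //.
  exact: cap_w2.
exact: cap_countable.
Qed.

(** Adequacy yields the disjunction at [beta M N] alone, but amalgamation needs it at smaller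
    ordinals. It persists because hulls of models contain the initial segments of their countable
    sets of ordinals. *)
Lemma comparable_at_le M N b c : X M -> X N -> ordinal b -> ole c b -> comparable_at M N b -> comparable_at M N c.
Proof.
move=> XM XN ob cb [e|h|h].
- constructor 1; by rewrite -(cap_cap M (ole_sub ob cb)) e (cap_cap N (ole_sub ob cb)).
- constructor 2; exact: Sk_cap_le h.
- constructor 3; exact: Sk_cap_le h.
Qed.

Lemma beta_cap_le M L b : X M -> X L -> Gamma b ->
  ole (beta (cap M b) L) (beta M L) /\ ole (beta (cap M b) L) b.
Proof.
move=> XM XL Gb; have XMb := X_cap XM Gb.
have [[/(GammaM_cap _ XM Gb)[Mg gb] Lg] _] := beta_greatest XMb XL.
by split=> //; exact: beta_le.
Qed.

(** This is what allows a model to stand for its initial segments. The one delicate case has a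
    segment of [L] in the hull of [M]; [Sk_Lambda] moves it into the hull of [cap M b]. *)
Lemma comparable_at_cap M L b : X M -> X L -> Gamma b -> comparable_at M L (beta M L) ->
  comparable_at (cap M b) L (beta (cap M b) L).
Proof.
move=> XM XL Gb rML; have [gML gb] := beta_cap_le XM XL Gb.
have XMb := X_cap XM Gb; have Gg := beta_Gamma XMb XL.
have ob := Gamma_ord Gb; have og := Gamma_ord Gg.
have oML := Gamma_ord (beta_Gamma XM XL).
set g := beta (cap M b) L in gML gb Gg og *.
have eM : cap (cap M b) g = cap M g by apply: cap_cap; exact: ole_sub ob gb.
have [e|h|h] := comparable_at_le XM XL oML gML rML.
- by constructor 1; rewrite eM.
- by constructor 2; rewrite eM.
constructor 3; apply: Sk_Lambda => //.
  by apply: Y_init (X_Y XL) _; exact: Gamma_w2.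
rewrite elts_cap => x [_ xg]; exact: lt_ole_trans ob xg gb.
Qed.

Lemma Sk_GammaM N L c : X N -> X L -> elts L `<=` elts N ->
  GammaM Gamma L c -> GammaM Gamma N c.
Proof.
move=> XN XL LN /(GammaMP _ XL)[Gc h]; apply/(GammaMP _ XN); split=> // d Gd dc.
by have [x [xL xc dx]] := h _ Gd dc; exists x; split=> //; exact: LN.
Qed.

Lemma comparable_at_below N L b : X N -> X L -> Gamma b -> S (elts N) L -> comparable_at L N b.
Proof.
move=> XN XL Gb SL; constructor 2; apply: Sk_init => //.
- exact: X_w2.
- exact: X_countable.
- exact: Gamma_ord.
Qed.

Lemma adequate_comparable A M N : adequate w2 Y sk Gamma A -> A M -> A N -> comparable_at M N (beta M N).
Proof. by move=> [_ h] AM AN; exact: h. Qed.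

Lemma adequate_X A M : adequate w2 Y sk Gamma A -> A M -> X M.
Proof. by move=> [h _]; exact: h. Qed.

Lemma comparable_at_refl M b : comparable_at M M b. Proof. by constructor 1. Qed.

(** A model in the hull of [N] has all its initial segments there, so the second alternative of
    adequacy holds against [N]. *)
Lemma adequate_add A N : adequate w2 Y sk Gamma A -> X N -> A `<=` S (elts N) ->
  adequate w2 Y sk Gamma (A `|` [set N]).
Proof.
move=> aA XN AN; have cmpN M : A M -> comparable_at M N (beta M N).
  move=> AM; have XM := adequate_X aA AM.
  by apply: comparable_at_below => //; [exact: beta_Gamma|exact: AN].
split=> [M [/(adequate_X aA)//|->//]|M L [AM|->] [AL|->] /=].
- exact: adequate_comparable aA AM AL.
- exact: cmpN.
- by rewrite betaC; apply: comparable_at_sym; exact: cmpN.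
- exact: comparable_at_refl.
Qed.

(** For [L] in [B], every point of [L] is a point of [N], so the comparison point of [M] and [L] is
    at most that of [M] and [N]. Hence the segment of [L] lies in the hull of [cap N b] by
    [Sk_Lambda]. If [cap N b] equals [cap M b] or lies in the hull of [M], the segment of [L]
    reaches the hull of [M]. Otherwise [M'] from [B] has [cap M b] as a segment, and its comparison
    with [L] passes to [cap M b] and then to [M]. *)
Lemma adequate_amalgam A B N : adequate w2 Y sk Gamma A -> adequate w2 Y sk Gamma B ->
  A N -> B `<=` S (elts N) ->
  (forall M, A M -> S (elts N) (cap M (beta M N)) ->
     exists M' b, [/\ B M', Gamma b & cap M' b = cap M (beta M N)]) ->
  adequate w2 Y sk Gamma (A `|` B).
Proof.
move=> aA aB AN BN AB; have XN := adequate_X aA AN.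
have cmpAB M L : A M -> B L -> comparable_at M L (beta M L).
  move=> AM BL; have XM := adequate_X aA AM; have XL := adequate_X aB BL.
  have SL := BN _ BL.
  have LN : elts L `<=` elts N.
    apply: Sk_sub => //; [exact: X_w2|exact: X_countable].
  set g := beta M L; set b := beta M N.
  have Gg : Gamma g by exact: beta_Gamma.
  have Gb : Gamma b by exact: beta_Gamma.
  have og := Gamma_ord Gg; have ob := Gamma_ord Gb.
  have [[Mg Lg] _] := beta_greatest XM XL.
  have gb : ole g b by apply: beta_le => //; exact: Sk_GammaM Lg.
  have SLg : S (elts N) (cap L g).
    apply: Sk_init => //; [exact: X_w2|exact: X_countable].
  have SLgb : S (elts (cap N b)) (cap L g).
    apply: Sk_Lambda => //; first exact: Y_init (X_Y XL) (Gamma_w2 Gg).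
    rewrite elts_cap => x [_ xg]; exact: lt_ole_trans ob xg gb.
  have [e|h|h] := adequate_comparable aA AM AN.
  - constructor 3; move: SLgb; rewrite -e; apply: Sk_mono => x.
    by rewrite elts_cap => -[xM _]; exact: Sk_base.
  - have [M' [c [BM' Gc e]]] := AB _ AM h.
    have XM' := adequate_X aB BM'.
    have := comparable_at_cap XM' XL Gc (adequate_comparable aB BM' BL); rewrite e -/b.
    (* Cutting [M] at [b] loses no common point with [L], since all of them are at most [b]. *)
    have -> : beta (cap M b) L = g.
      have XMb := X_cap XM Gb.
      have [gML _] := beta_cap_le XM XL Gb.
      have gg : ole g (beta (cap M b) L).
        by apply: beta_le => //; apply/(GammaM_cap _ XM Gb).
      by case: gML => // /(ole_notin gg).
    rewrite /comparable_at cap_cap; last exact: ole_sub.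
    case=> [->|SM|SM]; [by constructor 1|by constructor 2|constructor 3].
    by apply: Sk_mono SM => x; rewrite elts_cap => -[xM _]; exact: Sk_base.
  - constructor 3; apply: Sk_mono SLgb => x xNb; apply: Sk_base.
    by apply: Sk_sub h _ _ _ xNb => //; [exact: cap_w2|exact: cap_countable].
split=> [M [/(adequate_X aA)//|/(adequate_X aB)//]|M L [AM|BM] [AL|BL] /=].
- exact: adequate_comparable aA AM AL.
- exact: cmpAB.
- by rewrite betaC; apply: comparable_at_sym; exact: cmpAB.
- exact: adequate_comparable aB BM BL.
Qed.

End Adequacy.

(** * Countable submodels *)

Lemma countable_seqs (T : choiceType) (A : set T) : countable A ->
  countable [set s : seq T | forall x, x \in s -> A x].
Proof.
move=> /countableE[f fI]; apply: (@countableI _ _ _ (map f)) => s t As At.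
elim: s t As At => [|x s IH] [|y t] // As At /= [xy st].
have [As1 As2] : A x /\ forall z, z \in s -> A z.
  by split=> [|z zs]; apply: As; rewrite inE ?eqxx ?zs ?orbT.
have [At1 At2] : A y /\ forall z, z \in t -> A z.
  by split=> [|z zs]; apply: At; rewrite inE ?eqxx ?zs ?orbT.
by rewrite (fI x y As1 At1 xy) (IH t As2 At2 st).
Qed.

(** * Countable hulls under finitary operations *)

Section FinitaryHull.
Context (T : choiceType) (G : seq T -> set T).

(** The operation takes lists and is multivalued, so that a single [G] can bundle countably many
    operations of all arities. *)
Inductive hull (a : set T) : T -> Prop :=
| hull_base x : a x -> hull a x
| hull_step s x : (forall y, y \in s -> hull a y) -> G s x -> hull a x.

Lemma hull_least a (X : set T) : a `<=` X ->
  (forall s, (forall y, y \in s -> X y) -> G s `<=` X) -> hull a `<=` X.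
Proof.
by move=> aX GX x; elim=> [y /aX//|s y _ IH Gy]; exact: GX IH _ Gy.
Qed.

Lemma hull_mono a b : a `<=` hull b -> hull a `<=` hull b.
Proof. by move=> ab; apply: hull_least => // s sb x; exact: hull_step. Qed.

(** A list of members of the hull uses only finitely many stages of the chain. This is the closure
    half of the club argument for sets closed under a hull. *)
Lemma hull_chain (c : nat -> set T) : (forall n, c n `<=` c n.+1) ->
  hull (\bigcup_n c n) `<=` \bigcup_n hull (c n).
Proof.
move=> cS; have cM m n : (m <= n)%N -> hull (c m) `<=` hull (c n).
  move=> mn; apply: hull_mono => x cx; apply: hull_base.
  elim: n mn => [|n IH]; first by rewrite leqn0 => /eqP <-.
  by rewrite leq_eqVlt => /orP[/eqP <-//|/IH]; exact: cS.
apply: hull_least => [x [n _ cx]|s IH x Gx].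
  by exists n => //; exact: hull_base.
suff [n sn] : exists n, forall y, y \in s -> hull (c n) y.
  by exists n => //; exact: hull_step Gx.
elim: s IH {Gx} => [|y s IH] h; first by exists 0%N.
have [|n sn] := IH; first by move=> z zs; apply: h; rewrite inE zs orbT.
have [|m _ ym] := h y; first exact: mem_head.
exists (maxn m n) => z; rewrite inE => /orP[/eqP->|/sn zn].
  exact: cM (leq_maxl _ _) _ ym.
exact: cM (leq_maxr _ _) _ zn.
Qed.

Lemma hull_countable a : (forall s, countable (G s)) -> countable a ->
  countable (hull a).
Proof.
(* [it n] collects what is reached in at most [n] rounds; countability of the set of lists keeps
   each round countable. *)
move=> cG ca; pose it := fix it n := if n is n'.+1 then
  it n' `|` \bigcup_(s in [set s : seq T | forall x, x \in s -> it n' x]) G s else a.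
have cit n : countable (it n).
  elim: n => //= n IH; apply: countableU => //.
  by apply: bigcup_countable => //; exact: countable_seqs.
have itM m n : (m <= n)%N -> it m `<=` it n.
  elim: n => [|n IH]; first by rewrite leqn0 => /eqP ->.
  by rewrite leq_eqVlt => /orP[/eqP->//|/IH mn x /mn]; left.
apply: (@sub_countableS _ _ (\bigcup_n it n)); last exact: bigcup_countable.
apply: hull_least => [x ax|s IH x Gx]; first by exists 0%N.
suff [n sn] : exists n, forall y, y \in s -> it n y.
  by exists n.+1 => //=; right; exists s.
elim: s IH {Gx} => [|y s IH] h; first by exists 0%N.
have [|n sn] := IH; first by move=> z zs; apply: h; rewrite inE zs orbT.
have [|m _ ym] := h y; first exact: mem_head.
exists (maxn m n) => z; rewrite inE => /orP[/eqP->|/sn zn].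
  exact: itM (leq_maxl _ _) _ ym.
exact: itM (leq_maxr _ _) _ zn.
Qed.

End FinitaryHull.

(** The criterion asks for counterexamples rather than witnesses because the universal quantifier is
    the primitive one. *)
Lemma tarski_vaught (T : Type) (L : language)
  (I : forall s : L, ('I_(arity s) -> T) -> Prop) (N D : set T) :
  N `<=` D ->
  (forall n (f : formula L n.+1) (e : 'I_n -> T), (forall i, N (e i)) ->
     (exists x, D x /\ ~ sat I D f (scons x e)) ->
     exists x, N x /\ ~ sat I D f (scons x e)) ->
  elementary_substructure I N D.
Proof.
move=> ND tv; split=> // n f; elim: f => {n} [n|n i j|n s v|n f IHf g IHg|n f IHf] e Ne //=.
  by rewrite IHf // IHg.
split=> h x; last by move=> Nx; apply/IHf; [exact: scons_in|apply: h; exact: ND].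
move=> Dx; apply: contrapT => nf.
have [|y [Ny nfy]] := tv _ f e Ne; first by exists x.
by apply: nfy; apply/IHf; [exact: scons_in|exact: h].
Qed.

(** * Reflection of finite configurations *)

Section Reflection.
Context (V : zfc) (Q : finType) (Th : Q -> V -> V -> V -> Prop).

(** The quantifier-free type of a list, recorded as booleans: only countably many types arise, so a
    countable set can be closed under a realisation of each. *)
Definition diagram n (l : seq V) : seq bool :=
  [seq `[< Th p.1 (nth point l p.2.1) (nth point l p.2.2.1) (nth point l p.2.2.2) >]
  | p : Q * ('I_n * ('I_n * 'I_n)) <- enum {: Q * ('I_n * ('I_n * 'I_n))}].

Lemma diagramP n l l' : diagram n l = diagram n l' ->
  forall q i j k, (i < n)%N -> (j < n)%N -> (k < n)%N ->
  Th q (nth point l i) (nth point l j) (nth point l k) <->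
  Th q (nth point l' i) (nth point l' j) (nth point l' k).
Proof.
move=> /eq_in_map h q i j k hi hj hk.
have := h (q, (Ordinal hi, (Ordinal hj, Ordinal hk))) (mem_enum _ _).
by move=> /= e; split=> a; apply/asboolP; [rewrite -e|rewrite e]; apply/asboolP.
Qed.

Definition type_witness (H : set V) (s : seq V) m (d : seq bool) : seq V :=
  xget [::] [set l | [/\ size l = m, forall x, x \in l -> H x &
    diagram (size s + m) (s ++ l) = d]].

(** Elementarity for [∈] says nothing of arbitrary relations [Th]. Instead the entries of [l] in [N]
    serve as parameters, and the other entries are replaced by the chosen tuple that has the same
    diagram over them; [N] contains this tuple. *)
Lemma reflect_types (H N : set V) :
  (forall s, (forall x, x \in s -> N x) -> forall m d x,
     x \in type_witness H s m d -> H x -> N x) ->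
  forall l : seq V, (forall x, x \in l -> H x) -> exists bar : V -> V,
    [/\ forall x, x \in l -> N (bar x),
        forall x, x \in l -> N x -> bar x = x &
        forall q x y z, x \in l -> y \in l -> z \in l ->
          Th q x y z <-> Th q (bar x) (bar y) (bar z)].
Proof.
move=> NT l lH; pose s := [seq x <- l | `[< N x >]].
pose r := [seq x <- l | ~~ `[< N x >]].
have sN x : x \in s -> N x by rewrite mem_filter => /andP[/asboolP].
pose r' := type_witness H s (size r) (diagram (size s + size r) (s ++ r)).
have [szr r'H dr] : [/\ size r' = size r, forall x, x \in r' -> H x &
    diagram (size s + size r) (s ++ r') = diagram (size s + size r) (s ++ r)].
  apply: (@xgetPex _ [::] [set l | [/\ size l = size r, forall x, x \in l -> H x &
    diagram (size s + size r) (s ++ l) = diagram (size s + size r) (s ++ r)]]).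
  by exists r; split=> // x; rewrite mem_filter => /andP[_ /lH].
have lL x : x \in l -> x \in s ++ r.
  by move=> xl; rewrite mem_cat !mem_filter xl !andbT; case: asboolP.
have lI x : x \in l -> (index x (s ++ r) < size s + size r)%N.
  by move=> /lL; rewrite -index_mem size_cat.
exists (fun x => nth point (s ++ r') (index x (s ++ r))); split=> [x xl|x xl Nx|].
- have : nth point (s ++ r') (index x (s ++ r)) \in s ++ r'.
    by apply: mem_nth; rewrite size_cat szr; exact: lI.
  rewrite mem_cat => /orP[/sN//|h]; exact: NT sN _ _ _ h (r'H _ h).
- have xs : x \in s by rewrite mem_filter xl andbT; exact/asboolP.
  by rewrite index_cat xs nth_cat index_mem xs nth_index.
move=> q x y z xl yl zl; rewrite -(diagramP (esym dr)) ?lI //.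
by rewrite !nth_index ?lL.
Qed.

End Reflection.

(** * Existence of suitable countable models *)

Section Models.
Context (V : zfc) (w1 w2 : V) (w1P : is_omega1 w1) (w2P : is_omega2 w1 w2).
Context (pi : V -> V) (Y : set V) (sk : skolem_family V langA).
Context (pi_bij : set_bij (elts w2) (Hset w2) pi).
Context (Y_sub : Y `<=` Pomega1 (elts w2)).
Context (Y_stat : stationary_Pomega1 (elts w2) Y).
Context (skP : definable_skolem_functions (interpA w2 pi Y) (Hset w2) sk).
Context (Q : finType) (Th : Q -> V -> V -> V -> Prop).
Context (t : V) (ot : ordinal t) (w2t : w2 ∈ t).
Context (A : set V) (A_club : club_Pomega1 (Hset t) A).
Implicit Types (x y z a b c M N : V).

Local Notation H := (Hset t).

(** [good_hull] turns membership in the hull of the trace of [N] on [w2] into plain membership in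
    [N] for elements of H(omega2). *)
Record good_model N : Prop := GoodModel {
  good_club : A N;
  good_elementary : elementary_substructure (@isin_interp V) (elts N) H;
  good_X : Xset w2 Y sk (cap N w2);
  good_hull : Sk sk (elts (cap N w2)) = elts N `&` Hset w2;
  good_countable : forall x, x ∈ N -> countable (elts x) -> elts x `<=` elts N;
  good_reflect : forall l : seq V, (forall x, x \in l -> H x) -> exists bar : V -> V,
    [/\ forall x, x \in l -> bar x ∈ N,
        forall x, x \in l -> x ∈ N -> bar x = x &
        forall q x y z, x \in l -> y \in l -> z \in l ->
          Th q x y z <-> Th q (bar x) (bar y) (bar z)]
}.

Lemma H_w2 : Hset w2 `<=` H.
Proof.
move=> x; rewrite /Hset /=; apply: contra => /(card_le_trans _); apply.
apply: subset_card_le; exact: ord_transitive.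
Qed.

Lemma countable_elts_set (a : set V) : countable a -> elts (toset a) = a.
Proof. by move=> /countable_set/tosetE. Qed.

Let club_next b x := get [set b' | A b' /\ elts b `<=` elts b' /\ (H x -> x ∈ b')].

Let club_nextP b x : A b ->
  [/\ A (club_next b x), elts b `<=` elts (club_next b x) & H x -> x ∈ club_next b x].
Proof.
move=> Ab; have [Asub Acof _] := A_club; have [bH cb] := Asub b Ab.
have cb1 : countable (elts b `|` [set y | y = x /\ H x]).
  apply: countableU => //.
  by apply: (@sub_countableS _ _ [set x]); [move=> y []|exact: countable1].
have b1E := countable_elts_set cb1.
have [|b' Ab' bb'] := Acof (toset (elts b `|` [set y | y = x /\ H x])).
  by split; rewrite b1E // => y [/bH//|[->]].
have : [set b' | A b' /\ elts b `<=` elts b' /\ (H x -> x ∈ b')] (club_next b x).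
  apply: xgetPex; exists b'; split=> //; rewrite b1E in bb'.
  by split=> [y yb|Hx]; apply: bb'; [left|right].
by case=> ? [].
Qed.

Let club_base : exists b, A b.
Proof.
have [_ Acof _] := A_club; have [b0 b0E] := set0_set V.
by have [|b Ab _] := Acof b0; [split; rewrite b0E //; exact: countable0|exists b].
Qed.

(** Members of the given club indexed by finite lists. Along the prefixes of an enumeration of N
    they increase with union N, which puts N in the club. *)
Let chain := fix chain (s : seq V) : V :=
  if s is x :: s' then club_next (chain s') x else get A.

Let chain_A s : A (chain s).
Proof.
elim: s => [|x s IH] /=; first exact: (xgetPex _ club_base).
by have [] := club_nextP x IH.
Qed.

Let wit n (f : formula lang_set n.+1) (e : 'I_n -> V) : V :=
  get [set y | H y /\ ~ sat (@isin_interp V) H f (scons y e)].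

Let env (s : seq V) n : 'I_n -> V := fun i => nth point s i.

(** Unary operations act on the head of the list. Intersecting with [H] keeps the hull inside H(t)
    even where [env] falls back on its default value. [w1] is added so that hulls are nonempty and
    can be enumerated. *)
Let G (s : seq V) : set V := H `&` [set y | 
  [\/ y ∈ chain s \/ y = w1,
      exists n (f : formula lang_set n.+1), y = wit f (@env s n),
      exists n (f : formula langA n.+1), y = sk f (@env s n) |
      [\/ countable (elts (head point s)) /\ y ∈ head point s,
          y ∈ w2 /\ pi y = head point s,
          y = sup (Cset w2 sk `&` elts (head point s)) |
          exists m d, y \in type_witness Th H s m d]]].

Let code_lang_set : injective (fun s : lang_set => 0%N).
Proof. by move=> [] []. Qed.

Let code_langA : injective (fun s : langA => match s with InA => 0 | PiA => 1 | YA => 2 end).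
Proof. by move=> [] []. Qed.

Let G_countable s : countable (G s).
Proof.
have [Asub _ _] := A_club.
have c1 : countable (elts (chain s) `|` [set w1]).
  by apply: countableU; [have [] := Asub _ (chain_A s)|exact: countable1].
have c2 : countable (\bigcup_n range (fun f : formula lang_set n.+1 => wit f (@env s n))).
  apply: bigcup_countable => // n _; apply: countable_img.
  exact: countable_formula code_lang_set _.
have c3 : countable (\bigcup_n range (fun f : formula langA n.+1 => sk f (@env s n))).
  apply: bigcup_countable => // n _; apply: countable_img.
  exact: countable_formula code_langA _.
have c4 : countable [set y | countable (elts (head point s)) /\ y ∈ head point s].
  have [c|nc] := pselect (countable (elts (head point s))).
    by apply: sub_countableS c => y [].
  by apply: (@sub_countableS _ _ set0); [move=> y []|exact: countable0].
have c5 : countable [set y | y ∈ w2 /\ pi y = head point s].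
  have [_ piI _] := pi_bij.
  apply: (@countableI _ nat _ (fun=> 0%N)) => x y [xw xh] [yw yh] _.
  by apply: piI; rewrite ?xh ?yh //; exact/mem_set.
have c6 : countable (\bigcup_(p in [set: nat * seq bool])
    [set` type_witness Th H s p.1 p.2]).
  by apply: bigcup_countable => // p _; exact/finite_set_countable/finite_seq.
apply: (sub_countableS _ (countableU c1 (countableU c2 (countableU c3 (countableU c4
  (countableU c5 (countableU (countable1 (sup (Cset w2 sk `&` elts (head point s)))) c6))))))).
move=> y [_ [h|[n [f h]]|[n [f h]]|[h|h|h|[m [d h]]]]].
- by left.
- by right; left; exists n => //; exists f.
- by right; right; left; exists n => //; exists f.
- by right; right; right; left.
- by right; right; right; right; left.
- by right; right; right; right; right; left.
- by right; right; right; right; right; right; exists (m, d).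
Qed.

Local Notation cl := (hull G).

Let cl_countable (a : set V) : countable a -> countable (cl a).
Proof. exact: hull_countable G_countable. Qed.

Let cl_H (a : set V) : a `<=` H -> cl a `<=` H.
Proof. by move=> aH; apply: hull_least => // s _ x []. Qed.

(** For club many [a] the hull of [a] adds no new ordinals of [w2]; this transfers stationarity from
    subsets of [w2] to subsets of H(t). *)
Let C := [set a | Pomega1 (elts w2) a /\ cl (elts a) `&` elts w2 `<=` elts a].

Let C_club : club_Pomega1 (elts w2) C.
Proof.
split=> [a []//|a [aw ca]|c cC cS].
  have cb : countable (cl (elts a) `&` elts w2).
    by apply: sub_countableS (cl_countable ca) => x [].
  have bE := countable_elts_set cb.
  exists (toset (cl (elts a) `&` elts w2)); last first.
    by rewrite bE => x xa; split; [exact: hull_base|exact: aw].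
  split; first by split; rewrite bE // => x [].
  rewrite bE => x [h xw]; split=> //; apply: hull_mono h => y [].
  by [].
have cb : countable (\bigcup_n elts (c n)).
  by apply: bigcup_countable => // n _; have [[]] := cC n.
have bE := countable_elts_set cb.
split; first by split; rewrite bE // => x [n _]; have [[h _] _] := cC n; exact: h.
rewrite bE => x [/(hull_chain cS)[n _ h] xw]; exists n => //.
by have [_] := cC n; apply.
Qed.

(** Stationarity gives a member [a] of [Y] in this club, and N is the hull of [a]. Its trace on [w2]
    is then [a] itself, hence in [Y]; the clauses of [G] provide the remaining closure
    properties. *)
Lemma good_model_exists : exists N, good_model N.
Proof.
have [a [Ya [[aw ca] aC]]] := Y_stat C_club.
have cN : countable (cl (elts a)) by exact: cl_countable.
pose N := toset (cl (elts a)).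
have NE : elts N = cl (elts a) by exact: countable_elts_set.
have NH : elts N `<=` H.
  by rewrite NE; apply: cl_H => x /aw/(w2_sub_H w2P)/H_w2.
have NG s y : (forall x, x \in s -> x ∈ N) -> G s y -> y ∈ N.
  move=> sN Gy; rewrite -eltsE NE; apply: hull_step Gy => z /sN.
  by rewrite -eltsE NE.
have capE : cap N w2 = a.
  apply: elts_inj; rewrite elts_cap NE; apply/seteqP; split=> // x xa.
  by split; [exact: hull_base|exact: aw].
have w1H : H w1 by apply/H_w2/(w2_sub_H w2P)/w1_in_w2.
have env_ex n (e : 'I_n -> V) : (forall i, e i ∈ N) ->
    exists2 s : seq V, (forall x, x \in s -> x ∈ N) & e = @env s n.
  move=> eN; exists [seq e i | i <- enum 'I_n].
    by move=> x /mapP[i _ ->].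
  apply: funext => i; rewrite /env (nth_map i) ?size_enum_ord ?ltn_ord //.
  by rewrite nth_ord_enum.
have one x : x ∈ N -> forall y, y \in [:: x] -> y ∈ N.
  by move=> xN y; rewrite inE => /eqP ->.
have skN n (f : formula langA n.+1) (e : 'I_n -> V) :
    (forall i, e i ∈ N /\ Hset w2 (e i)) -> sk f e ∈ N.
  move=> eN; have [|s sN es] := env_ex n e; first by move=> i; case: (eN i).
  apply: (NG s) => //; split; last by apply: Or43; exists n, f; rewrite es.
  by apply: H_w2; have [[h _] _] := skP f; apply: h => i; case: (eN i).
have elemN : elementary_substructure (@isin_interp V) (elts N) H.
  apply: tarski_vaught => // n f e eN [x [Hx nx]].
  have [s sN es] := env_ex n e eN.
  have [Hw nw] : [set y | H y /\ ~ sat (@isin_interp V) H f (scons y e)] (wit f e).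
    by apply: xgetPex; exists x.
  exists (wit f e); split=> //; apply: (NG s) => //.
  by split=> //; apply: Or42; exists n, f; rewrite es.
have N_w2 x : x ∈ N -> x ∈ w2 -> x ∈ a by move=> xN xw; rewrite -capE in_cap.
have aN x : x ∈ a -> x ∈ N /\ x ∈ w2 by rewrite -capE in_cap.
have aH : elts a `<=` Hset w2 by move=> x /aw/(w2_sub_H w2P).
have hullN : Sk sk (elts a) `<=` elts N `&` Hset w2.
  apply: Sk_least => [x xa|n f e eN].
    by split; [case: (aN x xa)|exact: aH].
  split; first by apply: skN.
  by have [[h _] _] := skP f; apply: h => i; case: (eN i).
have Nhull x : x ∈ N -> Hset w2 x -> Sk sk (elts a) x.
  move=> xN Hx; have [_ _ /(_ x Hx)[b bw pib]] := pi_bij.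
  rewrite -pib; apply: (Sk_pi pi_bij skP) => //; apply: Sk_base; apply: N_w2 => //.
  apply: (NG [:: x]); first exact: one.
  by split; [exact/H_w2/(w2_sub_H w2P)|apply: Or44; exact: Or42].
exists N; split=> //.
- have [_ _ Achain] := A_club.
  have [|e eE] := countable_enum cN.
    exists w1; rewrite -NE; apply: (NG [::]) => //.
    by split=> //; apply: Or41; right.
  (* Prefixes of the enumeration in reverse order, so that [chain (l n.+1)] extends [chain (l n)]
     and absorbs [e n]. *)
  pose l := fix l n := if n is n'.+1 then e n' :: l n' else [::].
  have eN n : e n ∈ N by rewrite -eltsE NE -eE; exists n.
  have lN n x : x \in l n -> x ∈ N.
    by elim: n => //= n IH; rewrite inE => /orP[/eqP->|].
  have [Asub _ _] := A_club.
  suff -> : N = toset (\bigcup_n elts (chain (l n))).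
    apply: Achain => [n|n]; first exact: chain_A.
    by have [] := club_nextP (e n) (chain_A (l n)).
  rewrite -[LHS]toset_elts; congr toset; apply/seteqP; split=> x; last first.
    move=> [n _ xn]; apply: (NG (l n)); first exact: lN.
    split; first by have [h _] := Asub _ (chain_A (l n)); exact: h.
    by apply: Or41; left.
  rewrite NE -eE => -[n _ <-]; exists n.+1 => //=.
  have [_ _] := club_nextP (e n) (chain_A (l n)); apply; exact: NH (eN n).
- rewrite capE; split=> // [|c ca'].
    apply/seteqP; split=> x; first by move=> [/hullN[xN _] xw]; exact: N_w2.
    by move=> xa; split; [exact: Sk_base|exact: aw].
  have [cN' cw] := aN c ca'; have ow2 := w2_ord w2P; have oc := ord_in ow2 cw.
  have sE : elts (sup (Cset w2 sk `&` elts c)) = \bigcup_(x in Cset w2 sk `&` elts c) elts x.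
    apply: tosetE; apply: (@set_sub _ _ c) => z [x [_ xc] zx]; exact: ord_trans oc zx xc.
  have sw : sup (Cset w2 sk `&` elts c) ∈ w2.
    apply: ole_lt_trans ow2 _ cw; apply: sub_ole => //.
      by apply: ord_bigcup sE => x [_]; exact: ord_in.
    rewrite sE => z [x [_ xc] zx]; exact: ord_trans oc zx xc.
  apply: N_w2 => //; apply: (NG [:: c]); first exact: one.
  by split; [exact/H_w2/(w2_sub_H w2P)|apply: Or44; exact: Or43].
- rewrite capE; apply/seteqP; split=> // x [xN Hx]; exact: Nhull.
- move=> x xN cx y yx; apply: (NG [:: x]); first exact: one.
  split; first exact: Hset_trans yx (NH _ xN).
  by apply: Or44; exact: Or41.
- apply: reflect_types => s sN m d x xs Hx; apply: (NG s) => //.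
  by split=> //; apply: Or44; apply: Or44; exists m, d.
Qed.

End Models.

(** * Conditions and their amalgamation *)

Section Conditions.
Context (V : zfc) (w1 w2 : V) (Y : set V) (sk : skolem_family V langA) (Gamma : set V).
Implicit Types (x y z a b c p q M N : V).

Definition pr1 p := get [set x | exists y, p = opair x y].
Definition pr2 p := get [set y | exists x, p = opair x y].

Lemma pr1E x y : pr1 (opair x y) = x.
Proof.
have [z] : [set z | exists t, opair x y = opair z t] (pr1 (opair x y)).
  by apply: xgetPex; exists x, y.
by move=> /opair_inj[].
Qed.

Lemma pr2E x y : pr2 (opair x y) = y.
Proof.
have [z] : [set t | exists z, opair x y = opair z t] (pr2 (opair x y)).
  by apply: xgetPex; exists y, x.
by move=> /opair_inj[].
Qed.

Definition nodes p : set V := elts (pr1 (pr1 (pr1 p))).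
Definition below p x y : Prop := tlt (pr2 (pr1 (pr1 p))) x y.
Definition label p x : V := app (pr2 (pr1 p)) x.
Definition mods p : set V := elts (pr2 p).

Definition top (T : set V) (R : V -> V -> Prop) x := T x /\ forall y, ~ R x y.

(** A condition with its codes removed, so that trees can be built from Rocq predicates. Labels are
    total functions, and only their values on tops matter. *)
Record condition_on (T : set V) (R : V -> V -> Prop) (F : V -> V) (A : set V) : Prop := {
  co_w1 : T `<=` elts w1;
  co_finite : finite_set T;
  co_nodes : forall x y, R x y -> T x /\ T y;
  co_trans : forall x y z, R x y -> R y z -> R x z;
  co_tree : forall x y z, R x z -> R y z -> [\/ x = y, R x y | R y x];
  co_in : forall x y, R x y -> x ∈ y;
  co_w2 : forall x, top T R x -> F x ∈ w2;
  co_inj : forall x y, top T R x -> top T R y -> F x = F y -> x = y;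
  co_models : finite_set A;
  co_adequate : adequate w2 Y sk Gamma A;
  co_sep : forall M a b, A M -> top T R a -> top T R b -> a <> b ->
    F a ∈ M -> F b ∈ M -> forall c, R c a -> R c b -> c ∈ M
}.

Lemma tripleE T R F A : let p := triple T R F A in
  [/\ nodes p = elts T, below p = tlt R, label p = app F & mods p = elts A].
Proof. by rewrite /nodes /below /label /mods /triple !pr1E !pr2E. Qed.

Lemma appE (f : V) x y : (forall z, opair x z ∈ f -> z = y) -> opair x y ∈ f -> app f x = y.
Proof.
move=> u xy; apply: u; exact: (xgetPex point (P := [set z | opair x z ∈ f]) (ex_intro _ y xy)).
Qed.

Lemma injection_app (f : V) A B x : injection_graph f A B -> A x ->
  [/\ opair x (app f x) ∈ f, B (app f x) & forall y, opair x y ∈ f -> y = app f x].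
Proof.
move=> [f1 f2 f3] Ax; have [y [xy yu]] := f2 x Ax.
have e : app f x = y by apply: appE => // z /yu.
rewrite e; split=> //; last by move=> z /yu.
by have [x' [y' [/opair_inj[_ ->] _]]] := f1 _ xy.
Qed.

Local Notation P := (poset w1 w2 Y sk Gamma).

Lemma poset_condition p : P p -> condition_on (nodes p) (below p) (label p) (mods p).
Proof.
move=> [T [R [F [A [-> []]]]]].
have [-> -> -> ->] := tripleE T R F A.
move=> [[T1 T2 T3] [T4 T5 T6 T7]] Fi [A1 A2] sep; split=> //.
- by move=> x y /T3[x' [y' [/opair_inj[-> ->]]]].
- by move=> x mx; have [] := injection_app Fi mx.
- move=> x y mx my e; have [fx _ _] := injection_app Fi mx.
  have [fy _ _] := injection_app Fi my; case: Fi => _ _ f3.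
  by apply: f3 fx _; rewrite e.
Qed.

Lemma condition_poset T R F A : condition_on T R F A -> exists p,
  [/\ P p, nodes p = T, forall x y, below p x y <-> R x y,
      forall x, top T R x -> label p x = F x & mods p = A].
Proof.
move=> co; have fT := co_finite co; have fA := co_models co.
have TE : elts (toset T) = T by apply: tosetE; exact: finite_set_set.
have AE : elts (toset A) = A by apply: tosetE; exact: finite_set_set.
pose RR := toset [set opair q.1 q.2 | q in [set q : V * V | R q.1 q.2]].
have RE : elts RR = [set opair q.1 q.2 | q in [set q : V * V | R q.1 q.2]].
  apply: tosetE; apply: finite_set_set; apply: finite_image.
  apply: (@sub_finite_set _ _ (T `*` T)); last exact: finite_setX.
  by move=> [x y] /= /(co_nodes co).
have ltE x y : tlt RR x y <-> R x y.
  rewrite /tlt -eltsE RE; split=> [[[x' y'] /= h /opair_inj[<- <-]//]|h].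
  by exists (x, y).
have topE : maximal_node (toset T) RR = top T R.
  apply/seteqP; split=> x [Tx h]; split.
  - by rewrite -TE.
  - by move=> y /ltE; exact: h.
  - by rewrite -eltsE TE.
  - by move=> y /ltE; exact: h.
pose FF := toset [set opair x (F x) | x in top T R].
have FE : elts FF = [set opair x (F x) | x in top T R].
  apply: tosetE; apply: finite_set_set; apply: finite_image.
  by apply: sub_finite_set fT => x [].
have FFi : injection_graph FF (maximal_node (toset T) RR) (elts w2).
  rewrite topE; split.
  - move=> q; rewrite -eltsE FE => -[x mx <-]; exists x, (F x); split=> //.
    exact: co_w2 co _ mx.
  - move=> x mx; exists (F x); split; first by rewrite -eltsE FE; exists x.
    by move=> y; rewrite -eltsE FE => -[x' _ /opair_inj[-> ->]].
  - move=> x x' y; rewrite -!eltsE FE => -[z mz /opair_inj[ez e1]] [z' mz' /opair_inj[ez' e2]].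
    by subst x x'; apply: (co_inj co) => //; rewrite e1 e2.
have appFE x : top T R x -> app FF x = F x.
  rewrite -topE => /(injection_app FFi)[+ _ _].
  by rewrite -eltsE FE => -[x' _ /opair_inj[-> <-]].
exists (triple (toset T) RR FF (toset A)); have [-> -> -> ->] := tripleE (toset T) RR FF (toset A).
split=> //; exists (toset T), RR, FF, (toset A); split=> //; split=> //.
- split; split; rewrite ?TE ?AE.
  + exact: co_w1 co.
  + exact: fT.
  + move=> q; rewrite -eltsE RE => -[[x y] /= h <-]; exists x, y; split=> //;
      by rewrite -eltsE TE; case: (co_nodes co h).
  + by move=> x /ltE/(co_in co)/isin_irr.
  + by move=> x y z /ltE xy /ltE yz; apply/ltE; exact: (co_trans co xy yz).
  + move=> x y z /ltE xz /ltE yz; have [->|h|h] := co_tree co xz yz.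
    * by constructor 1.
    * by constructor 2; apply/ltE.
    * by constructor 3; apply/ltE.
  + by move=> x y /ltE/(co_in co).
- by rewrite AE; split=> //; exact: co_adequate co.
move=> M a b; rewrite topE => MA ma mb ab; rewrite !appFE // => Fa Fb c /ltE ca /ltE cb.
by apply: (co_sep co _ ma mb ab Fa Fb ca cb); rewrite -AE.
Qed.

Lemma poset_leP q p : P p -> P q -> poset_le q p <->
  [/\ nodes p `<=` nodes q,
      forall x y, nodes p x -> nodes p y -> (below q x y <-> below p x y),
      mods p `<=` mods q &
      forall a, top (nodes p) (below p) a -> exists b,
        [/\ top (nodes q) (below q) b, a = b \/ below q a b & label p a = label q b]].
Proof.
move=> [T [R [F [A [-> _]]]]] [T' [R' [F' [A' [-> _]]]]].
have [-> -> -> ->] := tripleE T R F A; have [-> -> -> ->] := tripleE T' R' F' A'.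
split=> [|[h1 h2 h3 h4]]; last first.
  by exists T, R, F, A, T', R', F', A'; split.
move=> [T1 [R1 [F1 [A1 [T1' [R1' [F1' [A1' [+ + [h1 h2] h3 h4]]]]]]]]].
move=> /opair_inj[/opair_inj[/opair_inj[eT eR] eF] eA].
move=> /opair_inj[/opair_inj[/opair_inj[eT' eR'] eF'] eA'].
by subst.
Qed.

Section InModel.
Context (N : V) (N_countable : forall x, x ∈ N -> countable (elts x) -> elts x `<=` elts N).

Lemma opair_model x y : opair x y ∈ N -> x ∈ N /\ y ∈ N.
Proof.
have c2 (u v : V) : countable (elts (toset [set u; v])).
  rewrite elts_pairE; exact/finite_set_countable/finite_set2.
move=> /N_countable /(_ (c2 (toset [set x]) (toset [set x; y]))); rewrite elts_opair => h.
have /N_countable : toset [set x; y] ∈ N by apply: h; right.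
move=> /(_ (c2 _ _)); rewrite elts_pairE => {}h.
by split; apply: h; [left|right].
Qed.

(** Pairs and the finite components of a condition are countable sets, so [N_countable] takes them
    apart inside [N]. *)
Lemma condition_model p : P p -> p ∈ N -> [/\ nodes p `<=` elts N, mods p `<=` elts N &
  forall x, top (nodes p) (below p) x -> label p x ∈ N].
Proof.
move=> [T [R [F [A [-> [[[_ fT _] _] Fi [fA _] _]]]]]].
have [-> -> -> ->] := tripleE T R F A.
move=> /opair_model[/opair_model[/opair_model[TN RN] FN] AN].
have fF : countable (elts F).
  have [f1 f2 f3] := Fi.
  apply: (@sub_countableS _ _ [set opair x (app F x) | x in elts T]); last first.
    exact/countable_img/finite_set_countable.
  move=> q qF; have [x [y [e mx yw]]] := f1 _ qF; subst q; exists x; first by case: mx.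
  by have [_ _ /(_ _ qF) ->] := injection_app Fi mx.
split.
- exact/N_countable/finite_set_countable.
- exact/N_countable/finite_set_countable.
move=> x mx; have [xF _ _] := injection_app Fi mx.
by have /opair_model[] := N_countable FN fF xF.
Qed.

End InModel.

End Conditions.

(** * Raising the maximal nodes out of a countable set *)

Section Topping.
Context (V : zfc) (w1 w2 : V) (w1P : is_omega1 w1) (Y : set V) (sk : skolem_family V langA).
Context (Gamma : set V).
Implicit Types (x y z a b c M : V).

Local Notation condition_on := (@condition_on V w1 w2 Y sk Gamma).

(** Each top gets one new node above it, which inherits its value. Two distinct new tops share
    exactly the nodes that the old tops shared, so separation is not affected. *)
Lemma condition_raise_tops T R F A (B : set V) : condition_on T R F A -> countable B ->
  exists T1 R1 F1, [/\ condition_on T1 R1 F1 A,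
    T `<=` T1, forall x y, T x -> T y -> (R1 x y <-> R x y),
    forall a, top T R a -> exists b, [/\ top T1 R1 b, R1 a b & F a = F1 b] &
    forall b, top T1 R1 b -> ~ B b].
Proof.
move=> co cB.
pose Z := [set x | [/\ x ∈ w1, ~ B x & forall y, T y -> y ∈ x]].
have ow1 := w1_ord w1P.
(* Outside [Z] there are only the members of [B] and the ordinals at most some node of the finite
   tree, countably many in all. *)
have infZ : infinite_set Z.
  move=> fZ; apply: (w1_uncountable w1P).
  apply: (@sub_countableS _ _ (B `|` (\bigcup_(y in T) elts (succ y) `|` Z))).
    move=> x xw; have [|nB] := pselect (B x); [by left|right].
    have [h|h] := pselect (forall y, T y -> y ∈ x); [by right|left].
    apply: contrapT => N; apply: h => y Ty; apply: contrapT => yx; apply: N.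
    exists y => //; rewrite eltsE in_succ; apply: (ord_leNgt _ _ yx).
      exact: ord_in ow1 (co_w1 co Ty).
    exact: ord_in ow1 xw.
  do 2 (apply: countableU => //); last exact: finite_set_countable.
  apply: bigcup_countable; first exact/finite_set_countable/(co_finite co).
  move=> y /(co_w1 co) yw; apply: (in_w1_countable w1P); exact: (succ_in_w1 w1P).
have ft : finite_set (top T R) by apply: sub_finite_set (co_finite co) => x [].
have [g [gZ gI]] : exists g : V -> V, (forall a, top T R a -> Z (g a)) /\
    (forall a b, top T R a -> top T R b -> g a = g b -> a = b).
  apply: card_leE; apply: card_le_trans (finite_set_countable ft) _; exact/infiniteP.
have gT a : top T R a -> ~ T (g a).
  by move=> ma Tg; have [_ _ /(_ _ Tg)/isin_irr] := gZ a ma.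
pose T1 := T `|` g @` top T R.
pose R1 x y := R x y \/ exists a, [/\ top T R a, y = g a & x = a \/ R x a].
pose F1 y := F (xget y [set a | top T R a /\ g a = y]).
have F1g a : top T R a -> F1 (g a) = F a.
  move=> ma; rewrite /F1; case: xgetP => [b _ [mb /(gI _ _ mb ma)->]//|].
  by move=> /(_ a) [].
have Rn x y : R x y -> T x /\ T y := @co_nodes _ _ _ _ _ _ _ _ _ _ co x y.
have RT x a : top T R a -> x = a \/ R x a -> T x.
  by move=> [Ta _] [->//|/Rn[]].
have R1T x y : R1 x y -> T x by move=> [/Rn[]//|[a [ma _]]]; exact: RT.
have top1 y : top T1 R1 y <-> exists2 a, top T R a & y = g a.
  split=> [[[Ty|[a ma <-]] my]|[a ma ->]]; last 1 first.
  - by split=> [|z /R1T/(gT _ ma)//]; right; exists a.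
  - case: (my (g y)); right; exists y; split=> //; last by left.
    by split=> // z yz; apply: (my z); left.
  - by exists a.
exists T1, R1, F1; split.
- split.
  + by move=> x [/(co_w1 co)//|[a /gZ[gw _ _] <-]].
  + by rewrite finite_setU; split; [exact: co_finite co|exact: finite_image].
  + move=> x y xy; split; first by left; exact: R1T xy.
    by case: xy => [/Rn[_ Ty]|[a [ma -> _]]]; [left|right; exists a].
  + move=> x y z xy [yz|[a [ma -> ya]]].
      case: xy => [xy|[a [ma e _]]]; first by left; exact: (co_trans co xy yz).
      by case: (gT a ma); rewrite -e; case: (Rn _ _ yz).
    right; exists a; split=> //.
    case: xy => [xy|[b [mb e _]]]; last by case: (gT b mb); rewrite -e; exact: RT ya.
    by right; case: ya => [<-//|ya]; exact: (co_trans co xy ya).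
  + move=> x y z [xz|[a [ma e xa]]] [yz|[b [mb e' yb]]].
    * by have [->|h|h] := co_tree co xz yz; [constructor 1|constructor 2; left|constructor 3; left].
    * by case: (gT b mb); rewrite -e'; case: (Rn _ _ xz).
    * by case: (gT a ma); rewrite -e; case: (Rn _ _ yz).
    * have ab : a = b by apply: gI => //; rewrite -e.
      subst b; case: xa yb => [->|xa] [->|ya].
      - by constructor 1.
      - by constructor 3; left.
      - by constructor 2; left.
      - by have [->|h|h] := co_tree co xa ya; [constructor 1|constructor 2; left|constructor 3; left].
  + move=> x y [/(co_in co)//|[a [ma -> xa]]].
    have [_ _] := gZ a ma; apply; exact: RT xa.
  + by move=> x /top1[a ma ->]; rewrite F1g //; exact: co_w2 co _ ma.
  + move=> x y /top1[a ma ->] /top1[b mb ->]; rewrite !F1g // => e.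
    by rewrite (co_inj co ma mb e).
  + exact: co_models co.
  + exact: co_adequate co.
  + move=> M x y AM /top1[a ma ->] /top1[b mb ->] ab; rewrite !F1g // => Fa Fb c ca cb.
    have {}ab : a <> b by move=> e; apply: ab; rewrite e.
    have inv d x' : top T R d -> R1 x' (g d) -> x' = d \/ R x' d.
      move=> md [/Rn[_ /(gT _ md)]//|[d' [md' /(gI _ _ md md')->]]//].
    have nR d d' : top T R d -> ~ R d d' by case.
    case: (inv _ _ ma ca) (inv _ _ mb cb) => [->|{}ca] [e|{}cb].
    * by case: ab.
    * by case: (nR _ _ ma cb).
    * by subst c; case: (nR _ _ mb ca).
    * exact: (co_sep co AM ma mb ab Fa Fb ca cb).
- by left.
- move=> x y Tx Ty; split=> [[//|[a [ma e _]]]|]; last by left.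
  by case: (gT a ma); rewrite -e.
- move=> a ma; exists (g a); rewrite F1g //; split=> //; first by apply/top1; exists a.
  by right; exists a; split=> //; left.
- by move=> b /top1[a /gZ[_ nB _] ->].
Qed.

End Topping.

(** * Gluing two trees over a countable model *)

Section Amalgam.
Context (V : zfc) (w1 w2 : V) (w1P : is_omega1 w1).
Context (Y : set V) (sk : skolem_family V langA) (Gamma : set V).
Implicit Types (x y z a b c M : V).
Context (N M0 : V) (M0E : M0 = cap N w2).
Context (N_countable : forall x, x ∈ N -> countable (elts x) -> elts x `<=` elts N).
Context (T : set V) (R : V -> V -> Prop) (F : V -> V) (A : set V).
Context (coT : condition_on w1 w2 Y sk Gamma T R F A) (AM0 : A M0).
Context (T_out : forall a, top T R a -> ~ a ∈ N).
Context (S : set V) (RS : V -> V -> Prop) (G : V -> V) (B : set V).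
Context (coS : condition_on w1 w2 Y sk Gamma S RS G B).
Context (SN : S `<=` elts N) (GN : forall x, top S RS x -> G x ∈ N) (BN : B `<=` elts N).
Context (bar up : V -> V).
Context (bar_id : forall x, T x -> x ∈ N -> bar x = x).
Context (bar_S : forall x, T x -> S (bar x)).
Context (bar_R : forall x y, T x -> T y -> (RS (bar x) (bar y) <-> R x y)).
Context (bar_inj : forall x y, T x -> T y -> bar x = bar y -> x = y).
Context (bar_F_inj : forall a b, top T R a -> top T R b -> bar (F a) = bar (F b) -> F a = F b).
Context (bar_F_id : forall a, top T R a -> F a ∈ N -> bar (F a) = F a).
Context (up_top : forall a, top T R a -> top S RS (up a)).
Context (up_bar : forall a, top T R a -> bar a = up a \/ RS (bar a) (up a)).
Context (up_G : forall a, top T R a -> G (up a) = bar (F a)).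

Definition weak (R : V -> V -> Prop) x y := x = y \/ R x y.

(* The S-nodes that have to lie below the node y of T outside N: the tops
   [up a] carrying a value [F a] in N that y (or a node outside N below both y
   and a) shares with a, and the nodes of T in N below y. *)
Definition stem z y :=
  (exists a y0, [/\ top T R a /\ F a ∈ N, T y0 /\ ~ y0 ∈ N, weak R y0 y, weak R y0 a & z = up a])
  \/ [/\ T z, z ∈ N & R z y].

(** Cross relations go only upwards from [S] to nodes of [T] outside [N]: the countable ordinals in
    [N] form an initial segment of [w1], so a node outside [N] cannot be below one inside. *)
Definition glue_lt x y := [\/ RS x y, R x y |
  [/\ S x, T y, ~ y ∈ N & exists2 z, weak RS x z & stem z y]].

Let leT_trans x y z : weak R x y -> weak R y z -> weak R x z.
Proof.
move=> [->//|xy] [<-|yz]; first by right.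
right; exact: (co_trans coT xy yz).
Qed.

Let leS_trans x y z : weak RS x y -> weak RS y z -> weak RS x z.
Proof.
move=> [->//|xy] [<-|yz]; first by right.
right; exact: (co_trans coS xy yz).
Qed.

Let ltS_le x y z : RS x y -> weak RS y z -> RS x z.
Proof. by move=> xy [<-//|yz]; exact: (co_trans coS xy yz). Qed.

Let leT_cmp x y z : weak R x z -> weak R y z -> weak R x y \/ R y x.
Proof.
move=> [->|xz] [->|yz].
- by left; left.
- by right.
- by left; right.
by have [->|h|h] := co_tree coT xz yz; [left; left|left; right|right].
Qed.

Let leS_cmp x y z : weak RS x z -> weak RS y z -> weak RS x y \/ RS y x.
Proof.
move=> [->|xz] [->|yz].
- by left; left.
- by right.
- by left; right.
by have [->|h|h] := co_tree coS xz yz; [left; left|left; right|right].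
Qed.

Let RT x y : R x y -> T x /\ T y. Proof. exact: (@co_nodes _ _ _ _ _ _ _ _ _ _ coT). Qed.
Let RSS x y : RS x y -> S x /\ S y. Proof. exact: (@co_nodes _ _ _ _ _ _ _ _ _ _ coS). Qed.

Let ST x : S x -> x ∈ N. Proof. exact: SN. Qed.

Let T_S x : T x -> x ∈ N -> S x.
Proof. by move=> Tx xN; rewrite -(bar_id Tx xN); exact: bar_S. Qed.

Let T_R x y : T x -> x ∈ N -> T y -> y ∈ N -> (RS x y <-> R x y).
Proof. by move=> Tx xN Ty yN; have := bar_R Tx Ty; rewrite !bar_id. Qed.

Let w1_N x y : y ∈ N -> y ∈ w1 -> x ∈ y -> x ∈ N.
Proof. by move=> yN /(in_w1_countable w1P); move/(N_countable yN) => h xy; exact: h. Qed.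

Let R_N x y : R x y -> y ∈ N -> x ∈ N.
Proof.
move=> xy yN; have [_ Ty] := RT xy.
exact: (w1_N yN (co_w1 coT Ty) (co_in coT xy)).
Qed.

Let up_S a : top T R a -> S (up a). Proof. by move=> /up_top[]. Qed.

Let bar_up a x : top T R a -> T x -> weak R x a -> weak RS (bar x) (up a).
Proof.
move=> ma Tx [->|xa]; first exact: up_bar.
apply: leS_trans (up_bar ma); right; apply/bar_R => //; by case: ma.
Qed.

Let M0_N x : x ∈ M0 -> x ∈ N. Proof. by rewrite M0E in_cap => -[]. Qed.

Let N_M0 x : x ∈ N -> x ∈ w2 -> x ∈ M0. Proof. by rewrite M0E in_cap. Qed.

Let top_eq a b : top T R a -> top T R b -> weak R a b -> a = b.
Proof. by move=> [_ h] _ [//|/h]. Qed.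

Let topS_eq a b : top S RS a -> weak RS a b -> a = b.
Proof. by move=> [_ h] [//|/h]. Qed.

(* Two tops with values in N only share nodes in N, since M0 is in A. *)
Let shared_top a a' y : top T R a -> top T R a' -> F a ∈ N -> F a' ∈ N ->
  T y -> ~ y ∈ N -> weak R y a -> weak R y a' -> a = a'.
Proof.
move=> ma ma' FaN Fa'N Ty yN ya ya'; apply: contrapT => ne.
have [e|{}ya] := ya; first by subst y; apply: ne; exact: top_eq ya'.
have [e|{}ya'] := ya'.
  by subst y; apply: ne; apply/esym; apply: (top_eq ma' ma); right.
apply: yN; apply: M0_N; apply: (co_sep coT AM0 ma ma' ne _ _ ya ya').
  by apply: N_M0 => //; exact: co_w2 coT _ ma.
by apply: N_M0 => //; exact: co_w2 coT _ ma'.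
Qed.

Let stem_up z y y' : stem z y -> R y y' -> stem z y'.
Proof.
move=> [[a [y0 [h1 h2 h3 h4 ->]]]|[Tz zN zy]] yy'.
  left; exists a, y0; split=> //; apply: leT_trans h3 _; by right.
by right; split=> //; exact: (co_trans coT zy yy').
Qed.

(** This explains the auxiliary [y0] in [stem]: if [y'] falls strictly below [y0], it is itself
    outside [N] and below both [y] and [a], and can replace [y0]. *)
Let stem_down z y y' : stem z y -> R y' y -> ~ y' ∈ N -> stem z y'.
Proof.
move=> [[a [y0 [h1 h2 h3 h4 ->]]]|[Tz zN zy]] y'y y'N; have [Ty' Ty] := RT y'y.
  left; have y'weak : weak R y' y by right.
  have [h|h] := leT_cmp h3 y'weak; first by exists a, y0.
  by exists a, y'; split=> //; [left|apply: leT_trans h4; right].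
have [e|h|h] := co_tree coT zy y'y.
- by subst z.
- by right.
- by case: y'N; exact: R_N h zN.
Qed.

(** No new relation arises inside [T]. If [z] is [up a], then [x] and [bar a] are both below it,
    hence comparable; since [bar] fixes [x] and reflects the order, and [a] is a top outside [N],
    the only outcome is that [x] is below [a]. *)
Let stem_T x z y : T x -> x ∈ N -> weak RS x z -> stem z y -> T y -> ~ y ∈ N -> R x y.
Proof.
move=> Tx xN xz [[a [y0 [[ma FaN] [Ty0 y0N] y0y y0a ez]]]|[Tz zN zy]] Ty yN; last first.
  by case: xz => [->//|/(T_R Tx xN Tz zN) xz]; exact: (co_trans coT xz zy).
have [Ta na] := ma.
have xa : R x a.
  subst z; have [h|h] := leS_cmp xz (up_bar ma).
    case: h => [e|]; last by rewrite -{1}(bar_id Tx xN) => /(bar_R Tx Ta).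
    case: (T_out ma); rewrite -(bar_inj Tx Ta _) //; by rewrite bar_id.
  by move: h; rewrite -{1}(bar_id Tx xN) => /(bar_R Ta Tx)/na.
have xa' : weak R x a by right.
have [[e|h]|h] := leT_cmp xa' y0a.
- by subst x.
- by case: y0y => [<-//|y0y]; exact: (co_trans coT h y0y).
- by case: y0N; exact: R_N h xN.
Qed.

(** The nodes forced below [y] form a chain. Two of the form [up a] coincide by [shared_top]; a node
    of [T] in [N] below [y] is also below [y0], hence below [a], and copying this relation puts it
    below [up a]. *)
Let stem_cmp z z' y : stem z y -> stem z' y -> T y -> ~ y ∈ N -> weak RS z z' \/ RS z' z.
Proof.
have key u a y0 : top T R a /\ F a ∈ N -> T y0 /\ ~ y0 ∈ N -> weak R y0 y ->
    weak R y0 a -> T u -> u ∈ N -> R u y -> RS u (up a).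
  move=> [ma FaN] [Ty0 y0N] y0y y0a Tu uN uy.
  have uy' : weak R u y by right.
  have uy0 : R u y0.
    have [[e|//]|h] := leT_cmp uy' y0y; first by subst u.
    by case: y0N; exact: R_N h uN.
  have [Ta _] := ma.
  apply: ltS_le (up_bar ma); rewrite -(bar_id Tu uN); apply/(bar_R Tu Ta).
  by case: y0a => [<-//|y0a]; exact: (co_trans coT uy0 y0a).
move=> [[a [y0 [h1 h2 h3 h4 ->]]]|[Tz zN zy]] [[a' [y0' [h1' h2' h3' h4' ->]]]|[Tz' zN' zy']] Ty yN.
- suff -> : a = a' by left; left.
  have [[ma FaN] [Ty0 y0N]] := (h1, h2); have [[ma' FaN'] [Ty0' y0N']] := (h1', h2').
  have [h|h] := leT_cmp h3 h3'.
    exact: shared_top Ty0 y0N h4 (leT_trans h h4').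
  by apply: (shared_top ma ma' FaN FaN' Ty0' y0N') => //; apply: leT_trans h4; right.
- by right; exact: key h1 h2 h3 h4 Tz' zN' zy'.
- by left; right; exact: key h1' h2' h3' h4' Tz zN zy.
- have [->|h|h] := co_tree coT zy zy'; first by left; left.
    by left; right; apply/(T_R Tz zN Tz' zN').
  by right; apply/(T_R Tz' zN' Tz zN).
Qed.

Let mixed x y := [/\ S x, T y, ~ y ∈ N & exists2 z, weak RS x z & stem z y].

Let R_mixed x y : R x y -> x ∈ N -> ~ y ∈ N -> mixed x y.
Proof.
move=> xy xN yN; have [Tx Ty] := RT xy; split=> //; first exact: T_S.
by exists x; [left|right].
Qed.

Let mixed_R x y : mixed x y -> T x -> R x y.
Proof. by move=> [Sx Ty yN [z xz zy]] Tx; apply: stem_T xz zy Ty yN => //; exact: ST. Qed.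

Lemma glue_T x y : T x -> T y -> (glue_lt x y <-> R x y).
Proof.
move=> Tx Ty; split=> [[h|//|h]|]; last by constructor 2.
  by have [/ST xN /ST yN] := RSS h; apply/(T_R Tx xN Ty yN).
exact: mixed_R.
Qed.

Lemma glue_S x y : S x -> S y -> (glue_lt x y <-> RS x y).
Proof.
move=> /[dup] Sx /ST xN /[dup] Sy /ST yN; split=> [[//|h|[_ _ /(_ yN)//]]|]; last by constructor 1.
by have [Tx Ty] := RT h; apply/(T_R Tx xN Ty yN).
Qed.

Let glue_cases x y : glue_lt x y -> [\/ RS x y, (R x y /\ ~ x ∈ N) /\ ~ y ∈ N | mixed x y].
Proof.
move=> [h|h|h]; [by constructor 1| |by constructor 3].
have [Tx Ty] := RT h; have [yN|yN] := pselect (y ∈ N).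
  by constructor 1; apply/T_R => //; exact: R_N h yN.
by have [xN|xN] := pselect (x ∈ N); [constructor 3; exact: R_mixed|constructor 2].
Qed.

Let glue_nodes x y : glue_lt x y -> (S `|` T) x /\ (S `|` T) y.
Proof.
move=> [/RSS[Sx Sy]|/RT[Tx Ty]|[Sx Ty _ _]].
- by split; left.
- by split; right.
- by split; [left|right].
Qed.

Let glue_in x y : glue_lt x y -> x ∈ y.
Proof.
move=> [/(co_in coS)//|/(co_in coT)//|[Sx Ty yN _]].
have ow := w1_ord w1P; have xw := co_w1 coS Sx; have yw := co_w1 coT Ty.
have [//|e|h] := ord_total (ord_in ow xw) (ord_in ow yw).
  by case: yN; rewrite -e; exact: ST.
by case: yN; exact: w1_N (ST Sx) xw h.
Qed.

Let glue_trans x y z : glue_lt x y -> glue_lt y z -> glue_lt x z.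
Proof.
move=> /glue_cases[xy|[[xy xN] yN]|xy] /glue_cases[yz|[[yz yN'] zN]|yz].
- by constructor 1; exact: (co_trans coS xy yz).
- by case: yN'; apply: ST; case: (RSS xy).
- case: yz => Sy Tz zN [u yu uz]; constructor 3; split=> //.
    by case: (RSS xy).
  by exists u => //; right; exact: ltS_le xy yu.
- by case: yN; apply: ST; case: (RSS yz).
- by constructor 2; exact: (co_trans coT xy yz).
- by case: yN; apply: ST; case: yz.
- by case: xy => _ _ yN; case: yN; apply: ST; case: (RSS yz).
- case: xy => Sx Ty _ [u xu uy]; constructor 3; split=> //; first by case: (RT yz).
  by exists u => //; exact: stem_up uy yz.
- by case: xy => _ _ yN; case: yN; apply: ST; case: yz.
Qed.

(** When both relations into [z] are mixed, [stem_cmp] provides one node of [S] above [x] and [y],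
    and treeness of [S] applies. When only one is, [stem_down] passes its stem to the other lower
    node. *)
Let glue_tree x y z : glue_lt x z -> glue_lt y z -> [\/ x = y, glue_lt x y | glue_lt y x].
Proof.
have key u v : glue_lt v z -> mixed u z -> ~ v ∈ N -> glue_lt u v.
  move=> /glue_cases[h|[[vz _] zN]|[/ST//]] [Su Tz _ [t ut tz]] vN.
    by case: vN; apply: ST; case: (RSS h).
  constructor 3; split=> //; first by case: (RT vz).
  by exists t => //; exact: stem_down tz vz vN.
move=> xz yz; have [xS|[[xz' xN] zN]|xm] := glue_cases xz;
    have [yS|[[yz' yN] zN']|ym] := glue_cases yz.
- have [->|h|h] := co_tree coS xS yS; by [constructor 1|constructor 2; constructor 1|constructor 3; constructor 1].
- by case: zN'; apply: ST; case: (RSS xS).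
- by case: ym => _ _ zN; case: zN; apply: ST; case: (RSS xS).
- by case: zN; apply: ST; case: (RSS yS).
- have [->|h|h] := co_tree coT xz' yz'; by [constructor 1|constructor 2; constructor 2|constructor 3; constructor 2].
- by constructor 3; exact: key xz ym xN.
- by case: xm => _ _ zN; case: zN; apply: ST; case: (RSS yS).
- by constructor 2; exact: key yz xm yN.
case: xm ym => Sx Tz zN [u xu uz] [Sy _ _ [v yv vz]].
have [t [xt yt]] : exists t, weak RS x t /\ weak RS y t.
  have [h|h] := stem_cmp uz vz Tz zN.
    by exists v; split=> //; exact: leS_trans xu h.
  by exists u; split=> //; apply: leS_trans yv _; right.
have [[->|h]|h] := leS_cmp xt yt; by [constructor 1|constructor 2; constructor 1|constructor 3; constructor 1].
Qed.

(** * Maximal nodes and labels of the glued tree *)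

Let covered b := exists a, [/\ top T R a, F a ∈ N & b = up a].

Lemma glue_topT a : top T R a -> top (S `|` T) glue_lt a.
Proof.
move=> ma; have aN := T_out ma; have [Ta na] := ma; split; first by right.
move=> y [/RSS[/ST//]|/na//|[/ST//]].
Qed.

Lemma glue_topS b : top S RS b -> ~ covered b -> top (S `|` T) glue_lt b.
Proof.
move=> mb nc; have [Sb nb] := mb; split; first by left.
have bN := ST Sb.
have key y z : weak RS b z -> stem z y -> T y -> ~ y ∈ N -> False.
  move=> /(topS_eq mb) <- [[a [y0 [[ma FaN] _ _ _ e]]]|[Tb _ by']] Ty yN.
    by apply: nc; exists a.
  by apply: (nb (bar y)); rewrite -(bar_id Tb bN); apply/bar_R.
move=> y /glue_cases[/nb//|[[_ /(_ bN)//]]|[_ Ty yN [z bz zy]]].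
exact: key bz zy Ty yN.
Qed.

(** As [up a] and [a] carry the same value, injectivity forbids that both remain tops; [a] takes
    over. In [stem] the node [y0] is [a] itself. *)
Lemma covered_lt a : top T R a -> F a ∈ N -> glue_lt (up a) a.
Proof.
move=> ma FaN; constructor 3; split; [exact: up_S|by case: ma|exact: T_out|].
exists (up a); first by left.
left; exists a, a; split=> //; [by split; [case: ma|exact: T_out]|by left|by left].
Qed.

Lemma glue_topP x : top (S `|` T) glue_lt x ->
  top T R x \/ [/\ top S RS x, ~ covered x & x ∈ N].
Proof.
move=> [STx nx].
have [Tx|nTx] := pselect (T x).
  by left; split=> // y xy; apply: (nx y); constructor 2.
have Sx : S x by case: STx.
right; split; last exact: ST.
  by split=> // y xy; apply: (nx y); constructor 1.
by move=> [a [ma FaN e]]; apply: (nx a); rewrite e; exact: covered_lt.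
Qed.

Definition glue_val x := if `[< x ∈ N >] then G x else F x.

Let glue_valT a : top T R a -> glue_val a = F a.
Proof. by move=> /T_out aN; rewrite /glue_val; case: asboolP. Qed.

Let glue_valS b : b ∈ N -> glue_val b = G b.
Proof. by move=> bN; rewrite /glue_val; case: asboolP. Qed.

Let glue_val_w2 x : top (S `|` T) glue_lt x -> glue_val x ∈ w2.
Proof.
move=> /glue_topP[mx|[mx _ xN]].
  by rewrite glue_valT //; exact: co_w2 coT _ mx.
by rewrite glue_valS //; exact: co_w2 coS _ mx.
Qed.

Let mixed_val a b : top T R a -> top S RS b -> ~ covered b -> F a <> G b.
Proof.
move=> ma mb nc e; have FaN : F a ∈ N by rewrite e; exact: GN.
apply: nc; exists a; split=> //; apply: (co_inj coS mb (up_top ma)).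
by rewrite up_G // bar_F_id.
Qed.

Let glue_val_inj x y : top (S `|` T) glue_lt x -> top (S `|` T) glue_lt y ->
  glue_val x = glue_val y -> x = y.
Proof.
move=> /glue_topP[mx|[mx cx xN]] /glue_topP[my|[my cy yN]];
  rewrite ?(glue_valT mx) ?(glue_valT my) ?(glue_valS xN) ?(glue_valS yN).
- exact: (co_inj coT).
- by move=> /(mixed_val mx my cy).
- by move=> /esym/(mixed_val my mx cx).
- exact: (co_inj coS).
Qed.

(* The top of S standing for the top x of the glued tree. *)
Let hat x := if `[< x ∈ N >] then x else up x.

Let hatT a : top T R a -> hat a = up a.
Proof. by move=> /T_out aN; rewrite /hat; case: asboolP. Qed.

Let hatS b : b ∈ N -> hat b = b.
Proof. by move=> bN; rewrite /hat; case: asboolP. Qed.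

Let hat_top x : top (S `|` T) glue_lt x -> top S RS (hat x).
Proof.
by move=> /glue_topP[mx|[mx _ xN]]; [rewrite hatT //; exact: up_top|rewrite hatS].
Qed.

Let glue_out x y c : glue_lt c x -> ~ c ∈ N -> R c x.
Proof.
by move=> /glue_cases[/RSS[/ST//]|[[]]//|[/ST//]].
Qed.

Let out_top c x : top (S `|` T) glue_lt x -> glue_lt c x -> ~ c ∈ N -> top T R x /\ R c x.
Proof.
move=> mx cx cN; have {}cx := glue_out x cx cN.
split=> //; case: (glue_topP mx) => // -[_ _ xN].
by case: cN; exact: R_N cx xN.
Qed.

Let glue_N x c : glue_lt c x -> x ∈ N -> RS c x.
Proof. by move=> /glue_cases[//|[_ xN /xN]|[_ _ xN _ /xN]]. Qed.

(* A node c in N below x is below the substitute of x, unless x has a node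
   outside N whose copy in S is below both c and the substitute. *)
Let below_hat c x : top (S `|` T) glue_lt x -> glue_lt c x -> c ∈ N ->
  weak RS c (hat x) \/
  exists r, [/\ T r /\ ~ r ∈ N, weak RS (bar r) c & weak RS (bar r) (hat x)].
Proof.
move=> mx cx cN; have [mx'|[mx' _ xN]] := glue_topP mx; last first.
  by left; rewrite hatS //; right; exact: glue_N.
rewrite hatT //; have xN := T_out mx'; have [Tx nx] := mx'.
have [/RSS[_ /ST//]|[[_ /(_ cN)//]]|[Sc _ _ [z cz zx]]] := glue_cases cx.
case: zx => [[a [y0 [[ma FaN] [Ty0 y0N] y0x y0a ez]]]|[Tz zN zx]].
  subst z; have [h|h] := leS_cmp cz (bar_up ma Ty0 y0a).
    by left; apply: leS_trans h _; exact: bar_up.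
  by right; exists y0; split=> //; [right|exact: bar_up].
left; apply: leS_trans cz _; rewrite -(bar_id Tz zN); apply: bar_up => //; by right.
Qed.

(** Once the value of [x] is in [N], [shared_top] identifies [a] with [x], and the second
    alternative of [below_hat] disappears. *)
Let below_hat_N c x : top (S `|` T) glue_lt x -> glue_val x ∈ N -> glue_lt c x -> c ∈ N ->
  weak RS c (hat x).
Proof.
move=> mx vN cx cN; have [mx'|[mx' _ xN]] := glue_topP mx; last first.
  by rewrite hatS //; right; exact: glue_N.
rewrite hatT //; have xN := T_out mx'; have [Tx nx] := mx'.
rewrite glue_valT // in vN.
have [/RSS[_ /ST//]|[[_ /(_ cN)//]]|[Sc _ _ [z cz zx]]] := glue_cases cx.
case: zx => [[a [y0 [[ma FaN] [Ty0 y0N] y0x y0a ez]]]|[Tz zN zx]].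
  by rewrite (shared_top mx' ma vN FaN Ty0 y0N y0x y0a) -ez.
apply: leS_trans cz _; rewrite -(bar_id Tz zN); apply: bar_up => //; by right.
Qed.

(** * The separation clause in the glued tree *)

Let sepS M x y c : B M -> top S RS x -> top S RS y -> x <> y ->
  G x ∈ M -> G y ∈ M -> weak RS c x -> weak RS c y -> c ∈ M.
Proof.
move=> BM mx my ne xM yM cx cy.
have cx' : RS c x.
  by case: cx => // e; subst c; case: ne; exact: topS_eq cy.
have cy' : RS c y.
  by case: cy => // e; subst c; case: ne; apply/esym; exact: topS_eq cx.
exact: (co_sep coS BM mx my ne xM yM).
Qed.

Context (B_sub : forall M, B M -> elts M `<=` elts N).
Context (adequateAB : adequate w2 Y sk Gamma (A `|` B)).
(** Either [M] contains every countable ordinal of [N], and separation at nodes of [N] is automatic,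
    or [M] has a copy [M'] among the models of [S]. *)
Context (reflected : forall M, A M -> (forall x, x ∈ N -> x ∈ w1 -> x ∈ M) \/
  exists M', [/\ B M', forall x, x ∈ M -> x ∈ N -> x ∈ M',
    forall x, x ∈ w1 -> (x ∈ M' -> x ∈ M) /\ (x ∈ M -> x ∈ N),
    forall a, top T R a -> (F a ∈ M -> bar (F a) ∈ M') /\ (bar (F a) ∈ M -> F a ∈ N) &
    forall x, T x -> bar x ∈ M' -> x ∈ M]).

Let glue_w1 x y : glue_lt x y -> x ∈ w1.
Proof. by move=> /glue_nodes[[/(co_w1 coS)|/(co_w1 coT)]]. Qed.

(** Both values are in [N]. A common node outside [N] would contradict separation by [M0] in [T];
    one inside lies below two tops of [S] that carry the same two values, and separation by [M] in
    [S] applies. *)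
Let sepB M x y c : B M -> top (S `|` T) glue_lt x -> top (S `|` T) glue_lt y ->
  x <> y -> glue_val x ∈ M -> glue_val y ∈ M -> glue_lt c x -> glue_lt c y -> c ∈ M.
Proof.
move=> BM mx my ne xM yM cx cy.
have xN := B_sub BM xM; have yN := B_sub BM yM.
have [cN|cN] := pselect (c ∈ N); last first.
  have [tx Rx] := out_top mx cx cN; have [ty Ry] := out_top my cy cN.
  case: cN; apply: M0_N; apply: (co_sep coT AM0 tx ty ne _ _ Rx Ry).
    by rewrite -glue_valT //; apply: N_M0 => //; exact: glue_val_w2.
  by rewrite -glue_valT //; apply: N_M0 => //; exact: glue_val_w2.
have Ghat z : top (S `|` T) glue_lt z -> glue_val z ∈ N -> G (hat z) = glue_val z.
  move=> /glue_topP[mz|[mz _ zN]]; last by rewrite hatS // glue_valS.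
  by rewrite hatT // glue_valT // => FzN; rewrite up_G // bar_F_id.
apply: (sepS BM (hat_top mx) (hat_top my)); rewrite ?Ghat //.
- by move=> e; apply: ne; apply: glue_val_inj => //; rewrite -(Ghat x) // -(Ghat y) // e.
- exact: below_hat_N.
- exact: below_hat_N.
Qed.

(** Outside [N] the situation is that of [T]. For [c] in [N] the substitutes of [x] and [y] are
    distinct tops of [S] with values in [M'], and separation by [M'] applies once [c] is known to be
    below both. *)
Let sepA M x y c : A M -> top (S `|` T) glue_lt x -> top (S `|` T) glue_lt y ->
  x <> y -> glue_val x ∈ M -> glue_val y ∈ M -> glue_lt c x -> glue_lt c y -> c ∈ M.
Proof.
move=> AM mx my ne xM yM cx cy.
have [cN|cN] := pselect (c ∈ N); last first.
  have [tx Rx] := out_top mx cx cN; have [ty Ry] := out_top my cy cN.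
  by rewrite !glue_valT // in xM yM; exact: (co_sep coT AM tx ty ne xM yM).
have [NM|[M' [BM' MM' w1M' FM' TM']]] := reflected AM.
  by apply: NM => //; exact: glue_w1 cx.
have Ghat z : top (S `|` T) glue_lt z -> glue_val z ∈ M -> G (hat z) ∈ M'.
  move=> /glue_topP[mz|[mz _ zN]].
    by rewrite glue_valT // hatT // up_G //; exact: (FM' _ mz).1.
  by rewrite glue_valS // hatS // => GM; apply: MM' => //; exact: GN.
have mixed_hat a b : top T R a -> top S RS b -> ~ covered b -> G b ∈ M -> up a <> b.
  move=> ma mb nc GM e; apply: nc; exists a; split=> //.
  by apply: (FM' _ ma).2; rewrite -up_G // e.
(* In the mixed case a coincidence would put the copied value of the [T]-top in [M]; then its
   original value is in [N], and the [S]-top would be covered. *)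
have hat_ne : hat x <> hat y.
  move: mx my xM yM => /glue_topP[mx|[mx ncx xN]] /glue_topP[my|[my ncy yN]].
  - rewrite !hatT // => _ _ e; apply: ne; apply: (co_inj coT) => //.
    by apply: bar_F_inj => //; rewrite -!up_G // e.
  - by rewrite glue_valT // (glue_valS yN) (hatT mx) (hatS yN) => _; exact: mixed_hat.
  - rewrite (glue_valT my) (glue_valS xN) (hatT my) (hatS xN) => xM _ /esym.
    exact: mixed_hat.
  - by rewrite !hatS.
have hx := hat_top mx; have hy := hat_top my.
have Gx := Ghat _ mx xM; have Gy := Ghat _ my yM.
(* A copy [bar r] below both substitutes is in [M'] by separation, so [r] is in [M]; but the
   countable ordinals of [M] are in [N] here. This excludes the exceptional case of [below_hat]. *)
have no_root r : T r /\ ~ r ∈ N -> weak RS (bar r) (hat x) -> weak RS (bar r) (hat y) -> False.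
  move=> [Tr rN] rx ry; apply: rN; have [_] := w1M' r (co_w1 coT Tr); apply.
  by apply: TM' => //; exact: (sepS BM' hx hy hat_ne Gx Gy rx ry).
have [cx'|[r [Tr rc rx]]] := below_hat mx cx cN;
    have [cy'|[r' [Tr' rc' ry]]] := below_hat my cy cN.
- have [+ _] := w1M' c (glue_w1 cx); apply.
  exact: (sepS BM' hx hy hat_ne Gx Gy cx' cy').
- by case: (no_root r' Tr') => //; exact: leS_trans rc' cx'.
- by case: (no_root r Tr) => //; exact: leS_trans rc cy'.
have [h|h] := leS_cmp rc rc'.
  by case: (no_root r Tr) => //; exact: leS_trans h ry.
by case: (no_root r' Tr') => //; apply: leS_trans rx; right.
Qed.

Lemma condition_glue : condition_on w1 w2 Y sk Gamma (S `|` T) glue_lt glue_val (A `|` B).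
Proof.
split.
- by move=> x [/(co_w1 coS)|/(co_w1 coT)].
- by rewrite finite_setU; split; [exact: co_finite coS|exact: co_finite coT].
- exact: glue_nodes.
- exact: glue_trans.
- exact: glue_tree.
- exact: glue_in.
- exact: glue_val_w2.
- exact: glue_val_inj.
- by rewrite finite_setU; split; [exact: co_models coT|exact: co_models coS].
- exact: adequateAB.
move=> M a b [AM|BM] ma mb ab aM bM c; first exact: sepA.
exact: sepB.
Qed.

Lemma glue_extends_T a : top T R a ->
  [/\ top (S `|` T) glue_lt a, a = a \/ glue_lt a a & F a = glue_val a].
Proof. by move=> ma; rewrite glue_valT //; split; [exact: glue_topT|left|]. Qed.

Lemma glue_extends_S b : top S RS b -> exists a,
  [/\ top (S `|` T) glue_lt a, b = a \/ glue_lt b a & G b = glue_val a].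
Proof.
move=> mb; have [[a [ma FaN ->]]|nc] := pselect (covered b).
  exists a; split; [exact: glue_topT|by right; exact: covered_lt|].
  by rewrite glue_valT // up_G // bar_F_id.
exists b; split; [exact: glue_topS|by left|].
by rewrite glue_valS //; case: mb => /ST.
Qed.

End Amalgam.

(** * Strong genericity *)

Section Genericity.
Context (V : zfc) (w1 w2 : V) (w1P : is_omega1 w1) (w2P : is_omega2 w1 w2).
Context (pi : V -> V) (Y : set V) (sk : skolem_family V langA) (Gamma : set V).
Context (pi_bij : set_bij (elts w2) (Hset w2) pi).
Context (Y_sub : Y `<=` Pomega1 (elts w2)) (Y_thin : thin w1 w2 Y).
Context (Y_init : forall a b : V, Y a -> b ∈ w2 -> Y (cap a b)).
Context (skP : definable_skolem_functions (interpA w2 pi Y) (Hset w2) sk).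
Context (Gamma_sub : Gamma `<=` Lambda w1 w2 sk).
Context (Gamma_stat : stationary_in w2 Gamma).
Implicit Types (x y z a b c p q r M : V).

Local Notation P := (poset w1 w2 Y sk Gamma).
Local Notation condition_on := (@condition_on V w1 w2 Y sk Gamma).
Local Notation beta := (comparison_point Gamma).

Lemma condition_sub_models T R F (A A' : set V) :
  A' `<=` A -> condition_on T R F A -> condition_on T R F A'.
Proof.
move=> sA [h1 h2 h3 h4 h5 h6 h7 h8 h9 [h10 h10'] h11]; split=> //.
- exact: sub_finite_set sA h9.
- by split=> [M /sA/h10//|M L /sA AM /sA AL]; exact: h10'.
- by move=> M a b /sA; exact: h11.
Qed.

(* The facts about a condition that its reflection into a model has to keep. *)
Definition atom (k : 'I_10) x y z : Prop :=
  match nat_of_ord k with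
  | 0 => x = y
  | 1 => x ∈ y
  | 2 => P x
  | 3 => nodes x y
  | 4 => below x y z
  | 5 => top (nodes x) (below x) y
  | 6 => label x y = z
  | 7 => mods x y
  | 8 => x = cap y z
  | _ => Gamma x
  end.

Context (t : V) (ot : ordinal t) (w2t : w2 ∈ t) (PH : P `<=` Hset t).
Context (A0 : set V) (N : V) (gm : good_model w2 Y sk atom t A0 N).

Local Notation M0 := (cap N w2).
Local Notation H := (Hset t).

Let N_countable := good_countable gm.

Let XM0 : Xset w2 Y sk M0 := good_X gm.

Let hull_N x : Sk sk (elts M0) x -> x ∈ N.
Proof. by rewrite (good_hull gm) => -[]. Qed.

Let N_hull x : x ∈ N -> Hset w2 x -> Sk sk (elts M0) x.
Proof. by rewrite (good_hull gm). Qed.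

Let H_H x : Hset w2 x -> H x. Proof. exact: (H_w2 ot w2t). Qed.

Let w2_H x : x ∈ w2 -> H x. Proof. by move=> /(w2_sub_H w2P)/H_H. Qed.

Let w1_w2 x : x ∈ w1 -> x ∈ w2.
Proof. by move=> xw; exact: (ord_trans (w2_ord w2P) xw (w1_in_w2 w1P w2P)). Qed.

Let X_Hset M : Xset w2 Y sk M -> Hset w2 M.
Proof. by move=> /(X_HC w1P w2P Y_sub)/(HC_Hset w2P). Qed.

Let M0_N x : x ∈ M0 -> x ∈ N. Proof. by rewrite in_cap => -[]. Qed.

Let N_M0 x : x ∈ N -> x ∈ w2 -> x ∈ M0. Proof. by rewrite in_cap. Qed.

(** All models of [p] are in the hull of [M0], and all nodes of [p] are in [M0]: neither adequacy
    nor separation is endangered. *)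
Lemma model_extension p : P p -> p ∈ N -> exists q, [/\ P q, poset_le q p & mods q M0].
Proof.
move=> Pp pN; have co := poset_condition Pp.
have [nN mN _] := condition_model N_countable Pp pN.
have adq : adequate w2 Y sk Gamma (mods p `|` [set M0]).
  apply: (adequate_add w1P w2P Y_sub skP Gamma_sub Gamma_stat (co_adequate co) XM0).
  move=> M pM; apply: N_hull; first exact: mN.
  exact/X_Hset/(adequate_X (co_adequate co) pM).
have [q [Pq qn qlt qval qm]] : exists q, [/\ P q, nodes q = nodes p,
    forall x y, below q x y <-> below p x y,
    forall x, top (nodes p) (below p) x -> label q x = label p x & mods q = mods p `|` [set M0]].
  apply: condition_poset; case: co => h1 h2 h3 h4 h5 h6 h7 h8 h9 h10 h11; split=> //.
    by rewrite finite_setU; split=> //; exact: finite_set1.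
  move=> M a b [pM|->]; first exact: h11.
  move=> _ _ _ _ _ c /h3[nc _] _; apply: N_M0; first exact: nN.
  exact/w1_w2/h1.
exists q; split=> //; last by rewrite qm; right.
apply/(poset_leP Pp Pq); rewrite qn qm; split=> // a ma.
exists a; split; [|by left|by rewrite qval].
by case: ma => na h; split=> // y /qlt; exact: h.
Qed.

Lemma model_generic q : mods q M0 -> P q -> countable (elts N) ->
  strongly_generic P (@poset_le V) (elts N) q.
Proof.
move=> qM0 Pq cN D [DP Ddense] r Pr /(poset_leP Pq Pr)[_ _ qr _].
have [T [R [F [coT nT ltT topT T_out]]]] := condition_raise_tops w1P (poset_condition Pr) cN.
set A := mods r in coT.
have AM0 : A M0 by exact: qr.
have aA := co_adequate coT.
have AX M : A M -> Xset w2 Y sk M by move=> AM; exact: (adequate_X aA AM).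
pose K M := cap M (beta M M0).
(* By adequacy, a model of [A] outside [L] contains all countable ordinals of [N], so only the
   models in [L] are copied. *)
pose L : set V := [set M | A M /\ Sk sk (elts M0) (K M)].
have LA : L `<=` A by move=> M [].
have coL := condition_sub_models LA coT.
have [p0 [Pp0 p0n p0lt p0v p0m]] := condition_poset coL.
have {}p0lt : below p0 = R by apply: funext => x; apply: funext => y; exact/propext.
have /finite_seqP[sT sTE] := co_finite coT.
have /finite_seqP[sU sUE] : finite_set (top T R).
  by apply: sub_finite_set (co_finite coT) => x [].
have /finite_seqP[sL sLE] := co_models coL.
pose l := p0 :: sT ++ [seq F a | a <- sU] ++ sL ++ [seq beta M M0 | M <- sL] ++ [seq K M | M <- sL].
have lp : p0 \in l by exact: mem_head.
have lT x : T x -> x \in l.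
  by rewrite sTE => xT; rewrite inE !mem_cat xT !orbT.
have lF a : top T R a -> F a \in l.
  by rewrite sUE => aU; rewrite inE !mem_cat (map_f F aU) !orbT.
have lL M : L M -> M \in l.
  by rewrite sLE => ML; rewrite inE !mem_cat (_ : M \in sL) ?orbT.
have lb M : L M -> beta M M0 \in l.
  by rewrite sLE => ML; rewrite inE !mem_cat (map_f (fun M => beta M M0) ML) !orbT.
have lK M : L M -> K M \in l.
  by rewrite sLE => ML; rewrite inE !mem_cat (map_f K ML) !orbT.
have Gb M : A M -> Gamma (beta M M0).
  by move=> /AX XM; exact: (beta_Gamma w1P w2P Y_sub Gamma_sub Gamma_stat).
have KN M : L M -> K M ∈ N by move=> [_ /hull_N].
have KwS M : A M -> elts (K M) `<=` elts w2 by move=> /AX; exact: (cap_w2 Y_sub).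
have Kc M : A M -> countable (elts (K M)) by move=> /AX; exact: (cap_countable Y_sub).
have lH x : x \in l -> H x.
  rewrite inE => /orP[/eqP->|]; first exact: PH.
  rewrite !mem_cat => /or4P[xT|/mapP[a aU ->]|xL|/orP[/mapP[M ML ->]|/mapP[M ML ->]]].
  - apply/w2_H/w1_w2/(co_w1 coT); by rewrite sTE.
  - apply: w2_H; apply: (co_w2 coT); by rewrite sUE.
  - apply/H_H/X_Hset/AX/LA; by rewrite sLE.
  - have /LA AM : L M by rewrite sLE.
    exact/w2_H/(Gamma_w2 Gamma_sub)/Gb.
  - have /LA AM : L M by rewrite sLE.
    apply/H_H/(HC_Hset w2P)/(w2_countable_HC w1P w2P); [exact: KwS|exact: Kc].
have [bar [barN bar_id0 barA0]] := good_reflect gm lH.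
have barA k (hk : (k < 10)%N) x y z : x \in l -> y \in l -> z \in l ->
    atom (Ordinal hk) x y z <-> atom (Ordinal hk) (bar x) (bar y) (bar z) by exact: barA0.
set w := bar p0; have wN : w ∈ N by exact: barN.
have Pw : P w by apply: (iffLR (barA 2 isT p0 p0 p0 lp lp lp)).
have [s Ds /(poset_leP Pw (DP _ Ds).2)[ws_n ws_lt ws_m ws_top]] := Ddense w (conj wN Pw).
have [sN Ps] := DP _ Ds.
have coS := poset_condition Ps.
have [SN BN GN] := condition_model N_countable Ps sN.
have bar_id x : T x -> x ∈ N -> bar x = x by move=> /lT; exact: bar_id0.
have bar_w x : T x -> nodes w (bar x).
  move=> Tx; apply: (iffLR (barA 3 isT p0 x x lp (lT _ Tx) (lT _ Tx))).
  by rewrite /atom /= p0n.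
have bar_S x : T x -> nodes s (bar x) by move=> /bar_w/ws_n.
have bar_R x y : T x -> T y -> (below s (bar x) (bar y) <-> R x y).
  move=> Tx Ty; rewrite ws_lt; [|exact: bar_w|exact: bar_w].
  by have := barA 4 isT p0 x y lp (lT _ Tx) (lT _ Ty); rewrite /atom /= p0lt => ->.
have bar_eq x y : x \in l -> y \in l -> bar x = bar y -> x = y.
  by move=> xl yl; exact: (iffRL (barA 0 isT x y x xl yl xl)).
have bar_mem x y : x \in l -> y \in l -> (x ∈ y <-> bar x ∈ bar y).
  by move=> xl yl; exact: (barA 1 isT x y x xl yl xl).
have /choice[up upP] : forall a, exists b, top T R a -> [/\ top (nodes s) (below s) b,
    bar a = b \/ below s (bar a) b & label s b = bar (F a)].
  move=> a; have [ma|] := pselect (top T R a); last by exists a.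
  have al := lT _ ma.1; have mwa : top (nodes w) (below w) (bar a).
    apply: (iffLR (barA 5 isT p0 a a lp al al)).
    by rewrite /atom /= p0n p0lt.
  have [b [mb ab eb]] := ws_top _ mwa; exists b => _; split=> //.
  rewrite -eb; apply: (iffLR (barA 6 isT p0 a (F a) lp al (lF _ ma))).
  by rewrite /atom /= p0v.
(* [K M] is in [N], so [bar] fixes it, while [M] and its comparison point may move; the equation
   defining [K M] passes to the copies. *)
have bar_L M : L M -> [/\ mods s (bar M), Gamma (bar (beta M M0)) &
    cap (bar M) (bar (beta M M0)) = K M].
  move=> LM; have [[Ml bl] Kl] := (lL _ LM, lb _ LM, lK _ LM).
  split.
  - apply: ws_m; apply: (iffLR (barA 7 isT p0 M M lp Ml Ml)).
    by rewrite /atom /= p0m.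
  - by apply: (iffLR (barA 9 isT _ M M bl Ml Ml)); exact: Gb (LA _ LM).
  - rewrite -(bar_id0 _ Kl (KN _ LM)); apply/esym.
    exact: (iffLR (barA 8 isT _ _ _ Kl Ml bl)).
have B_hull : mods s `<=` Sk sk (elts M0).
  move=> M BM; apply: N_hull; first exact: BN.
  exact/X_Hset/(adequate_X (co_adequate coS) BM).
have adAB : adequate w2 Y sk Gamma (A `|` mods s).
  apply: (adequate_amalgam w1P w2P pi_bij Y_sub Y_thin Y_init skP Gamma_sub Gamma_stat
    aA (co_adequate coS) AM0 B_hull) => M AM KM.
  have LM : L M by [].
  by have [h1 h2 h3] := bar_L _ LM; exists (bar M), (bar (beta M M0)).
have B_sub M : mods s M -> elts M `<=` elts N.
  move=> BM; apply: N_countable; first exact: BN.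
  exact: (X_countable Y_sub (adequate_X (co_adequate coS) BM)).
have w1_beta M x : A M -> x ∈ w1 -> x ∈ beta M M0.
  by move=> AM; exact: (Gamma_w1 w2P Gamma_sub (Gb _ AM)).
have KM0 M : L M -> elts (K M) `<=` elts N.
  by move=> LM; apply: N_countable; [exact: KN|exact: Kc (LA _ LM)].
(* The three cases of adequacy of [M] and [M0]. As their comparison point exceeds all countable
   ordinals, the first and third give the first alternative here, and the second gives the copy. *)
have reflected M : A M -> (forall x, x ∈ N -> x ∈ w1 -> x ∈ M) \/
  exists M', [/\ mods s M', forall x, x ∈ M -> x ∈ N -> x ∈ M',
    forall x, x ∈ w1 -> (x ∈ M' -> x ∈ M) /\ (x ∈ M -> x ∈ N),
    forall a, top T R a -> (F a ∈ M -> bar (F a) ∈ M') /\ (bar (F a) ∈ M -> F a ∈ N) &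
    forall x, T x -> bar x ∈ M' -> x ∈ M].
  move=> AM; have XM := AX _ AM.
  have M0K x : x ∈ N -> x ∈ w1 -> x ∈ cap M0 (beta M M0).
    by move=> xN xw; rewrite in_cap; split; [apply: N_M0 => //; exact: w1_w2|exact: w1_beta].
  have [e|h|h] := adequate_comparable aA AM AM0.
  - by left=> x xN xw; have := M0K x xN xw; rewrite -e in_cap => -[].
  - have LM : L M by []; have [BM' Gz eK] := bar_L _ LM.
    have inK x : x ∈ K M <-> x ∈ bar M /\ x ∈ bar (beta M M0) by rewrite -eK in_cap.
    (* [common_in_beta] puts everything common to [M] and [N] below the comparison point, hence in
       [K M]. *)
    have MNK x : x ∈ M -> x ∈ N -> x ∈ K M.
      move=> xM xN; rewrite in_cap; split=> //.
      apply: (common_in_beta w1P w2P Y_sub skP Gamma_sub Gamma_stat XM XM0 xM).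
      by apply: N_M0 => //; exact: (X_w2 Y_sub XM).
    right; exists (bar M); split=> //.
    + by move=> x xM xN; case: (iffLR (inK x) (MNK x xM xN)).
    + move=> x xw; split=> [xM'|xM].
        have : x ∈ K M.
          by apply/inK; split=> //; exact: (Gamma_w1 w2P Gamma_sub Gz).
        by rewrite in_cap => -[].
      by apply: (KM0 _ LM); rewrite eltsE in_cap; split=> //; exact: w1_beta.
    + move=> a ma; split; first by move=> FM; apply: (iffLR (bar_mem _ _ (lF _ ma) (lL _ LM))).
      (* A copied value in [M] lies in [K M], which is its own copy; reflecting this membership back
         puts the original value in [K M], a subset of [N]. *)
      move=> bFM; have := MNK _ bFM (barN _ (lF _ ma)).
      rewrite -(bar_id0 _ (lK _ LM) (KN _ LM)) => /(iffRL (bar_mem _ _ (lF _ ma) (lK _ LM))).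
      exact: KM0.
    + by move=> x Tx /(iffRL (bar_mem _ _ (lT _ Tx) (lL _ LM))).
  - left=> x xN xw.
    apply: (Sk_sub w1P w2P Y_sub skP XM h); [exact: (cap_w2 Y_sub XM0)|exact: (cap_countable Y_sub _ XM0)|].
    exact: M0K.
have up_top a : top T R a -> top (nodes s) (below s) (up a) by move=> /upP[].
have up_bar a : top T R a -> bar a = up a \/ below s (bar a) (up a) by move=> /upP[].
have up_G a : top T R a -> label s (up a) = bar (F a) by move=> /upP[].
have bar_inj x y : T x -> T y -> bar x = bar y -> x = y.
  by move=> /lT xl /lT yl; exact: bar_eq.
have bar_F_inj a b : top T R a -> top T R b -> bar (F a) = bar (F b) -> F a = F b.
  by move=> /lF al /lF bl; exact: bar_eq.
have bar_F_id a : top T R a -> F a ∈ N -> bar (F a) = F a by move=> /lF; exact: bar_id0.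
have coU := condition_glue w1P (erefl M0) N_countable coT AM0 T_out coS SN GN bar_id bar_S
  bar_R bar_F_inj bar_F_id up_top up_bar up_G B_sub adAB reflected.
have [u [Pu un ult uv um]] := condition_poset coU.
have {}ult : below u = glue_lt N T R F (nodes s) (below s) up.
  by apply: funext => x; apply: funext => y; exact/propext.
exists s, u; split=> //.
- apply/(poset_leP Ps Pu); rewrite un ult um; split.
  + by move=> x; left.
  + by move=> x y; exact: (glue_S coT SN up bar_id bar_R).
  + by move=> x; right.
  + move=> b mb.
    have [a [ma ba e]] := glue_extends_S w1P N_countable coT T_out coS SN bar_id bar_S bar_R
      bar_F_id up_top up_G mb.
    by exists a; split=> //; rewrite uv.
- apply/(poset_leP Pr Pu); rewrite un ult um; split.
  + by move=> x /nT; right.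
  + move=> x y nx ny; rewrite -ltT //.
    exact: (glue_T w1P N_countable coT T_out coS SN bar_id bar_R bar_inj up_bar (nT _ nx) (nT _ ny)).
  + by move=> x; left.
  + move=> a /topT[b [mb ab e]].
    have [mb' _ eb] := glue_extends_T F T_out coS SN up mb.
    exists b; split=> //; first by right; constructor 2.
    by rewrite uv // -eb.
Qed.

End Genericity.

Theorem proposition7p9 (V : zfc) (w1 w2 : V)
  (pi : V -> V) (Y : set V) (sk : skolem_family V langA) (Gamma : set V)
  (w1P : is_omega1 w1) (w2P : is_omega2 w1 w2)
  (pow_w1 : [set x : V | elts x `<=` elts w1] #= elts w2)
  (pi_bij : set_bij (elts w2) (Hset w2) pi)
  (Y_sub : Y `<=` Pomega1 (elts w2))
  (Y_stat : stationary_Pomega1 (elts w2) Y)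
  (Y_thin : thin w1 w2 Y)
  (Y_init : forall a b : V, Y a -> b ∈ w2 -> Y (cap a b))
  (skP : definable_skolem_functions (interpA w2 pi Y) (Hset w2) sk)
  (Gamma_sub : Gamma `<=` Lambda w1 w2 sk)
  (Gamma_stat : stationary_in w2 Gamma) :
  strongly_proper_on_stationary_set
    (poset w1 w2 Y sk Gamma) (@poset_le V).
Proof.
(* Above the threshold [w2], H(t) includes H(omega2), so the structure on H(omega2) and its hulls
   live inside H(t). *)
exists w2; split=> [|t [ot _ _] w2t PH A A_club]; first exact: (w2_ord w2P).
have [N gm] := good_model_exists w1P w2P pi_bij Y_stat skP
  (@atom V w1 w2 Y sk Gamma) ot w2t A_club.
exists N; split; last exact: good_club gm.
split; first exact: good_elementary gm.
move=> p [pN Pp].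
have [q [Pq qp qM0]] := model_extension w1P w2P Y_sub skP Gamma_sub Gamma_stat gm Pp pN.
exists q; split=> //.
have cN : countable (elts N) by have [AH _ _] := A_club; case: (AH _ (good_club gm)).
exact: (model_generic w1P w2P pi_bij Y_sub Y_thin Y_init skP Gamma_sub Gamma_stat
  ot w2t PH gm qM0 Pq cN).
Qed.
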